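(* Let $a<b$, $T>0$, $Q=(a,b)\times(0,T]$. Let $u_0\in C([a,b])$ with $u_0(a)=-1$, $u_0(b)=1$, such that $u_0$ has finitely many zeros $x_1<\dots<x_k$ in $(a,b)$ and changes sign at each of them; set $\mathcal N_0=\{x_1,\dots,x_k\}$. Let $u$ be the unique classical solution of $$u_t=|u|u_{xx}+u(1-|u|)\ \text{in } Q,\quad u(a,t)=-1,\ u(b,t)=1\ (t\in(0,T]),\quad u(x,0)=u_0(x).$$ Then: (i) $u_x\in L^\infty(((a,b)\setminus\mathcal N_0)\times(t_0,T))$ for all $t_0\in(0,T)$, and for every $t\in(0,T]$ the function $x\mapsto u_x(x,t)$ has at most a jump discontinuity at each $x_i\in\mathcal N_0$ (i.e. the one-sided limits $u_x(x_i^\pm,t)$ exist and are finite); (ii) for every $i=1,\dots,k$ there exist $\tau_i^\pm\in[0,\infty]$, independent of $T$, such that $u_x(x_i^\pm,t)=0$ if $0<t<\tau_i^\pm$ and $u_x(x_i^\pm,t)\neq0$ if $t>\tau_i^\pm$; moreover the functions $t\mapsto u_x(x_i^\pm,t)$ are continuous on $(0,T]\setminus\{\tau_i^\pm\}$.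
   Context: With $\mathcal N=\mathcal N_0\times[0,T]$, a classical solution is a function $u\in C(\overline Q)$ such that $u(x,t)=0$ iff $(x,t)\in\mathcal N$, $u\in C^{2,1}(Q\setminus\mathcal N)$, the boundary and initial conditions hold, and the PDE holds pointwise in $Q\setminus\mathcal N$; it exists and is unique, and solutions for different $T$ are restrictions of each other (this is the sense in which $\tau_i^\pm$ is independent of $T$). $u_x(x_i^\pm,t)$ denotes $\lim_{x\to x_i^\pm}u_x(x,t)$. *)

(* Defs.v *)
From Stdlib Require Import Reals.
From Coquelicot Require Import Coquelicot.
Open Scope R_scope.

Definition cont_on (D : R * R -> Prop) (f : R -> R -> R) : Prop :=
  forall p : R * R, D p ->
    filterlim (fun q : R * R => f (fst q) (snd q)) (within D (locally p))
              (locally (f (fst p) (snd p))).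

Definition ux (u : R -> R -> R) (x t : R) : R := Derive (fun y => u y t) x.
Definition uxx (u : R -> R -> R) (x t : R) : R := Derive (fun y => ux u y t) x.

Definition is_tderiv (u : R -> R -> R) (T x t l : R) : Prop :=
  filterlim (fun s => (u x s - u x t) / (s - t))
            (within (fun s => 0 < s <= T /\ s <> t) (locally t)) (locally l).

Definition Qbar (a b T : R) (p : R * R) : Prop :=
  a <= fst p <= b /\ 0 <= snd p <= T.

Definition QmN (a b T : R) (N0 : R -> Prop) (p : R * R) : Prop :=
  a < fst p < b /\ ~ N0 (fst p) /\ 0 < snd p <= T.

Definition zset (k : nat) (xs : nat -> R) (y : R) : Prop :=
  exists i, (i < k)%nat /\ y = xs i.

Definition classical_solution (a b T : R) (u0 : R -> R) (N0 : R -> Prop)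
    (u : R -> R -> R) : Prop :=
  cont_on (Qbar a b T) u /\
  (forall x t, a <= x <= b -> 0 <= t <= T -> (u x t = 0 <-> N0 x)) /\
  (forall x t, QmN a b T N0 (x, t) ->
     ex_derive (fun y => u y t) x /\ ex_derive (fun y => ux u y t) x) /\
  cont_on (QmN a b T N0) (ux u) /\
  cont_on (QmN a b T N0) (uxx u) /\
  (exists v : R -> R -> R, cont_on (QmN a b T N0) v /\
     forall x t, QmN a b T N0 (x, t) ->
       is_tderiv u T x t (v x t) /\
       v x t = Rabs (u x t) * uxx u x t + u x t * (1 - Rabs (u x t))) /\
  (forall t, 0 < t <= T -> u a t = -1 /\ u b t = 1) /\
  (forall x, a <= x <= b -> u x 0 = u0 x).

(* Main.v *)
Require Import Defs.
From Stdlib Require Import Reals.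
From Coquelicot Require Import Coquelicot.
From Stdlib Require Import Lra Lia Psatz ClassicalEpsilon.
Open Scope R_scope.

(** On a nodal interval write w for u or -u, so that w > 0 and (ln w)_t = w_xx + 1 - w. Everything rests on one comparison principle for this degenerate equation, which needs no control of w near the zeros: if w is a subsolution, v a supersolution and w <= v on the parabolic boundary, then the time integral of (w - v)^+ is convex in x and vanishes at the ends (a form of the L^1 contraction of ln w).

Comparing w(x,t) with lam w(x, lam t) shows that t w is nondecreasing in t (Aronson-Benilan), that is w_xx >= -1 - 1/t. Hence w_x + K x is nondecreasing in x, which gives the one-sided limits of w_x and, with an explicit barrier at an end where w = 1, the bound of w_x. If g(t) is the slope at a zero, t g(t) is nondecreasing, so g is zero up to some tau and positive afterwards; g is upper semicontinuous, being an infimum of continuous functions of t. An upward jump of g from a value m > 0 is excluded by two barriers: shortly before the jump w / x exceeds m at some small distance from the zero, and this excess reaches the zero before the time of the jump. Uniqueness of u, again by comparison, makes tau independent of T. *)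

(** The difference of two solutions w and v satisfies an equation with v_xx as a zero-order
    coefficient, and nothing bounds v_xx near a zero; this is why comparison goes through an
    integrated inequality and not through a linear equation for w - v. Afterwards every estimate
    compares w with a rescaled copy of itself or with an explicit function. Near a zero w is at most
    of the order of the distance x, hence so is the diffusion coefficient, and a distance X
    corresponds to a time of order X, not X^2. Both barriers against a jump live on this scale. The
    upper one is useful only for a time of order cX, with c small and dictated by the size of the
    jump, so the lower one must carry the excess to the zero within an arbitrarily short rescaled
    time. It can, because its rate grows like ka^2 while the loss to overcome is only exp ka. The
    gain th does not depend on X, whereas g moves by a small fraction of th between the two times
    once X is small: this is the contradiction. *)

(** * Calculus in one and two variables *)

Lemma locally_2d_box (a b c d x t : R) (P : R -> R -> Prop) :
  a < x < b -> c < t < d ->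
  (forall y s, a < y < b -> c < s < d -> P y s) -> locally_2d P x t.
Proof.
  intros Hx Ht HP.
  set (e := Rmin (Rmin (x - a) (b - x)) (Rmin (t - c) (d - t))).
  assert (He : 0 < e) by (unfold e; repeat apply Rmin_pos; lra).
  assert (E1 : e <= x - a) by (unfold e; eapply Rle_trans; [apply Rmin_l|apply Rmin_l]).
  assert (E2 : e <= b - x) by (unfold e; eapply Rle_trans; [apply Rmin_l|apply Rmin_r]).
  assert (E3 : e <= t - c) by (unfold e; eapply Rle_trans; [apply Rmin_r|apply Rmin_l]).
  assert (E4 : e <= d - t) by (unfold e; eapply Rle_trans; [apply Rmin_r|apply Rmin_r]).
  exists (mkposreal e He); simpl; intros u v Hu Hv.
  apply Rabs_lt_between in Hu; apply Rabs_lt_between in Hv.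
  apply HP; lra.
Qed.

Lemma locally_itv (a b x : R) (P : R -> Prop) :
  a < x < b -> (forall y, a < y < b -> P y) -> locally x P.
Proof.
  intros Hx HP.
  assert (He : 0 < Rmin (x - a) (b - x)) by (apply Rmin_pos; lra).
  exists (mkposreal _ He); simpl; intros u Hu.
  change (Rabs (u - x) < Rmin (x - a) (b - x)) in Hu.
  pose proof (Rmin_l (x - a) (b - x)); pose proof (Rmin_r (x - a) (b - x)).
  apply Rabs_lt_between in Hu; apply HP; lra.
Qed.

Lemma continuity_2d_pt_snd (f : R -> R -> R) (x t : R) :
  continuity_2d_pt f x t -> continuous (f x) t.
Proof.
  intros H. apply continuity_2d_pt_filterlim in H.
  intros P HP. destruct (H P HP) as [e He]. exists e. intros y Hy.
  apply (He (x, y)). split; [apply ball_center|exact Hy].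
Qed.

Lemma continuity_2d_pt_fst (f : R -> R -> R) (x t : R) :
  continuity_2d_pt f x t -> continuous (fun y => f y t) x.
Proof.
  intros H. apply continuity_2d_pt_filterlim in H.
  intros P HP. destruct (H P HP) as [e He]. exists e. intros y Hy.
  apply (He (y, t)). split; [exact Hy|apply ball_center].
Qed.

Lemma is_derive_RInt_box (a b c d e t : R) (f fx : R -> R -> R) (x : R) :
  c < e -> e <= t -> t < d ->
  (forall y s, a < y < b -> c < s < d ->
     is_derive (fun z => f z s) y (fx y s) /\
     continuity_2d_pt f y s /\ continuity_2d_pt fx y s) ->
  a < x < b ->
  is_derive (fun y => RInt (f y) e t) x (RInt (fx x) e t).
Proof.
  intros Hc Het Hd H Hx.
  assert (Emin : Rmin e t = e) by (apply Rmin_left; lra).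
  assert (Emax : Rmax e t = t) by (apply Rmax_right; lra).
  replace (RInt (fx x) e t) with (RInt (fun s => Derive (fun y => f y s) x) e t).
  - apply (is_derive_RInt_param (fun y s => f y s)).
    + apply (locally_itv a b); auto. intros y Hy s Hs. rewrite Emin, Emax in Hs.
      exists (fx y s). apply H; lra.
    + intros s Hs. rewrite Emin, Emax in Hs.
      apply continuity_2d_pt_ext_loc with fx.
      * apply (locally_2d_box a b c d); try lra.
        intros y r Hy Hr. symmetry. apply is_derive_unique. apply H; lra.
      * apply H; lra.
    + apply (locally_itv a b); auto. intros y Hy.
      apply (ex_RInt_continuous (V := R_CompleteNormedModule)). intros s Hs. rewrite Emin, Emax in Hs.
      apply continuity_2d_pt_snd. apply H; lra.
  - apply RInt_ext. intros s Hs. rewrite Emin, Emax in Hs.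
    apply is_derive_unique. apply H; lra.
Qed.

Lemma nondecreasing_of_derive (f df : R -> R) (a b : R) :
  (forall x, a < x < b -> is_derive f x (df x)) ->
  (forall x, a < x < b -> 0 <= df x) ->
  forall x y, a < x -> x <= y -> y < b -> f x <= f y.
Proof.
  intros Hf Hd x y Hx Hxy Hy.
  destruct (MVT_gen f x y df) as [c [Hc E]].
  - intros z Hz. rewrite Rmin_left, Rmax_right in Hz by lra. apply Hf; lra.
  - intros z Hz. rewrite Rmin_left, Rmax_right in Hz by lra.
    apply derivable_continuous_pt. exists (df z). apply is_derive_Reals, Hf; lra.
  - rewrite Rmin_left, Rmax_right in Hc by lra.
    assert (0 <= df c * (y - x)) by (apply Rmult_le_pos; [apply Hd|]; lra). lra.
Qed.

Lemma MVT_open (f df : R -> R) (a b x y : R) :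
  (forall z, a < z < b -> is_derive f z (df z)) ->
  a < x -> x < y -> y < b ->
  exists c, x <= c <= y /\ f y - f x = df c * (y - x).
Proof.
  intros Hf Hx Hxy Hy.
  destruct (MVT_gen f x y df) as [c [Hc E]].
  - intros z Hz. rewrite Rmin_left, Rmax_right in Hz by lra. apply Hf; lra.
  - intros z Hz. rewrite Rmin_left, Rmax_right in Hz by lra.
    apply derivable_continuous_pt. exists (df z). apply is_derive_Reals, Hf; lra.
  - rewrite Rmin_left, Rmax_right in Hc by lra. exists c; auto.
Qed.

(** Adding [k / 2 * (y - x1) ^ 2] makes the function convex. An interior value above both end values
    would force its derivative to be positive somewhere and negative further right. *)
Lemma semiconvex_le_max (f f' f'' : R -> R) (a b x1 x2 k : R) :
  (forall x, a < x < b -> is_derive f x (f' x)) ->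
  (forall x, a < x < b -> is_derive f' x (f'' x)) ->
  a < x1 -> x2 < b -> 0 <= k ->
  (forall x, x1 <= x <= x2 -> - k <= f'' x) ->
  forall x, x1 <= x <= x2 -> f x <= Rmax (f x1) (f x2) + k * (x2 - x1) ^ 2.
Proof.
  intros H1 H2 Ha Hb Hk Hc x Hx.
  set (h := fun y => f y + k / 2 * (y - x1) ^ 2).
  set (h' := fun y => f' y + k * (y - x1)).
  assert (D1 : forall y, a < y < b -> is_derive h y (h' y)).
  { intros y Hy. unfold h, h'. specialize (H1 y Hy).
    auto_derive. exists (f' y); auto.
    replace (Derive (fun x0 => f x0) y) with (f' y) by (symmetry; apply is_derive_unique; auto).
    field. }
  assert (Hx2 : f x2 + k / 2 * (x2 - x1) ^ 2 <= Rmax (f x1) (f x2) + k * (x2 - x1) ^ 2).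
  { pose proof (Rmax_r (f x1) (f x2)). pose proof (pow2_ge_0 (x2 - x1)). nra. }
  assert (Hx1 : f x1 <= Rmax (f x1) (f x2) + k * (x2 - x1) ^ 2).
  { pose proof (Rmax_l (f x1) (f x2)). pose proof (pow2_ge_0 (x2 - x1)). nra. }
  assert (Hfh : f x <= h x).
  { unfold h. pose proof (pow2_ge_0 (x - x1)). nra. }
  destruct (Req_dec x x1) as [->|N1]; [lra|].
  destruct (Req_dec x x2) as [->|N2].
  { eapply Rle_trans; [apply Hfh|]; exact Hx2. }
  apply Rnot_lt_le; intros Hlt.
  assert (L1 : h x1 < h x) by (unfold h at 1; replace (x1 - x1) with 0 by ring; lra).
  assert (L2 : h x2 < h x) by (unfold h at 1; lra).
  destruct (MVT_open h h' a b x1 x D1) as [c1 [Hc1 E1]]; try lra.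
  destruct (MVT_open h h' a b x x2 D1) as [c2 [Hc2 E2]]; try lra.
  assert (P1 : 0 < h' c1) by (apply Rnot_le_lt; intros ?; nra).
  assert (P2 : h' c2 < 0) by (apply Rnot_le_lt; intros ?; nra).
  assert (c1 < c2) by (destruct (Req_dec c1 c2) as [->|]; lra).
  destruct (MVT_open f' f'' a b c1 c2 H2) as [c3 [Hc3 E3]]; try lra.
  assert (- k <= f'' c3) by (apply Hc; lra).
  unfold h' in P1, P2. nra.
Qed.

(** * Smooth maximum *)

(** The exponent [N] is real, so [a ^ N] is written [exp (N * ln a)]. Then [smax] is the l^N norm of
    (a, b), [slog] is its logarithm, and [swt] is the derivative of [slog] with respect to
    [ln a]. *)
Definition ssum (N a b : R) : R := exp (N * ln a) + exp (N * ln b).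
Definition slog (N a b : R) : R := ln (ssum N a b) / N.
Definition smax (N a b : R) : R := exp (slog N a b).
Definition swt (N a b : R) : R := exp (N * ln a) / ssum N a b.

Lemma ssum_pos (N a b : R) : 0 < ssum N a b.
Proof. unfold ssum. pose proof (exp_pos (N * ln a)). pose proof (exp_pos (N * ln b)). lra. Qed.

Lemma smax_pos (N a b : R) : 0 < smax N a b.
Proof. apply exp_pos. Qed.

Lemma swt_sym (N a b : R) : swt N b a = 1 - swt N a b.
Proof. unfold swt. pose proof (ssum_pos N a b). unfold ssum in *. rewrite (Rplus_comm (exp (N * ln b))). field. lra. Qed.

Lemma smax_sym (N a b : R) : smax N b a = smax N a b.
Proof. unfold smax, slog, ssum. now rewrite (Rplus_comm (exp (N * ln b))). Qed.

Lemma swt_pos (N a b : R) : 0 < swt N a b.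
Proof. apply Rdiv_lt_0_compat; [apply exp_pos|apply ssum_pos]. Qed.

Lemma swt_lt_1 (N a b : R) : swt N a b < 1.
Proof. pose proof (swt_pos N b a). rewrite swt_sym in H. lra. Qed.

Lemma exp_ge (x : R) : 1 + x <= exp x.
Proof. destruct (Req_dec x 0) as [->|]; [rewrite exp_0; lra|]. left. now apply exp_ineq1. Qed.

Lemma mul_exp_neg_le_1 (z : R) : 0 <= z -> z * exp (- z) <= 1.
Proof.
  intros. pose proof (exp_ge z). rewrite exp_Ropp. pose proof (exp_pos z).
  apply Rmult_le_reg_r with (exp z); auto. rewrite Rmult_assoc, Rinv_l; lra.
Qed.

(** The quantity [smax * swt / a] is the partial derivative of the norm in [a]. With y =
    [slog - ln a] >= 0 it equals exp (- (N - 1) y), while [swt] equals exp (- N y); the two differ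
    by at most y exp (- (N - 1) y), which is at most 1 / (N - 1). *)
Lemma smax_swt (N a b : R) : 1 < N -> 0 < a ->
  swt N a b <= smax N a b * swt N a b / a /\
  smax N a b * swt N a b / a <= 1 /\
  smax N a b * swt N a b / a <= swt N a b + / (N - 1).
Proof.
  intros HN Ha.
  set (y := slog N a b - ln a).
  assert (Ey : smax N a b / a = exp y).
  { unfold y, smax, Rminus. rewrite exp_plus, exp_Ropp, exp_ln; auto. }
  assert (Es : swt N a b = exp (- (N * y))).
  { unfold y, swt, slog. replace (- (N * (ln (ssum N a b) / N - ln a))) with (N * ln a + - ln (ssum N a b)) by (field; lra).
    rewrite exp_plus, exp_Ropp, exp_ln; auto. apply ssum_pos. }
  assert (Hy : 0 <= y).
  { pose proof (swt_lt_1 N a b). rewrite Es in H. apply Rnot_lt_le; intros Hn.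
    assert (exp 0 < exp (- (N * y))) by (apply exp_increasing; nra). rewrite exp_0 in H0. lra. }
  replace (smax N a b * swt N a b / a) with (smax N a b / a * swt N a b) by (field; lra).
  rewrite Ey, Es, <- exp_plus.
  assert (M : forall p q, p <= q -> exp p <= exp q).
  { intros p q [?|<-]; [left; now apply exp_increasing|lra]. }
  repeat split.
  - apply M; nra.
  - rewrite <- exp_0. apply M; nra.
  - set (z := (N - 1) * y).
    replace (y + - (N * y)) with (- z) by (unfold z; ring).
    replace (- (N * y)) with (- z + - y) by (unfold z; ring).
    rewrite exp_plus. pose proof (exp_pos (- z)). pose proof (exp_ge (- y)).
    assert (exp (- z) * y <= / (N - 1)).
    { pose proof (mul_exp_neg_le_1 z ltac:(unfold z; nra)).
      replace (exp (-z) * y) with (z * exp (- z) * / (N - 1)) by (unfold z; field; lra).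
      rewrite <- (Rmult_1_l (/ (N - 1))) at 2. apply Rmult_le_compat_r; auto.
      left. apply Rinv_0_lt_compat; lra. }
    nra.
Qed.

Lemma smax_ge_l (N a b : R) : 0 < N -> 0 < a -> a <= smax N a b.
Proof.
  intros HN Ha. unfold smax, slog. rewrite <- (exp_ln a) at 1 by auto.
  assert (ln a <= ln (ssum N a b) / N).
  { apply Rmult_le_reg_l with N; auto. replace (N * (ln (ssum N a b) / N)) with (ln (ssum N a b)) by (field; lra).
    rewrite <- (ln_exp (N * ln a)). apply ln_le. apply exp_pos. unfold ssum. pose proof (exp_pos (N * ln b)). lra. }
  destruct H as [?|E]; [left; now apply exp_increasing|rewrite <- E; lra].
Qed.

Lemma smax_ge_r (N a b : R) : 0 < N -> 0 < b -> b <= smax N a b.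
Proof. intros. rewrite <- smax_sym. now apply smax_ge_l. Qed.

(** The two powers sum to at most 2 m^N, and 2 <= e turns the factor 2 into the additive error 1 /
    N. *)
Lemma slog_le (N a b m : R) : 0 < N -> 0 < a -> 0 < b -> a <= m -> b <= m ->
  slog N a b <= ln m + / N.
Proof.
  intros HN Ha Hb Ham Hbm. unfold slog.
  apply Rmult_le_reg_l with N; auto. replace (N * (ln (ssum N a b) / N)) with (ln (ssum N a b)) by (field; lra).
  replace (N * (ln m + / N)) with (N * ln m + 1) by (field; lra).
  rewrite <- (ln_exp (N * ln m + 1)).
  apply ln_le; [apply ssum_pos|].
  rewrite exp_plus. unfold ssum.
  assert (forall p q, p <= q -> exp p <= exp q) as M.
  { intros p q [?|<-]; [left; now apply exp_increasing|lra]. }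
  assert (exp (N * ln a) <= exp (N * ln m)) by (apply M, Rmult_le_compat_l; [lra|apply ln_le; lra]).
  assert (exp (N * ln b) <= exp (N * ln m)) by (apply M, Rmult_le_compat_l; [lra|apply ln_le; lra]).
  pose proof (exp_ge 1). pose proof (exp_pos (N * ln m)). nra.
Qed.

Lemma slog_derive (N : R) (A B : R -> R) (x a' b' : R) :
  N <> 0 -> 0 < A x -> 0 < B x -> is_derive A x a' -> is_derive B x b' ->
  is_derive (fun y => slog N (A y) (B y)) x
    (swt N (A x) (B x) * (a' / A x) + (1 - swt N (A x) (B x)) * (b' / B x)).
Proof.
  intros HN HA HB DA DB. unfold slog, swt, ssum.
  pose proof (exp_pos (N * ln (A x))). pose proof (exp_pos (N * ln (B x))).
  auto_derive.
  - repeat split; try assumption; try lra; eexists; eassumption.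
  - replace (Derive (fun x0 => A x0) x) with a' by (symmetry; apply is_derive_unique; auto).
    replace (Derive (fun x0 => B x0) x) with b' by (symmetry; apply is_derive_unique; auto).
    field. repeat split; lra.
Qed.

Lemma swt_derive (N : R) (A B : R -> R) (x a' b' : R) :
  0 < A x -> 0 < B x -> is_derive A x a' -> is_derive B x b' ->
  is_derive (fun y => swt N (A y) (B y)) x
    (N * swt N (A x) (B x) * (1 - swt N (A x) (B x)) * (a' / A x - b' / B x)).
Proof.
  intros HA HB DA DB. unfold swt, ssum.
  pose proof (exp_pos (N * ln (A x))). pose proof (exp_pos (N * ln (B x))).
  auto_derive.
  - repeat split; try assumption; try lra; eexists; eassumption.
  - replace (Derive (fun x0 => A x0) x) with a' by (symmetry; apply is_derive_unique; auto).
    replace (Derive (fun x0 => B x0) x) with b' by (symmetry; apply is_derive_unique; auto).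
    field. repeat split; lra.
Qed.

Lemma smax_derive (N : R) (A B : R -> R) (x a' b' : R) :
  N <> 0 -> 0 < A x -> 0 < B x -> is_derive A x a' -> is_derive B x b' ->
  is_derive (fun y => smax N (A y) (B y)) x
    (smax N (A x) (B x) * (swt N (A x) (B x) * (a' / A x) + (1 - swt N (A x) (B x)) * (b' / B x))).
Proof.
  intros HN HA HB DA DB. unfold smax at 1.
  pose proof (slog_derive N A B x a' b' HN HA HB DA DB) as D.
  rewrite Rmult_comm. apply (is_derive_comp exp (fun y => slog N (A y) (B y))); auto.
  apply is_derive_Reals. apply derivable_pt_lim_exp.
Qed.

(** The derivative of the weight contributes N s (1 - s) times the squared difference of the
    logarithmic derivatives, and the variance of these derivatives takes one copy back. The sign of
    the remaining N - 1 expresses convexity of the norm. *)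
Lemma smax_derive2 (N : R) (A B A1 B1 : R -> R) (x a2 b2 : R) :
  N <> 0 -> 0 < A x -> 0 < B x ->
  is_derive A x (A1 x) -> is_derive B x (B1 x) ->
  is_derive A1 x a2 -> is_derive B1 x b2 ->
  is_derive (fun y => smax N (A y) (B y) * (swt N (A y) (B y) * (A1 y / A y) + (1 - swt N (A y) (B y)) * (B1 y / B y))) x
    (smax N (A x) (B x) * (swt N (A x) (B x) * (a2 / A x) + (1 - swt N (A x) (B x)) * (b2 / B x)
       + (N - 1) * (swt N (A x) (B x) * (1 - swt N (A x) (B x))) * (A1 x / A x - B1 x / B x) ^ 2)).
Proof.
  intros HN HA HB DA DB DA1 DB1.
  pose proof (smax_derive N A B x _ _ HN HA HB DA DB) as D1.
  pose proof (swt_derive N A B x _ _ HA HB DA DB) as D2.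
  set (m := fun y => smax N (A y) (B y)) in *.
  set (s := fun y => swt N (A y) (B y)) in *.
  change (smax N (A x) (B x)) with (m x) in *. change (swt N (A x) (B x)) with (s x) in *.
  apply is_derive_ext with (fun y => m y * (s y * (A1 y / A y) + (1 - s y) * (B1 y / B y))).
  { intros; reflexivity. }
  auto_derive.
  - repeat split; try lra; eexists; eauto.
  - replace (Derive (fun x0 => A x0) x) with (A1 x) by (symmetry; apply is_derive_unique; auto).
    replace (Derive (fun x0 => B x0) x) with (B1 x) by (symmetry; apply is_derive_unique; auto).
    replace (Derive (fun x0 => A1 x0) x) with a2 by (symmetry; apply is_derive_unique; auto).
    replace (Derive (fun x0 => B1 x0) x) with b2 by (symmetry; apply is_derive_unique; auto).
    replace (Derive (fun x0 => m x0) x) with (m x * (s x * (A1 x / A x) + (1 - s x) * (B1 x / B x)))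
      by (symmetry; apply is_derive_unique; exact D1).
    replace (Derive (fun x0 => s x0) x) with (N * s x * (1 - s x) * (A1 x / A x - B1 x / B x))
      by (symmetry; apply is_derive_unique; exact D2).
    field. lra.
Qed.

(** * Uniform continuity on rectangles *)

(** Continuity relative to a closed rectangle, boundary included, whereas [continuity_2d_pt] looks
    at a full neighbourhood. The uniform form speaks only of values inside the rectangle. *)
Definition ucont (a b c d : R) (f : R -> R -> R) : Prop :=
  forall eps, 0 < eps -> exists del, 0 < del /\
    forall x t y s, a <= x <= b -> c <= t <= d -> a <= y <= b -> c <= s <= d ->
      Rabs (y - x) < del -> Rabs (s - t) < del -> Rabs (f y s - f x t) < eps.

Lemma ucont_of_continuity (a b c d : R) (f : R -> R -> R) :
  (forall x t, a <= x <= b -> c <= t <= d -> continuity_2d_pt f x t) -> ucont a b c d f.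
Proof.
  intros H eps He.
  destruct (uniform_continuity_2d f a b c d H (mkposreal eps He)) as [del Hd].
  exists del. split; [apply cond_pos|]. intros. apply Hd; auto.
Qed.

Lemma ucont_restrict (a b c d a' b' c' d' : R) (f : R -> R -> R) :
  a <= a' -> b' <= b -> c <= c' -> d' <= d -> ucont a b c d f -> ucont a' b' c' d' f.
Proof.
  intros ? ? ? ? H eps He. destruct (H eps He) as [del [Hd Hf]].
  exists del; split; auto. intros. apply Hf; lra.
Qed.

Lemma ucont_bounded (a b c d : R) (f : R -> R -> R) :
  a <= b -> c <= d -> ucont a b c d f ->
  exists M, 0 < M /\ forall x t, a <= x <= b -> c <= t <= d -> Rabs (f x t) <= M.
Proof.
  intros Hab Hcd H. destruct (H 1 Rlt_0_1) as [del [Hd Hf]].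
  set (L := (b - a) + (d - c)).
  destruct (INR_unbounded (L / del)) as [n Hn].
  assert (Hn0 : 0 < INR n).
  { eapply Rle_lt_trans; [|exact Hn]. unfold L. apply Rdiv_le_0_compat; lra. }
  exists (Rabs (f a c) + INR n). split; [pose proof (Rabs_pos (f a c)); lra|].
  intros x t Hx Ht.
  (* Walk from (a, c) to (x, t) in [n] equal steps, each shorter than [del] in both coordinates, so
     that [f] changes by less than 1 at a time. *)
  assert (Hstep : forall k, (k <= n)%nat ->
     Rabs (f (a + (x - a) * (INR k / INR n)) (c + (t - c) * (INR k / INR n))) <= Rabs (f a c) + INR k).
  { induction k as [|k IH]; intros Hk.
    - simpl. rewrite Rdiv_0_l, !Rmult_0_r, !Rplus_0_r. lra.
    - specialize (IH ltac:(lia)). rewrite S_INR.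
      assert (K1 : 0 <= INR k / INR n) by (apply Rdiv_le_0_compat; [apply pos_INR|lra]).
      assert (K2 : (INR k + 1) / INR n <= 1).
      { apply Rmult_le_reg_r with (INR n); auto. unfold Rdiv. rewrite Rmult_assoc, Rinv_l by lra.
        rewrite <- S_INR. apply le_INR in Hk. lra. }
      assert (K3 : (INR k + 1) / INR n = INR k / INR n + / INR n) by (field; lra).
      assert (K4 : 0 < / INR n) by (apply Rinv_0_lt_compat; auto).
      assert (K5 : L * / INR n < del).
      { apply Rmult_lt_reg_r with (INR n); auto. rewrite Rmult_assoc, Rinv_l by lra.
        apply Rmult_lt_compat_r with (r := del) in Hn; auto. unfold Rdiv in Hn.
        rewrite Rmult_assoc, Rinv_l in Hn; lra. }
      rewrite K3 in *. unfold L in K5.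
      set (p := INR k / INR n) in *. set (q := / INR n) in *.
      assert (Rabs (f (a + (x - a) * (p + q)) (c + (t - c) * (p + q)) - f (a + (x - a) * p) (c + (t - c) * p)) < 1).
      { apply Hf; try (split; nra); apply Rabs_lt_between; nra. }
      pose proof (Rabs_triang_inv (f (a + (x - a) * (p + q)) (c + (t - c) * (p + q))) (f (a + (x - a) * p) (c + (t - c) * p))).
      lra. }
  specialize (Hstep n (Nat.le_refl n)).
  replace (INR n / INR n) with 1 in Hstep by (field; lra).
  replace (a + (x - a) * 1) with x in Hstep by ring.
  replace (c + (t - c) * 1) with t in Hstep by ring. exact Hstep.
Qed.

(** Projection onto [a, b]. Being 1-Lipschitz, it extends a function that is [ucont] on a rectangle
    to one continuous on the whole plane, to which the library lemmas apply. *)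
Definition clamp (a b x : R) : R := Rmax a (Rmin b x).

Lemma clamp_in (a b x : R) : a <= b -> a <= clamp a b x <= b.
Proof.
  intros. unfold clamp. split; [apply Rmax_l|]. apply Rmax_lub; auto. apply Rmin_l.
Qed.

Lemma clamp_id (a b x : R) : a <= x <= b -> clamp a b x = x.
Proof. intros. unfold clamp. rewrite Rmin_right, Rmax_right; lra. Qed.

Lemma clamp_lip (a b x y : R) : a <= b -> Rabs (clamp a b x - clamp a b y) <= Rabs (x - y).
Proof.
  intros. unfold clamp, Rmin. destruct (Rle_dec b x), (Rle_dec b y); unfold Rmax;
  repeat match goal with |- context [Rle_dec ?p ?q] => destruct (Rle_dec p q) end;
  unfold Rabs; repeat destruct Rcase_abs; lra.
Qed.

Lemma ucont_clamp (a b c d : R) (f : R -> R -> R) :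
  a <= b -> c <= d -> ucont a b c d f ->
  forall x t, continuity_2d_pt (fun y s => f (clamp a b y) (clamp c d s)) x t.
Proof.
  intros Hab Hcd H x t eps. destruct (H eps (cond_pos eps)) as [del [Hd Hf]].
  exists (mkposreal del Hd). simpl. intros u v Hu Hv.
  apply Hf; try (apply clamp_in; assumption);
  (eapply Rle_lt_trans; [apply clamp_lip; assumption|assumption]).
Qed.

(** A bound for the continuous function 1 / f gives the positive lower bound. *)
Lemma ucont_pos_lower (a b c d : R) (f : R -> R -> R) :
  a <= b -> c <= d -> ucont a b c d f ->
  (forall x t, a <= x <= b -> c <= t <= d -> 0 < f x t) ->
  exists m, 0 < m /\ forall x t, a <= x <= b -> c <= t <= d -> m <= f x t.
Proof.
  intros Hab Hcd H Hp.
  assert (U : ucont a b c d (fun y s => / f (clamp a b y) (clamp c d s))).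
  { apply ucont_of_continuity. intros x t _ _. apply continuity_2d_pt_inv.
    - now apply ucont_clamp.
    - apply Rgt_not_eq, Hp; now apply clamp_in. }
  destruct (ucont_bounded _ _ _ _ _ Hab Hcd U) as [M [HM HB]].
  exists (/ M). split; [now apply Rinv_0_lt_compat|]. intros x t Hx Ht.
  specialize (HB x t Hx Ht). simpl in HB. rewrite !clamp_id in HB by auto.
  specialize (Hp x t Hx Ht). rewrite Rabs_pos_eq in HB by (left; now apply Rinv_0_lt_compat).
  rewrite <- (Rinv_inv (f x t)). apply Rinv_le_contravar; auto. now apply Rinv_0_lt_compat.
Qed.

(** * A smoothed Kato inequality *)

Definition smooth (a b c d : R) (w wx wxx wt : R -> R -> R) : Prop :=
  forall x t, a < x < b -> c < t < d ->
    is_derive (fun y => w y t) x (wx x t) /\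
    is_derive (fun y => wx y t) x (wxx x t) /\
    is_derive (fun s => w x s) t (wt x t) /\
    continuity_2d_pt w x t /\ continuity_2d_pt wx x t /\
    continuity_2d_pt wxx x t /\ continuity_2d_pt wt x t.

(** Apart from the error term, the left side is the time derivative of [slog N w v - ln v] and the
    right side the second space derivative of [smax N w v - v]. Let A and B be the partial
    derivatives of the norm. Euler's identity A W + B V = m >= V gives the zero-order terms the
    right sign. Replacing A by s and B by 1 - s costs C / (N - 1) each, and the constant 1 - A - B
    costs 2 / (N - 1). *)
Lemma kato_pointwise (N W V wx wxx wt vx vxx vt C : R) :
  1 < N -> 0 < W -> 0 < V ->
  wt <= W * (wxx + 1 - W) -> V * (vxx + 1 - V) <= vt ->
  Rabs (wt / W) <= C -> Rabs (vt / V) <= C ->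
  swt N W V * (wt / W) + (1 - swt N W V) * (vt / V) - vt / V - 2 * (1 + C) / (N - 1) <=
  smax N W V * (swt N W V * (wxx / W) + (1 - swt N W V) * (vxx / V)
      + (N - 1) * (swt N W V * (1 - swt N W V)) * (wx / W - vx / V) ^ 2) - vxx.
Proof.
  intros HN HW HV Hw Hv HCw HCv.
  destruct (smax_swt N W V HN HW) as [A1 [A2 A3]].
  destruct (smax_swt N V W HN HV) as [B1 [B2 B3]].
  rewrite smax_sym, swt_sym in B1, B2, B3.
  pose proof (swt_pos N W V) as S0. pose proof (swt_lt_1 N W V) as S1.
  pose proof (smax_pos N W V) as M0.
  pose proof (smax_ge_r N W V ltac:(lra) HV) as MV.
  set (s := swt N W V) in *. set (m := smax N W V) in *.
  set (A := m * s / W) in *. set (B := m * (1 - s) / V) in *.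
  set (p := wt / W) in *. set (q := vt / V) in *. set (nu := / (N - 1)) in *.
  assert (Hnu : 0 < nu) by (apply Rinv_0_lt_compat; lra).
  assert (Hp : p <= wxx + 1 - W).
  { unfold p. apply Rmult_le_reg_l with W; auto. replace (W * (wt / W)) with wt by (field; lra). lra. }
  assert (Hq : vxx + 1 - V <= q).
  { unfold q. apply Rmult_le_reg_l with V; auto. replace (V * (vt / V)) with vt by (field; lra). lra. }
  assert (EQ : m * (s * (wxx / W) + (1 - s) * (vxx / V) + (N - 1) * (s * (1 - s)) * (wx / W - vx / V) ^ 2) - vxx
     = A * wxx + B * vxx - vxx + m * ((N - 1) * (s * (1 - s)) * (wx / W - vx / V) ^ 2)).
  { unfold A, B. field. lra. }
  rewrite EQ.
  assert (SQ : 0 <= m * ((N - 1) * (s * (1 - s)) * (wx / W - vx / V) ^ 2)).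
  { apply Rmult_le_pos; [lra|]. apply Rmult_le_pos; [|apply pow2_ge_0].
    apply Rmult_le_pos; [lra|]. apply Rmult_le_pos; lra. }
  assert (EM : A * W + B * V = m) by (unfold A, B; field; lra).
  replace (2 * (1 + C) / (N - 1)) with (2 * (1 + C) * nu) by (unfold nu, Rdiv; ring).
  apply Rabs_le_between in HCw. apply Rabs_le_between in HCv.
  (* The signs A >= 0 and B <= 1 let the subsolution and supersolution inequalities be used each in
     its own direction. *)
  assert (HA : A * (p - 1 + W) <= A * wxx) by (apply Rmult_le_compat_l; lra).
  assert (HB : (1 - B) * vxx <= (1 - B) * (q - 1 + V)) by (apply Rmult_le_compat_l; lra).
  assert (HC : 0 <= C) by lra.
  assert (E1 : - ((A - s) * p) <= nu * C).
  { apply Rle_trans with ((A - s) * C); nra. }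
  assert (E2 : - ((B - (1 - s)) * q) <= nu * C).
  { apply Rle_trans with ((B - (1 - s)) * C); nra. }
  nra.
Qed.

Ltac c2d := repeat first
  [ assumption
  | apply continuity_2d_pt_const
  | apply continuity_2d_pt_id1
  | apply continuity_2d_pt_id2
  | apply continuity_2d_pt_plus
  | apply continuity_2d_pt_minus
  | apply continuity_2d_pt_mult
  | apply continuity_2d_pt_opp
  | apply continuity_2d_pt_inv ].

Lemma continuity_2d_pt_exp (f : R -> R -> R) (x t : R) :
  continuity_2d_pt f x t -> continuity_2d_pt (fun y s => exp (f y s)) x t.
Proof. apply continuity_1d_2d_pt_comp. apply derivable_continuous_pt, derivable_pt_exp. Qed.

Lemma continuity_2d_pt_ln (f : R -> R -> R) (x t : R) :
  0 < f x t -> continuity_2d_pt f x t -> continuity_2d_pt (fun y s => ln (f y s)) x t.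
Proof.
  intros. apply continuity_1d_2d_pt_comp; auto.
  apply derivable_continuous_pt. exists (/ f x t). now apply derivable_pt_lim_ln.
Qed.

Lemma continuity_2d_pt_smax (N : R) (w v : R -> R -> R) (x t : R) :
  0 < w x t -> 0 < v x t -> continuity_2d_pt w x t -> continuity_2d_pt v x t ->
  continuity_2d_pt (fun y s => smax N (w y s) (v y s)) x t /\
  continuity_2d_pt (fun y s => swt N (w y s) (v y s)) x t.
Proof.
  intros Hw Hv Cw Cv.
  assert (Cs : continuity_2d_pt (fun y s => ssum N (w y s) (v y s)) x t).
  { unfold ssum. apply continuity_2d_pt_plus; apply continuity_2d_pt_exp;
    apply continuity_2d_pt_mult; try apply continuity_2d_pt_const; now apply continuity_2d_pt_ln. }
  split.
  - unfold smax, slog. apply continuity_2d_pt_exp. apply continuity_2d_pt_mult.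
    + apply continuity_2d_pt_ln; auto. apply ssum_pos.
    + apply continuity_2d_pt_const.
  - unfold swt. apply continuity_2d_pt_mult.
    + apply continuity_2d_pt_exp. apply continuity_2d_pt_mult; [apply continuity_2d_pt_const|].
      now apply continuity_2d_pt_ln.
    + apply continuity_2d_pt_inv; auto. apply Rgt_not_eq, ssum_pos.
Qed.

Lemma is_derive_Rminus (f g : R -> R) (x f' g' : R) :
  is_derive f x f' -> is_derive g x g' -> is_derive (fun y => f y - g y) x (f' - g').
Proof. apply (is_derive_minus (K := R_AbsRing) (V := R_NormedModule)). Qed.

(** Integrating the pointwise inequality in time bounds the second derivative of the integral below
    by h t - h e minus the error, where h = [slog N w v - ln v]. Here h t >= 0 because the norm
    dominates v, and h e <= kap by hypothesis; so the integral is almost convex. *)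
Lemma kato_integral (N a b c d x1 x2 e t C kap : R)
    (w wx wxx wt v vx vxx vt : R -> R -> R) :
  1 < N -> c < e -> e <= t -> t < d -> a < x1 -> x2 < b -> 0 <= kap ->
  smooth a b c d w wx wxx wt -> smooth a b c d v vx vxx vt ->
  (forall x s, a < x < b -> c < s < d -> 0 < w x s /\ 0 < v x s /\
     wt x s <= w x s * (wxx x s + 1 - w x s) /\
     v x s * (vxx x s + 1 - v x s) <= vt x s) ->
  (forall x s, x1 <= x <= x2 -> e <= s <= t ->
     Rabs (wt x s / w x s) <= C /\ Rabs (vt x s / v x s) <= C) ->
  (forall x, x1 <= x <= x2 -> slog N (w x e) (v x e) - ln (v x e) <= kap) ->
  forall x, x1 <= x <= x2 ->
    RInt (fun s => smax N (w x s) (v x s) - v x s) e t <=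
    Rmax (RInt (fun s => smax N (w x1 s) (v x1 s) - v x1 s) e t)
         (RInt (fun s => smax N (w x2 s) (v x2 s) - v x2 s) e t)
    + (kap + 2 * (1 + C) / (N - 1) * (t - e)) * (x2 - x1) ^ 2.
Proof.
  intros HN Hce Het Htd Hax1 Hx2b Hkap Sw Sv Hpde HC Hini x Hx.
  set (f := fun y s => smax N (w y s) (v y s) - v y s).
  set (fx := fun y s => smax N (w y s) (v y s) *
     (swt N (w y s) (v y s) * (wx y s / w y s) + (1 - swt N (w y s) (v y s)) * (vx y s / v y s)) - vx y s).
  set (fxx := fun y s => smax N (w y s) (v y s) *
     (swt N (w y s) (v y s) * (wxx y s / w y s) + (1 - swt N (w y s) (v y s)) * (vxx y s / v y s)
       + (N - 1) * (swt N (w y s) (v y s) * (1 - swt N (w y s) (v y s))) * (wx y s / w y s - vx y s / v y s) ^ 2)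
     - vxx y s).
  assert (D : forall y s, a < y < b -> c < s < d ->
     is_derive (fun z => f z s) y (fx y s) /\ is_derive (fun z => fx z s) y (fxx y s) /\
     continuity_2d_pt f y s /\ continuity_2d_pt fx y s /\ continuity_2d_pt fxx y s).
  { intros y s Hy Hs. destruct (Hpde y s Hy Hs) as [Pw [Pv _]].
    destruct (Sw y s Hy Hs) as [W1 [W2 [_ [W3 [W4 [W5 _]]]]]].
    destruct (Sv y s Hy Hs) as [V1 [V2 [_ [V3 [V4 [V5 _]]]]]].
    destruct (continuity_2d_pt_smax N w v y s Pw Pv W3 V3) as [C1 C2].
    split; [|split; [|split; [|split]]].
    - apply is_derive_Rminus; auto. apply (smax_derive N (fun z => w z s) (fun z => v z s)); auto; lra.
    - apply is_derive_Rminus; auto.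
      apply (smax_derive2 N (fun z => w z s) (fun z => v z s) (fun z => wx z s) (fun z => vx z s)); auto; lra.
    - unfold f. c2d.
    - unfold fx, Rdiv. c2d; lra.
    - unfold fxx, Rdiv. simpl. c2d; lra. }
  apply (semiconvex_le_max (fun y => RInt (f y) e t) (fun y => RInt (fx y) e t) (fun y => RInt (fxx y) e t) a b x1 x2); auto.
  - intros y Hy. apply (is_derive_RInt_box a b c d); auto.
    intros z s Hz Hs. destruct (D z s Hz Hs) as [? [? [? [? ?]]]]. auto.
  - intros y Hy. apply (is_derive_RInt_box a b c d); auto.
    intros z s Hz Hs. destruct (D z s Hz Hs) as [? [? [? [? ?]]]]. auto.
  - assert (C0 : 0 <= C).
    { destruct (HC x e Hx ltac:(lra)) as [H _]. pose proof (Rabs_pos (wt x e / w x e)). lra. }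
    assert (0 <= 2 * (1 + C) / (N - 1) * (t - e)); [|lra].
    apply Rmult_le_pos; [|lra]. apply Rdiv_le_0_compat; lra.
  - intros y Hy. assert (Hy' : a < y < b) by lra.
    set (h := fun s => slog N (w y s) (v y s) - ln (v y s)).
    set (dh := fun s => swt N (w y s) (v y s) * (wt y s / w y s) + (1 - swt N (w y s) (v y s)) * (vt y s / v y s) - vt y s / v y s).
    assert (Ih : is_RInt dh e t (minus (h t) (h e))).
    { apply (is_RInt_derive (V := R_CompleteNormedModule)).
      - intros s Hs. rewrite Rmin_left, Rmax_right in Hs by lra.
        assert (Hs' : c < s < d) by lra.
        destruct (Hpde y s Hy' Hs') as [Pw [Pv _]].
        destruct (Sw y s Hy' Hs') as [_ [_ [W1 _]]]. destruct (Sv y s Hy' Hs') as [_ [_ [V1 _]]].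
        apply is_derive_Rminus.
        + apply (slog_derive N (fun r => w y r) (fun r => v y r)); auto; lra.
        + replace (vt y s / v y s) with (vt y s * / v y s) by reflexivity.
          apply (is_derive_comp ln (fun r => v y r)); auto.
          apply is_derive_Reals. now apply derivable_pt_lim_ln.
      - intros s Hs. rewrite Rmin_left, Rmax_right in Hs by lra.
        assert (Hs' : c < s < d) by lra.
        destruct (Hpde y s Hy' Hs') as [Pw [Pv _]].
        destruct (Sw y s Hy' Hs') as [_ [_ [_ [W3 [_ [_ W6]]]]]].
        destruct (Sv y s Hy' Hs') as [_ [_ [_ [V3 [_ [_ V6]]]]]].
        destruct (continuity_2d_pt_smax N w v y s Pw Pv W3 V3) as [C1 C2].
        apply (continuity_2d_pt_snd (fun y s => swt N (w y s) (v y s) * (wt y s / w y s) + (1 - swt N (w y s) (v y s)) * (vt y s / v y s) - vt y s / v y s) y).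
        unfold Rdiv. c2d; lra. }
    assert (Ic : is_RInt (fun _ => - (2 * (1 + C) / (N - 1))) e t ((t - e) * - (2 * (1 + C) / (N - 1)))).
    { apply (is_RInt_const (V := R_NormedModule)). }
    pose proof (is_RInt_plus (V := R_NormedModule) _ _ _ _ _ _ Ih Ic) as Is.
    assert (If : ex_RInt (fxx y) e t).
    { apply (ex_RInt_continuous (V := R_CompleteNormedModule)). intros s Hs.
      rewrite Rmin_left, Rmax_right in Hs by lra.
      apply continuity_2d_pt_snd. apply D; lra. }
    assert (LE : RInt (fun s => plus (dh s) (- (2 * (1 + C) / (N - 1)))) e t <= RInt (fxx y) e t).
    { apply RInt_le; auto.
      - eexists; exact Is.
      - intros s Hs. assert (Hs' : c < s < d) by lra.
        destruct (Hpde y s Hy' Hs') as [Pw [Pv [Qw Qv]]].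
        destruct (HC y s Hy ltac:(lra)) as [C1 C2].
        change (dh s + - (2 * (1 + C) / (N - 1)) <= fxx y s).
        unfold dh, fxx. apply kato_pointwise; auto. }
    apply (is_RInt_unique (V := R_CompleteNormedModule)) in Is.
    assert (LE' : (h t - h e) + (t - e) * - (2 * (1 + C) / (N - 1)) <= RInt (fxx y) e t).
    { eapply Rle_trans; [|exact LE]. right. symmetry. exact Is. }
    clear LE; rename LE' into LE.
    assert (Ht0 : 0 <= h t).
    { unfold h. destruct (Hpde y t Hy' ltac:(lra)) as [Pw [Pv _]].
      pose proof (smax_ge_r N (w y t) (v y t) ltac:(lra) Pv) as G.
      apply ln_le in G; auto. unfold smax in G. rewrite ln_exp in G. lra. }
    specialize (Hini y Hy). unfold h in LE at 2. unfold h in Ht0. unfold h in LE. lra.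
Qed.

(** * The comparison principle *)

Lemma exp_le_1_2z (z : R) : 0 <= z <= / 2 -> exp z <= 1 + 2 * z.
Proof.
  intros Hz. pose proof (exp_ge (- z)). rewrite exp_Ropp in H. pose proof (exp_pos z).
  apply Rmult_le_compat_l with (r := exp z) in H; [|lra]. rewrite Rinv_r in H by lra. nra.
Qed.

Lemma smax_le (N a b g M : R) : 2 <= N -> 0 < a -> 0 < b -> 0 <= g -> a <= b + g -> b + g <= M ->
  smax N a b - b <= g + 2 * M / N.
Proof.
  intros HN Ha Hb Hg Hab HM.
  assert (H : slog N a b <= ln (b + g) + / N) by (apply slog_le; lra).
  assert (Hi : 0 <= / N <= / 2).
  { split; [left; apply Rinv_0_lt_compat; lra|apply Rinv_le_contravar; lra]. }
  assert (smax N a b <= (b + g) * (1 + 2 * / N)).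
  { unfold smax. apply Rle_trans with (exp (ln (b + g) + / N)).
    - destruct H as [H| ->]; [left; now apply exp_increasing|lra].
    - rewrite exp_plus, exp_ln by lra. apply Rmult_le_compat_l; [lra|]. now apply exp_le_1_2z. }
  unfold Rdiv. nra.
Qed.

Lemma ln_ratio_le (p q : R) : 0 < p -> 0 <= q -> ln (p + q) - ln p <= q / p.
Proof.
  intros. pose proof (exp_ge (q / p)).
  assert (0 <= q / p) by (apply Rdiv_le_0_compat; lra).
  assert (ln (p + q) <= ln (p * exp (q / p))).
  { apply ln_le; [lra|]. apply Rle_trans with (p * (1 + q / p)); [right; field; lra|].
    apply Rmult_le_compat_l; lra. }
  rewrite ln_mult, ln_exp in H3 by (lra || apply exp_pos). lra.
Qed.

Lemma smooth_ratio_bounded (a b c d x1 x2 e t : R) (w wx wxx wt : R -> R -> R) :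
  a < x1 -> x1 <= x2 -> x2 < b -> c < e -> e <= t -> t < d ->
  smooth a b c d w wx wxx wt ->
  (forall x s, a < x < b -> c < s < d -> 0 < w x s) ->
  exists C, 0 < C /\ forall x s, x1 <= x <= x2 -> e <= s <= t -> Rabs (wt x s / w x s) <= C.
Proof.
  intros H1 H2 H3 H4 H5 H6 Sw Pw.
  apply (ucont_bounded x1 x2 e t (fun y s => wt y s / w y s)); auto.
  apply ucont_of_continuity. intros x s Hx Hs.
  destruct (Sw x s ltac:(lra) ltac:(lra)) as [_ [_ [_ [W3 [_ [_ W6]]]]]].
  specialize (Pw x s ltac:(lra) ltac:(lra)).
  unfold Rdiv. c2d. lra.
Qed.

(* The smooth maximum [smax N w v = (w^N + v^N)^(1/N)] is convex and homogeneous of degree one in (w, v). Homogeneity lets the time derivatives of [ln w] and [ln v] enter through the exact derivative of [slog N w v], up to an error of order 1/N, although they carry the factors 1/w and 1/v. In the limit the time integral of the positive part of [w - v] is convex in x. *)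
Theorem comparison (a b c d : R) (w wx wxx wt v vx vxx vt : R -> R -> R) :
  a < b -> c < d ->
  ucont a b c d w -> ucont a b c d v ->
  smooth a b c d w wx wxx wt -> smooth a b c d v vx vxx vt ->
  (forall x t, a < x < b -> c <= t <= d -> 0 < w x t /\ 0 < v x t) ->
  (forall x t, a < x < b -> c < t < d -> wt x t <= w x t * (wxx x t + 1 - w x t)) ->
  (forall x t, a < x < b -> c < t < d -> v x t * (vxx x t + 1 - v x t) <= vt x t) ->
  (forall x, a <= x <= b -> w x c <= v x c) ->
  (forall t, c <= t <= d -> w a t <= v a t /\ w b t <= v b t) ->
  forall x t, a <= x <= b -> c <= t <= d -> w x t <= v x t.
Proof.
  intros Hab Hcd Uw Uv Sw Sv Hpos Hw Hv Hini Hlat xs ts Hxs Hts.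
  apply Rnot_lt_le; intros Hlt.
  set (D := w xs ts - v xs ts). assert (HD : 0 < D) by (unfold D; lra).
  assert (Hxs' : a < xs < b).
  { destruct (Hlat ts Hts). split; apply Rnot_le_lt; intros ?.
    - replace xs with a in Hlt by lra. lra.
    - replace xs with b in Hlt by lra. lra. }
  assert (Hts' : c < ts).
  { apply Rnot_le_lt; intros ?. replace ts with c in Hlt by lra. specialize (Hini xs Hxs). lra. }
  assert (U : forall eps, 0 < eps -> exists del, 0 < del /\
    forall x t y s, a <= x <= b -> c <= t <= d -> a <= y <= b -> c <= s <= d ->
      Rabs (y - x) < del -> Rabs (s - t) < del ->
      Rabs (w y s - v y s - (w x t - v x t)) < eps).
  { intros eps He. destruct (Uw (eps / 2)) as [d1 [Hd1 F1]]; [lra|].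
    destruct (Uv (eps / 2)) as [d2 [Hd2 F2]]; [lra|].
    exists (Rmin d1 d2). split; [now apply Rmin_pos|]. intros x t y s ? ? ? ? E1 E2.
    pose proof (Rmin_l d1 d2). pose proof (Rmin_r d1 d2).
    specialize (F1 x t y s ltac:(auto) ltac:(auto) ltac:(auto) ltac:(auto) ltac:(lra) ltac:(lra)).
    specialize (F2 x t y s ltac:(auto) ltac:(auto) ltac:(auto) ltac:(auto) ltac:(lra) ltac:(lra)).
    apply Rabs_lt_between in F1. apply Rabs_lt_between in F2. apply Rabs_lt_between. lra. }
  destruct (U (D / 2)) as [d0 [Hd0 F0]]; [lra|].
  set (r := Rmin d0 (ts - c)). assert (Hr : 0 < r) by (apply Rmin_pos; lra).
  assert (Hr1 : r <= d0) by apply Rmin_l. assert (Hr2 : r <= ts - c) by apply Rmin_r.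
  (* The time [ts] may be the final time [d], where [smooth] says nothing; the integration stops at
     [t2 < d], still inside the period in which the excess at [xs] is at least D / 2. *)
  set (t1 := ts - r / 2). set (t2 := ts - r / 4).
  assert (Hbig : forall s, t1 <= s <= t2 -> D / 2 <= w xs s - v xs s).
  { intros s Hs. unfold t1, t2 in Hs.
    specialize (F0 xs ts xs s Hxs Hts Hxs ltac:(lra)).
    rewrite Rminus_diag, Rabs_R0 in F0. specialize (F0 Hd0 ltac:(apply Rabs_lt_between; lra)).
    apply Rabs_lt_between in F0. fold D in F0. lra. }
  (* A lower bound for the integral at [xs]. The upper bound will consist of I0 / 4 from the lateral
     sides, I0 / 4 from the initial time and I0 / 4 from all terms of order 1 / N. *)
  set (I0 := D / 2 * (r / 4)). assert (HI0 : 0 < I0) by (unfold I0; nra).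
  set (H := d - c). set (L := b - a).
  destruct (U (I0 / (4 * H))) as [dl [Hdl Fl]].
  { apply Rdiv_lt_0_compat; unfold H; lra. }
  set (rho := Rmin (dl / 2) (Rmin ((xs - a) / 2) ((b - xs) / 2))).
  assert (Hrho : 0 < rho) by (unfold rho; repeat apply Rmin_pos; lra).
  assert (R1 : rho <= dl / 2) by apply Rmin_l.
  assert (R2 : rho <= (xs - a) / 2) by (unfold rho; eapply Rle_trans; [apply Rmin_r|apply Rmin_l]).
  assert (R3 : rho <= (b - xs) / 2) by (unfold rho; eapply Rle_trans; [apply Rmin_r|apply Rmin_r]).
  set (x1 := a + rho). set (x2 := b - rho).
  assert (E1 : forall s, c <= s <= d -> w x1 s <= v x1 s + I0 / (4 * H)).
  { intros s Hs. destruct (Hlat s Hs).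
    specialize (Fl a s x1 s ltac:(lra) Hs ltac:(unfold x1; lra) Hs ltac:(unfold x1; apply Rabs_lt_between; lra)
      ltac:(apply Rabs_lt_between; lra)). apply Rabs_lt_between in Fl. lra. }
  assert (E2 : forall s, c <= s <= d -> w x2 s <= v x2 s + I0 / (4 * H)).
  { intros s Hs. destruct (Hlat s Hs).
    specialize (Fl b s x2 s ltac:(lra) Hs ltac:(unfold x2; lra) Hs ltac:(unfold x2; apply Rabs_lt_between; lra)
      ltac:(apply Rabs_lt_between; lra)). apply Rabs_lt_between in Fl. lra. }
  clear Fl.
  assert (Uv' : ucont x1 x2 c d v) by (apply (ucont_restrict a b c d); unfold x1, x2; auto; lra).
  destruct (ucont_pos_lower x1 x2 c d v) as [m [Hm Fm]]; auto; try (unfold x1, x2; lra).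
  { intros x t Hx Ht. apply Hpos; unfold x1, x2 in Hx; lra. }
  (* An initial excess [eta] changes the logarithm by at most eta / m, and eta / m * L^2 is exactly
     I0 / 4. *)
  set (eta := I0 * m / (4 * L ^ 2)).
  assert (HL : 0 < L ^ 2) by (apply pow_lt; unfold L; lra).
  assert (Heta : 0 < eta).
  { unfold eta. apply Rdiv_lt_0_compat; [now apply Rmult_lt_0_compat|lra]. }
  destruct (U eta Heta) as [de [Hde Fe]].
  set (e := c + Rmin (de / 2) ((t1 - c) / 2)).
  assert (Hmin : 0 < Rmin (de / 2) ((t1 - c) / 2)) by (apply Rmin_pos; unfold t1; lra).
  assert (He : c < e) by (unfold e; lra).
  assert (He1 : e < t1).
  { unfold e. pose proof (Rmin_r (de / 2) ((t1 - c) / 2)). lra. }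
  assert (He2 : e < c + de).
  { unfold e. pose proof (Rmin_l (de / 2) ((t1 - c) / 2)). lra. }
  assert (Ht2d : t2 < d) by (unfold t2; lra).
  assert (Ht12 : t1 < t2) by (unfold t1, t2; lra).
  assert (Ee : forall x, a <= x <= b -> w x e <= v x e + eta).
  { intros x Hx. specialize (Fe x c x e Hx ltac:(lra) Hx ltac:(lra)).
    rewrite Rminus_diag, Rabs_R0 in Fe. specialize (Fe Hde ltac:(apply Rabs_lt_between; lra)).
    apply Rabs_lt_between in Fe. specialize (Hini x Hx). lra. }
  destruct (smooth_ratio_bounded a b c d x1 x2 e t2 w wx wxx wt) as [C1 [HC1 FC1]]; auto; try (unfold x1, x2; lra).
  { intros; apply Hpos; lra. }
  destruct (smooth_ratio_bounded a b c d x1 x2 e t2 v vx vxx vt) as [C2 [HC2 FC2]]; auto; try (unfold x1, x2; lra).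
  { intros; apply Hpos; lra. }
  set (C := C1 + C2).
  destruct (ucont_bounded a b c d v) as [Mv [HMv FMv]]; auto; try lra.
  set (M := Mv + I0 / (4 * H)).
  assert (HH : 0 < H) by (unfold H; lra).
  assert (HIH : 0 < I0 / (4 * H)) by (apply Rdiv_lt_0_compat; lra).
  (* [K] collects the coefficients of every error of order 1 / N. The constant [C] degenerates as
     [x1], [x2] and [e] approach the boundary, but these are fixed by now and [N] is chosen last. *)
  set (K := H * (2 * M) + L ^ 2 * (1 + 2 * (1 + C) * H)).
  assert (HM0 : 0 < M) by (unfold M; lra).
  assert (HK : 0 < K).
  { unfold K. apply Rplus_lt_0_compat; apply Rmult_lt_0_compat; try lra.
    assert (0 < 2 * (1 + C) * H) by (apply Rmult_lt_0_compat; unfold C; lra). lra. }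
  set (nu := Rmin 1 (I0 / (4 * K))).
  assert (Hnu : 0 < nu) by (apply Rmin_pos; [lra|apply Rdiv_lt_0_compat; lra]).
  assert (Hnu1 : nu <= 1) by apply Rmin_l.
  assert (HnuK : nu * K <= I0 / 4).
  { apply Rle_trans with (I0 / (4 * K) * K); [apply Rmult_le_compat_r; [lra|apply Rmin_r]|right; field; lra]. }
  set (N := 1 + / nu).
  assert (HN : 2 <= N).
  { unfold N. apply Rinv_le_contravar in Hnu1; auto. rewrite Rinv_1 in Hnu1. lra. }
  assert (HN1 : / (N - 1) = nu) by (unfold N; field; lra).
  assert (HN2 : / N <= nu) by (rewrite <- HN1; apply Rinv_le_contravar; lra).
  assert (HN0 : 0 < / N) by (apply Rinv_0_lt_compat; lra).
  pose proof (kato_integral N a b c d x1 x2 e t2 C (eta / m + / N) w wx wxx wt v vx vxx vt) as KI.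
  assert (Hem : 0 < eta / m) by (apply Rdiv_lt_0_compat; auto).
  specialize (KI ltac:(lra) He ltac:(lra) Ht2d ltac:(unfold x1; lra) ltac:(unfold x2; lra) ltac:(lra) Sw Sv).
  specialize (KI ltac:(intros x s Hx Hs; destruct (Hpos x s Hx ltac:(lra)); auto)).
  assert (KC : forall x s, x1 <= x <= x2 -> e <= s <= t2 ->
     Rabs (wt x s / w x s) <= C /\ Rabs (vt x s / v x s) <= C).
  { intros x s Hx Hs. specialize (FC1 x s Hx Hs). specialize (FC2 x s Hx Hs). unfold C; lra. }
  specialize (KI KC).
  assert (KE : forall x, x1 <= x <= x2 -> slog N (w x e) (v x e) - ln (v x e) <= eta / m + / N).
  { intros x Hx. assert (Hx' : a < x < b) by (unfold x1, x2 in Hx; lra).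
    destruct (Hpos x e Hx' ltac:(lra)) as [Pw Pv].
    assert (S : slog N (w x e) (v x e) <= ln (v x e + eta) + / N).
    { apply slog_le; try lra. apply Ee; lra. }
    pose proof (ln_ratio_le (v x e) eta Pv ltac:(lra)).
    assert (eta / v x e <= eta / m).
    { apply Rmult_le_compat_l; [lra|]. apply Rinv_le_contravar; auto. apply Fm; auto. lra. }
    lra. }
  specialize (KI KE xs ltac:(unfold x1, x2; lra)).
  assert (Iex : forall x p q, a < x < b -> c < p -> p <= q -> q < d ->
     ex_RInt (fun s => smax N (w x s) (v x s) - v x s) p q).
  { intros x p q Hx Hp Hpq Hq. apply (ex_RInt_continuous (V := R_CompleteNormedModule)).
    intros s Hs. rewrite Rmin_left, Rmax_right in Hs by lra.
    destruct (Hpos x s Hx ltac:(lra)) as [Pw Pv].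
    destruct (Sw x s Hx ltac:(lra)) as [_ [_ [_ [W3 _]]]]. destruct (Sv x s Hx ltac:(lra)) as [_ [_ [_ [V3 _]]]].
    apply (continuity_2d_pt_snd (fun x s => smax N (w x s) (v x s) - v x s) x).
    apply continuity_2d_pt_minus; auto. now apply continuity_2d_pt_smax. }
  assert (Side : forall x, a < x < b -> (forall s, c <= s <= d -> w x s <= v x s + I0 / (4 * H)) ->
     RInt (fun s => smax N (w x s) (v x s) - v x s) e t2 <= H * (I0 / (4 * H) + 2 * M * nu)).
  { intros x Hx Hxs2. apply Rle_trans with (RInt (fun _ => I0 / (4 * H) + 2 * M * nu) e t2).
    - apply RInt_le; [lra|apply Iex; lra| |].
      + apply (ex_RInt_const (V := R_NormedModule)).
      + intros s Hs. destruct (Hpos x s Hx ltac:(lra)) as [Pw Pv].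
        apply Rle_trans with (I0 / (4 * H) + 2 * M / N).
        * apply smax_le; auto; try lra. apply Hxs2; lra.
          specialize (FMv x s ltac:(lra) ltac:(lra)). apply Rabs_le_between in FMv. unfold M. lra.
        * apply Rplus_le_compat_l. apply Rmult_le_compat_l; auto. unfold M; lra.
    - rewrite RInt_const. change ((t2 - e) * (I0 / (4 * H) + 2 * M * nu) <= H * (I0 / (4 * H) + 2 * M * nu)).
      apply Rmult_le_compat_r; [|unfold H; lra].
      assert (0 <= 2 * M * nu) by (apply Rmult_le_pos; unfold M; lra). lra. }
  assert (Low : I0 <= RInt (fun s => smax N (w xs s) (v xs s) - v xs s) e t2).
  { rewrite <- (RInt_Chasles (V := R_CompleteNormedModule) _ e t1 t2); [|apply Iex; lra|apply Iex; lra].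
    assert (Gp : forall s, c < s < d -> 0 <= smax N (w xs s) (v xs s) - v xs s /\ w xs s - v xs s <= smax N (w xs s) (v xs s) - v xs s).
    { intros s Hs. destruct (Hpos xs s Hxs' ltac:(lra)) as [Pw Pv].
      pose proof (smax_ge_l N (w xs s) (v xs s) ltac:(lra) Pw).
      pose proof (smax_ge_r N (w xs s) (v xs s) ltac:(lra) Pv). lra. }
    assert (0 <= RInt (fun s => smax N (w xs s) (v xs s) - v xs s) e t1).
    { apply RInt_ge_0; [lra|apply Iex; lra|]. intros s Hs. apply Gp; lra. }
    assert (I0 <= RInt (fun s => smax N (w xs s) (v xs s) - v xs s) t1 t2).
    { apply Rle_trans with (RInt (fun _ => D / 2) t1 t2).
      - rewrite RInt_const. change (I0 <= (t2 - t1) * (D / 2)). unfold I0, t1, t2. right; field.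
      - apply RInt_le; [lra|apply (ex_RInt_const (V := R_NormedModule))|apply Iex; lra|].
        intros s Hs. destruct (Gp s ltac:(lra)). specialize (Hbig s ltac:(lra)). lra. }
    unfold plus; simpl. lra. }
  pose proof (Side x1 ltac:(unfold x1; lra) E1) as S1.
  pose proof (Side x2 ltac:(unfold x2; lra) E2) as S2.
  assert (S3 : (eta / m + / N + 2 * (1 + C) / (N - 1) * (t2 - e)) * (x2 - x1) ^ 2 <=
     (eta / m + nu * (1 + 2 * (1 + C) * H)) * L ^ 2).
  { assert (0 < 1 + C) by (unfold C; lra).
    apply Rmult_le_compat.
    - assert (0 <= 2 * (1 + C) / (N - 1) * (t2 - e)).
      { apply Rmult_le_pos; [|lra]. apply Rdiv_le_0_compat; lra. } lra.
    - apply pow2_ge_0.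
    - replace (2 * (1 + C) / (N - 1) * (t2 - e)) with (2 * (1 + C) * nu * (t2 - e)) by (rewrite <- HN1; unfold Rdiv; ring).
      assert (2 * (1 + C) * nu * (t2 - e) <= 2 * (1 + C) * nu * H).
      { apply Rmult_le_compat_l; [|unfold H; lra]. apply Rmult_le_pos; lra. }
      lra.
    - apply pow_incr. unfold L, x1, x2. unfold x1, x2; lra. }
  assert (E3 : eta / m * L ^ 2 = I0 / 4) by (unfold eta; field; split; unfold L; lra).
  assert (E4 : H * (I0 / (4 * H) + 2 * M * nu) = I0 / 4 + nu * (H * (2 * M))) by (field; lra).
  assert (E5 : Rmax (RInt (fun s => smax N (w x1 s) (v x1 s) - v x1 s) e t2)
         (RInt (fun s => smax N (w x2 s) (v x2 s) - v x2 s) e t2) <= I0 / 4 + nu * (H * (2 * M))).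
  { rewrite <- E4. now apply Rmax_lub. }
  unfold K in HnuK. lra.
Qed.

(** * Positive solutions on a nodal interval *)

(** The function |u| on one nodal interval. Its end values are 0 at a zero of u and 1 at a or b.
    [smooth] uses two-sided neighbourhoods and stops before [T]; the separate fields [ps_dx],
    [ps_dxx] and [ps_cxx] carry what is used at the final time itself. *)
Record psol (al be T : R) (w wx wxx wt : R -> R -> R) : Prop := {
  ps_itv : al < be;
  ps_T : 0 < T;
  ps_uc : ucont al be 0 T w;
  ps_pos : forall x t, al < x < be -> 0 <= t <= T -> 0 < w x t;
  ps_smooth : smooth al be 0 T w wx wxx wt;
  ps_dx : forall x t, al < x < be -> 0 < t <= T -> is_derive (fun y => w y t) x (wx x t);
  ps_dxx : forall x t, al < x < be -> 0 < t <= T -> is_derive (fun y => wx y t) x (wxx x t);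
  ps_cxx : forall x eps, al < x < be -> 0 < eps -> exists del, 0 < del /\
     forall s, 0 < s <= T -> T - s < del -> Rabs (wxx x s - wxx x T) < eps;
  ps_pde : forall x t, al < x < be -> 0 < t < T -> wt x t = w x t * (wxx x t + 1 - w x t);
  ps_l : (forall t, 0 <= t <= T -> w al t = 0) \/ (forall t, 0 <= t <= T -> w al t = 1);
  ps_r : (forall t, 0 <= t <= T -> w be t = 0) \/ (forall t, 0 <= t <= T -> w be t = 1) }.

Lemma continuity_2d_pt_affine (f : R -> R -> R) (c sg k x t : R) :
  Rabs sg = 1 -> 0 < k -> continuity_2d_pt f (c + sg * x) (k * t) ->
  continuity_2d_pt (fun y s => f (c + sg * y) (k * s)) x t.
Proof.
  intros Hs Hk H eps. destruct (H eps) as [[del Hd] F]. simpl in F.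
  assert (Hm : 0 < Rmin del (del / k)) by (apply Rmin_pos; [lra|now apply Rdiv_lt_0_compat]).
  exists (mkposreal _ Hm). simpl. intros u v Hu Hv. apply F.
  - replace (c + sg * u - (c + sg * x)) with (sg * (u - x)) by ring.
    rewrite Rabs_mult, Hs, Rmult_1_l. eapply Rlt_le_trans; [exact Hu|apply Rmin_l].
  - replace (k * v - k * t) with (k * (v - t)) by ring.
    rewrite Rabs_mult, (Rabs_pos_eq k) by lra.
    apply Rlt_le_trans with (k * (del / k)); [|right; field; lra].
    apply Rmult_lt_compat_l; auto. eapply Rlt_le_trans; [exact Hv|apply Rmin_r].
Qed.

Lemma is_derive_affine (f : R -> R) (c sg x l : R) :
  is_derive f (c + sg * x) l -> is_derive (fun y => f (c + sg * y)) x (sg * l).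
Proof.
  intros H. apply (is_derive_comp f (fun y => c + sg * y)); auto.
  auto_derive; auto. ring.
Qed.

Lemma is_derive_Rscal (f : R -> R) (k x l : R) :
  is_derive f x l -> is_derive (fun y => k * f y) x (k * l).
Proof. intros. now apply (is_derive_scal f x k l). Qed.

(** Translation for [sg = 1] and reflection for [sg = -1]: either end of a nodal interval can be
    moved to the left end 0, and lower gradient bounds become upper ones. *)
Lemma psol_affine (al be T p q c sg : R) (w wx wxx wt : R -> R -> R) :
  psol al be T w wx wxx wt ->
  (sg = 1 /\ c + p = al /\ c + q = be) \/ (sg = -1 /\ c - p = be /\ c - q = al) ->
  psol p q T (fun x t => w (c + sg * x) t) (fun x t => sg * wx (c + sg * x) t)
    (fun x t => wxx (c + sg * x) t) (fun x t => wt (c + sg * x) t).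
Proof.
  intros [H1 H2 H3 H4 H5 H6 H7 H8 H9 H10 H11] Hc.
  assert (Hin : forall x, p < x < q -> al < c + sg * x < be).
  { intros x Hx. destruct Hc as [[-> [? ?]]|[-> [? ?]]]; lra. }
  assert (Hin' : forall x, p <= x <= q -> al <= c + sg * x <= be).
  { intros x Hx. destruct Hc as [[-> [? ?]]|[-> [? ?]]]; lra. }
  assert (Hsg : Rabs sg = 1).
  { destruct Hc as [[-> _]|[-> _]]; [apply Rabs_R1|]. rewrite Rabs_left; lra. }
  assert (Hs2 : sg * sg = 1) by (destruct Hc as [[-> _]|[-> _]]; lra).
  assert (Hcont : forall f x t, continuity_2d_pt f (c + sg * x) t ->
     continuity_2d_pt (fun y s => f (c + sg * y) s) x t).
  { intros f x t Hf. apply continuity_2d_pt_ext with (fun y s => f (c + sg * y) (1 * s)).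
    - intros. now rewrite Rmult_1_l.
    - apply continuity_2d_pt_affine; auto; [lra|]. now rewrite Rmult_1_l. }
  assert (Hd2 : forall x t l, is_derive (fun y => wx y t) (c + sg * x) l -> is_derive (fun y => sg * wx (c + sg * y) t) x l).
  { intros x t l Hl. replace l with (sg * (sg * l)) by (rewrite <- Rmult_assoc, Hs2; ring).
    apply is_derive_Rscal. now apply (is_derive_affine (fun y => wx y t)). }
  split; auto.
  - destruct Hc as [[_ [? ?]]|[_ [? ?]]]; lra.
  - intros eps He. destruct (H3 eps He) as [del [Hd F]]. exists del; split; auto.
    intros x t y s Hx Ht Hy Hs Hyx Hst. apply F; auto.
    replace (c + sg * y - (c + sg * x)) with (sg * (y - x)) by ring.
    now rewrite Rabs_mult, Hsg, Rmult_1_l.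
  - intros x t Hx Ht. destruct (H5 _ t (Hin x Hx) Ht) as [A1 [A2 [A3 [A4 [A5 [A6 A7]]]]]].
    split; [|split; [|split; [|split; [|split; [|split]]]]]; auto.
    + now apply (is_derive_affine (fun y => w y t)).
    + apply continuity_2d_pt_mult; [apply continuity_2d_pt_const|auto].
  - intros x t Hx Ht. apply (is_derive_affine (fun y => w y t)). auto.
  - destruct Hc as [[-> [Hp Hq]]|[-> [Hp Hq]]].
    + replace (c + 1 * p) with al by lra. auto.
    + replace (c + -1 * p) with be by lra. auto.
  - destruct Hc as [[-> [Hp Hq]]|[-> [Hp Hq]]].
    + replace (c + 1 * q) with be by lra. auto.
    + replace (c + -1 * q) with al by lra. auto.
Qed.

Lemma smooth_restrict (a b c d a' b' c' d' : R) (w wx wxx wt : R -> R -> R) :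
  a <= a' -> b' <= b -> c <= c' -> d' <= d ->
  smooth a b c d w wx wxx wt -> smooth a' b' c' d' w wx wxx wt.
Proof. intros ? ? ? ? H x t Hx Ht. apply H; lra. Qed.

Lemma psol_unique_le (al be T1 T2 : R) (w wx wxx wt v vx vxx vt : R -> R -> R) :
  psol al be T1 w wx wxx wt -> psol al be T2 v vx vxx vt ->
  (forall x, al <= x <= be -> w x 0 = v x 0) ->
  forall x t, al <= x <= be -> 0 <= t <= Rmin T1 T2 -> w x t <= v x t.
Proof.
  intros W V H0.
  pose proof (ps_T _ _ _ _ _ _ _ W). pose proof (ps_T _ _ _ _ _ _ _ V).
  assert (Hm : 0 < Rmin T1 T2) by (now apply Rmin_pos).
  pose proof (Rmin_l T1 T2). pose proof (Rmin_r T1 T2).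
  pose proof (ps_itv _ _ _ _ _ _ _ W).
  apply (comparison al be 0 (Rmin T1 T2) w wx wxx wt v vx vxx vt); auto.
  - eapply ucont_restrict; [..|apply (ps_uc _ _ _ _ _ _ _ W)]; lra.
  - eapply ucont_restrict; [..|apply (ps_uc _ _ _ _ _ _ _ V)]; lra.
  - eapply smooth_restrict; [..|apply (ps_smooth _ _ _ _ _ _ _ W)]; lra.
  - eapply smooth_restrict; [..|apply (ps_smooth _ _ _ _ _ _ _ V)]; lra.
  - intros. split; [apply (ps_pos _ _ _ _ _ _ _ W)|apply (ps_pos _ _ _ _ _ _ _ V)]; lra.
  - intros. right. apply (ps_pde _ _ _ _ _ _ _ W); lra.
  - intros. right. symmetry. apply (ps_pde _ _ _ _ _ _ _ V); lra.
  - intros. right. auto.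
  - intros t Ht.
    (* Each lateral value is constantly 0 or constantly 1, so agreement at time 0 forces both
       solutions to have the same one. *)
    assert (Hl := H0 al ltac:(lra)). assert (Hr := H0 be ltac:(lra)).
    split; right.
    + destruct (ps_l _ _ _ _ _ _ _ W) as [E|E], (ps_l _ _ _ _ _ _ _ V) as [F|F];
      rewrite E, F in * by lra; lra.
    + destruct (ps_r _ _ _ _ _ _ _ W) as [E|E], (ps_r _ _ _ _ _ _ _ V) as [F|F];
      rewrite E, F in * by lra; lra.
Qed.

(* Aronson-Benilan: for [lam >= 1], [lam * w x (lam * t)] is a supersolution above [w]. *)
Lemma psol_mono (al be T : R) (w wx wxx wt : R -> R -> R) (s1 s2 x : R) :
  psol al be T w wx wxx wt -> 0 < s1 -> s1 <= s2 -> s2 <= T -> al <= x <= be ->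
  s1 * w x s1 <= s2 * w x s2.
Proof.
  intros W H1 H12 H2 Hx.
  pose proof (ps_itv _ _ _ _ _ _ _ W).
  set (lam := s2 / s1).
  assert (Hlam : 1 <= lam).
  { unfold lam. apply Rmult_le_reg_r with s1; auto. unfold Rdiv. rewrite Rmult_assoc, Rinv_l; lra. }
  assert (El : lam * s1 = s2) by (unfold lam; field; lra).
  assert (Hls : forall s, 0 <= s <= s1 -> 0 <= lam * s <= T).
  { intros s Hs. split; [nra|]. apply Rle_trans with (lam * s1); [apply Rmult_le_compat_l|]; lra. }
  assert (Hls' : forall s, 0 < s < s1 -> 0 < lam * s < T).
  { intros s Hs. split; [nra|]. apply Rlt_le_trans with (lam * s1); [apply Rmult_lt_compat_l|]; lra. }
  assert (Hw0 : forall y s, al <= y <= be -> 0 <= s <= T -> 0 <= w y s).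
  { intros y s Hy Hs. destruct (Req_dec y al) as [->|].
    { destruct (ps_l _ _ _ _ _ _ _ W) as [E|E]; rewrite E; lra. }
    destruct (Req_dec y be) as [->|].
    { destruct (ps_r _ _ _ _ _ _ _ W) as [E|E]; rewrite E; lra. }
    left. apply (ps_pos _ _ _ _ _ _ _ W); lra. }
  assert (HL : w x s1 <= lam * w x (lam * s1)).
  { apply (comparison al be 0 s1 w wx wxx wt (fun x s => lam * w x (lam * s)) (fun x s => lam * wx x (lam * s))
      (fun x s => lam * wxx x (lam * s)) (fun x s => lam * (lam * wt x (lam * s)))); try lra.
    - eapply ucont_restrict; [..|apply (ps_uc _ _ _ _ _ _ _ W)]; lra.
    - intros eps He. destruct (ps_uc _ _ _ _ _ _ _ W (eps / lam)) as [del [Hd F]].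
      { apply Rdiv_lt_0_compat; lra. }
      exists (del / lam). assert (del / lam <= del).
      { apply Rmult_le_reg_r with lam; [lra|]. unfold Rdiv. rewrite Rmult_assoc, Rinv_l by lra. nra. }
      split; [apply Rdiv_lt_0_compat; lra|]. intros y t z s Hy Ht Hz Hs E1 E2.
      specialize (F y (lam * t) z (lam * s) Hy (Hls t Ht) Hz (Hls s Hs) ltac:(lra)).
      replace (lam * s - lam * t) with (lam * (s - t)) in F by ring.
      rewrite Rabs_mult, (Rabs_pos_eq lam) in F by lra.
      replace (lam * w z (lam * s) - lam * w y (lam * t)) with (lam * (w z (lam * s) - w y (lam * t))) by ring.
      rewrite Rabs_mult, (Rabs_pos_eq lam) by lra.
      apply Rlt_le_trans with (lam * (eps / lam)); [|right; field; lra].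
      apply Rmult_lt_compat_l; [lra|]. apply F.
      apply Rlt_le_trans with (lam * (del / lam)); [|right; field; lra].
      apply Rmult_lt_compat_l; lra.
    - eapply smooth_restrict; [..|apply (ps_smooth _ _ _ _ _ _ _ W)]; lra.
    - intros y s Hy Hs.
      destruct (ps_smooth _ _ _ _ _ _ _ W y (lam * s) Hy (Hls' s Hs)) as [A1 [A2 [A3 [A4 [A5 [A6 A7]]]]]].
      assert (Hcont : forall f, continuity_2d_pt f y (lam * s) -> continuity_2d_pt (fun y s => f y (lam * s)) y s).
      { intros f Hf. apply continuity_2d_pt_ext with (fun y s => f (0 + 1 * y) (lam * s)).
        - intros. now rewrite Rplus_0_l, Rmult_1_l.
        - apply continuity_2d_pt_affine; auto; [apply Rabs_R1|lra|]. now rewrite Rplus_0_l, Rmult_1_l. }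
      split; [|split; [|split; [|split; [|split; [|split]]]]];
      try (apply is_derive_Rscal; assumption);
      try (repeat (apply continuity_2d_pt_mult; [apply continuity_2d_pt_const|]); now apply Hcont).
      apply is_derive_Rscal. apply is_derive_ext with (fun r => w y (0 + lam * r)).
      + intros. now rewrite Rplus_0_l.
      + apply (is_derive_affine (w y)). now rewrite Rplus_0_l.
    - intros y s Hy Hs. split; [apply (ps_pos _ _ _ _ _ _ _ W); lra|].
      apply Rmult_lt_0_compat; [lra|]. apply (ps_pos _ _ _ _ _ _ _ W); auto.
    - intros y s Hy Hs. right. apply (ps_pde _ _ _ _ _ _ _ W); lra.
    (* For v = lam w(x, lam t) the diffusion and quadratic terms cancel, and v_t exceeds v (v_xx + 1
       - v) by lam (lam - 1) w. *)
    - intros y s Hy Hs. rewrite (ps_pde _ _ _ _ _ _ _ W y (lam * s)) by auto.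
      assert (0 < w y (lam * s)) by (apply (ps_pos _ _ _ _ _ _ _ W); auto; apply Hls; lra).
      assert (0 <= lam * w y (lam * s) * (lam - 1)) by (apply Rmult_le_pos; [apply Rmult_le_pos|]; lra).
      nra.
    - intros y Hy. rewrite Rmult_0_r. specialize (Hw0 y 0 Hy ltac:(lra)). nra.
    - intros s Hs. specialize (Hls s Hs). split.
      + destruct (ps_l _ _ _ _ _ _ _ W) as [E|E]; rewrite !E by lra; lra.
      + destruct (ps_r _ _ _ _ _ _ _ W) as [E|E]; rewrite !E by lra; lra. }
  rewrite El in HL. apply Rle_trans with (s1 * (lam * w x s2)).
  - apply Rmult_le_compat_l; lra.
  - rewrite <- Rmult_assoc, (Rmult_comm s1), El. lra.
Qed.

Lemma derive_nonneg (f : R -> R) (x r l : R) :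
  0 < r -> is_derive f x l -> (forall y, x < y < x + r -> f x <= f y) -> 0 <= l.
Proof.
  intros Hr Hd Hf. apply is_derive_Reals in Hd. apply Rnot_lt_le; intros Hl.
  destruct (Hd (- l) ltac:(lra)) as [del F].
  set (h := Rmin (del / 2) (r / 2)).
  assert (Hh : 0 < h) by (apply Rmin_pos; [pose proof (cond_pos del)|]; lra).
  assert (Hh1 : h <= del / 2) by apply Rmin_l. assert (Hh2 : h <= r / 2) by apply Rmin_r.
  specialize (F h ltac:(lra)). rewrite Rabs_pos_eq in F by lra. pose proof (cond_pos del).
  specialize (F ltac:(lra)). specialize (Hf (x + h) ltac:(lra)).
  apply Rabs_lt_between in F.
  assert (0 <= (f (x + h) - f x) / h) by (apply Rdiv_le_0_compat; lra). lra.
Qed.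

(** Inserting the equation in (t w)_t >= 0 and dividing by t w gives w_xx >= w - 1 - 1 / t. At t = T
    the bound is reached as a limit from earlier times, through [ps_cxx]. *)
Lemma psol_semiconvex (al be T : R) (w wx wxx wt : R -> R -> R) (x t : R) :
  psol al be T w wx wxx wt -> al < x < be -> 0 < t <= T -> - (1 + / t) <= wxx x t.
Proof.
  intros W Hx.
  assert (Hlt : forall t, 0 < t < T -> - (1 + / t) <= wxx x t).
  { clear t. intros t Ht.
    destruct (ps_smooth _ _ _ _ _ _ _ W x t Hx Ht) as [_ [_ [D _]]].
    assert (P : 0 < w x t) by (apply (ps_pos _ _ _ _ _ _ _ W); lra).
    assert (D2 : is_derive (fun s => s * w x s) t (w x t + t * wt x t)).
    { auto_derive. eexists; apply D.
      replace (Derive (fun x0 => w x x0) t) with (wt x t) by (symmetry; now apply is_derive_unique). ring. }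
    apply derive_nonneg with (r := T - t) in D2; [|lra|].
    - rewrite (ps_pde _ _ _ _ _ _ _ W x t Hx Ht) in D2.
      replace (w x t + t * (w x t * (wxx x t + 1 - w x t))) with (w x t * (t * (wxx x t + 1 + / t - w x t))) in D2 by (field; lra).
      assert (0 <= t * (wxx x t + 1 + / t - w x t)) by (apply Rmult_le_reg_l with (w x t); lra).
      assert (0 <= wxx x t + 1 + / t - w x t) by (apply Rmult_le_reg_l with t; lra).
      lra.
    - intros y Hy. eapply psol_mono; eauto; lra. }
  intros Ht. destruct (Rlt_le_dec t T) as [|HT]; [apply Hlt; lra|].
  replace t with T in * by lra. clear HT.
  apply Rnot_lt_le; intros Hn. set (e := - (1 + / T) - wxx x T). assert (He : 0 < e) by (unfold e; lra).
  destruct (ps_cxx _ _ _ _ _ _ _ W x (e / 2) Hx ltac:(lra)) as [del [Hd F]].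
  set (k := Rmin (del / 2) (T / 2)).
  assert (k <= del / 2) by apply Rmin_l. assert (k <= T / 2) by apply Rmin_r.
  assert (0 < k) by (apply Rmin_pos; lra).
  (* Since T - k2 >= T / 2, this bounds 1 / (T - k2) - 1 / T by e / 2; the other half of [e] absorbs
     the variation of [wxx]. *)
  set (k2 := Rmin k (e * T * T / 4)).
  assert (k2 <= k) by apply Rmin_l. assert (k2 <= e * T * T / 4) by apply Rmin_r.
  assert (0 < e * T * T) by (repeat apply Rmult_lt_0_compat; lra).
  assert (0 < k2) by (apply Rmin_pos; lra).
  specialize (F (T - k2) ltac:(lra) ltac:(lra)). apply Rabs_lt_between in F.
  specialize (Hlt (T - k2) ltac:(lra)).
  assert (/ (T - k2) - / T <= e / 2); [|unfold e in *; lra].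
  replace (/ (T - k2) - / T) with (k2 * / (T * (T - k2))) by (field; lra).
  apply Rle_trans with (e * T * T / 4 * / (T * (T / 2))).
  - apply Rmult_le_compat; try lra.
    + left; apply Rinv_0_lt_compat, Rmult_lt_0_compat; lra.
    + apply Rinv_le_contravar; [apply Rmult_lt_0_compat; lra|]. apply Rmult_le_compat_l; lra.
  - right; field; lra.
Qed.

(** * Semiconvexity and gradient bounds *)

Lemma continuous_nonneg_left (F : R -> R) (a b : R) :
  a < b -> continuous F a -> (forall x, a < x < b -> 0 <= F x) -> 0 <= F a.
Proof.
  intros Hab HF H. apply Rnot_lt_le; intros Hn.
  assert (L : locally (F a) (fun y => y < 0)) by (apply (locally_itv (F a - 1) 0); [lra|intros; lra]).
  destruct (HF _ L) as [[del Hd] G]. simpl in G.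
  set (h := Rmin (del / 2) ((b - a) / 2)).
  assert (0 < h) by (apply Rmin_pos; lra).
  assert (h <= del / 2) by apply Rmin_l. assert (h <= (b - a) / 2) by apply Rmin_r.
  specialize (H (a + h) ltac:(lra)).
  assert (F (a + h) < 0); [|lra]. apply G. change (Rabs (a + h - a) < del).
  apply Rabs_lt_between; lra.
Qed.

Lemma continuous_nonneg_right (F : R -> R) (a b : R) :
  a < b -> continuous F b -> (forall x, a < x < b -> 0 <= F x) -> 0 <= F b.
Proof.
  intros Hab HF H.
  rewrite <- (Ropp_involutive b).
  apply (continuous_nonneg_left (fun x => F (- x)) (- b) (- a)).
  - lra.
  - apply (continuous_comp (fun x => - x) F).
    + apply (continuous_opp (V := R_NormedModule)), continuous_id.
    + now rewrite Ropp_involutive.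
  - intros x Hx. apply H. lra.
Qed.

Lemma psol_continuous_x (al be T : R) (w wx wxx wt : R -> R -> R) (x t : R) :
  psol al be T w wx wxx wt -> 0 <= t <= T ->
  continuous (fun y => w (clamp al be y) t) x.
Proof.
  intros W Ht.
  pose proof (ps_itv _ _ _ _ _ _ _ W). pose proof (ps_T _ _ _ _ _ _ _ W).
  pose proof (ucont_clamp al be 0 T w ltac:(lra) ltac:(lra) (ps_uc _ _ _ _ _ _ _ W) x t) as C.
  apply continuity_2d_pt_fst in C. rewrite (clamp_id 0 T t) in C; auto.
Qed.

Lemma psol_dx_mono (al be T : R) (w wx wxx wt : R -> R -> R) (x y t K : R) :
  psol al be T w wx wxx wt -> 0 < t <= T -> 1 + / t <= K -> al < x -> x <= y -> y < be ->
  wx x t + K * x <= wx y t + K * y.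
Proof.
  intros W Ht HK Hx Hxy Hy.
  apply (nondecreasing_of_derive (fun z => wx z t + K * z) (fun z => wxx z t + K) al be); auto.
  - intros z Hz. pose proof (ps_dxx _ _ _ _ _ _ _ W z t Hz Ht) as D. auto_derive; [eexists; apply D|].
    replace (Derive (fun x0 => wx x0 t) z) with (wxx z t) by (symmetry; now apply is_derive_unique). ring.
  - intros z Hz. pose proof (psol_semiconvex _ _ _ _ _ _ _ z t W Hz Ht). lra.
Qed.

Lemma psol_chord (al be T : R) (w wx wxx wt : R -> R -> R) (x y t K : R) :
  psol al be T w wx wxx wt -> 0 < t <= T -> 1 + / t <= K -> al < x -> x < y -> y < be ->
  (wx x t - K * (y - x)) * (y - x) <= w y t - w x t <= (wx y t + K * (y - x)) * (y - x).
Proof.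
  intros W Ht HK Hx Hxy Hy.
  destruct (MVT_open (fun z => w z t) (fun z => wx z t) al be x y) as [c [Hc E]]; auto.
  { intros; now apply (ps_dx _ _ _ _ _ _ _ W). }
  rewrite E.
  pose proof (psol_dx_mono _ _ _ _ _ _ _ x c t K W Ht HK Hx ltac:(lra) ltac:(lra)).
  pose proof (psol_dx_mono _ _ _ _ _ _ _ c y t K W Ht HK ltac:(lra) ltac:(lra) Hy).
  assert (0 < / t) by (apply Rinv_0_lt_compat; lra).
  split; apply Rmult_le_compat_r; nra.
Qed.

(** At the end [al] only continuity of w is known, so the inequality for interior chords is passed
    to the limit; [clamp] supplies a function continuous on both sides of [al]. *)
Lemma psol_chord_l (al be T : R) (w wx wxx wt : R -> R -> R) (y t K : R) :
  psol al be T w wx wxx wt -> 0 < t <= T -> 1 + / t <= K -> al < y < be ->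
  w y t - w al t <= (wx y t + K * (y - al)) * (y - al).
Proof.
  intros W Ht HK Hy.
  set (F := fun x => (wx y t + K * (y - x)) * (y - x) - w y t + w (clamp al be x) t).
  assert (0 <= F al).
  { apply (continuous_nonneg_left F al y); [lra| |].
    - apply (continuous_plus (V := R_NormedModule)).
      + apply (ex_derive_continuous (V := R_NormedModule)). auto_derive. auto.
      + apply (psol_continuous_x _ _ _ _ _ _ _ _ _ W). lra.
    - intros x Hx. unfold F. rewrite clamp_id by lra.
      pose proof (psol_chord _ _ _ _ _ _ _ x y t K W Ht HK ltac:(lra) ltac:(lra) ltac:(lra)). lra. }
  unfold F in H. rewrite clamp_id in H by lra. lra.
Qed.

Lemma psol_chord_r (al be T : R) (w wx wxx wt : R -> R -> R) (x t K : R) :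
  psol al be T w wx wxx wt -> 0 < t <= T -> 1 + / t <= K -> al < x < be ->
  (wx x t - K * (be - x)) * (be - x) <= w be t - w x t.
Proof.
  intros W Ht HK Hx.
  set (F := fun y => - (wx x t - K * (y - x)) * (y - x) - w x t + w (clamp al be y) t).
  assert (0 <= F be).
  { apply (continuous_nonneg_right F x be); [lra| |].
    - apply (continuous_plus (V := R_NormedModule)).
      + apply (ex_derive_continuous (V := R_NormedModule)). auto_derive. auto.
      + apply (psol_continuous_x _ _ _ _ _ _ _ _ _ W). lra.
    - intros y Hy. unfold F. rewrite clamp_id by lra.
      pose proof (psol_chord _ _ _ _ _ _ _ x y t K W Ht HK ltac:(lra) ltac:(lra) ltac:(lra)). lra. }
  unfold F in H. rewrite clamp_id in H by lra. lra.
Qed.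

(** The subsolution is 1/4 + 3/4 exp (- A (be - x) - E (t1 - t)). Its floor 1/4 keeps the diffusion
    coefficient away from 0, and B <= 1 makes the reaction term nonnegative. It touches the value 1
    only at (be, t1) and is at most 1/2 on the other two sides, where w >= 1/2. As [A] and [del] do
    not depend on [t1], the bound is uniform in time. *)
Lemma psol_barrier_one (al be T t0 : R) (w wx wxx wt : R -> R -> R) :
  psol al be T w wx wxx wt -> 0 < t0 <= T -> (forall t, 0 <= t <= T -> w be t = 1) ->
  exists A del, 0 < del /\ al < be - del /\
    forall x t, be - del <= x <= be -> t0 <= t <= T -> 1 - A * (be - x) <= w x t.
Proof.
  intros W Ht0 Hone.
  pose proof (ps_itv _ _ _ _ _ _ _ W) as Hab.
  destruct (ps_uc _ _ _ _ _ _ _ W (/ 2) ltac:(lra)) as [d1 [Hd1 F]].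
  set (del := Rmin (d1 / 2) ((be - al) / 2)).
  assert (Hd : 0 < del) by (apply Rmin_pos; lra).
  assert (del <= d1 / 2) by apply Rmin_l. assert (del <= (be - al) / 2) by apply Rmin_r.
  assert (Hhalf : forall x t, be - del <= x <= be -> 0 <= t <= T -> / 2 <= w x t).
  { intros x t Hx Ht. specialize (F be t x t ltac:(lra) Ht ltac:(lra) Ht
      ltac:(apply Rabs_lt_between; lra) ltac:(apply Rabs_lt_between; lra)).
    rewrite (Hone t Ht) in F. apply Rabs_lt_between in F. lra. }
  (* Going back a time t0 / 2 or a distance [del] makes the exponent at most -2, and 1/4 + 3/4 exp
     (-2) <= 1/2. The term 4 E + 1 gives A^2 >= 4 E, so that B B_xx dominates B_t. *)
  set (E := 4 / t0). set (A := 2 / del + (4 * E + 1)).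
  assert (HE : 0 < E) by (apply Rdiv_lt_0_compat; lra).
  assert (HEt : E * (t0 / 2) = 2) by (unfold E; field; lra).
  assert (Hdd : 0 < 2 / del) by (apply Rdiv_lt_0_compat; lra).
  assert (HAd : 2 <= A * del).
  { unfold A. rewrite Rmult_plus_distr_r. replace (2 / del * del) with 2 by (field; lra). nra. }
  assert (HA2 : 4 * E <= A * A) by (unfold A; nra).
  assert (HA : 1 <= A) by (unfold A; lra).
  assert (He2 : exp (- 2) <= / 3).
  { replace (exp (- 2)) with (/ exp 2) by (rewrite <- exp_Ropp; f_equal; lra). apply Rinv_le_contravar; [lra|]. pose proof (exp_ge 2). lra. }
  assert (Mexp : forall p q, p <= q -> exp p <= exp q).
  { intros p q [?|<-]; [left; now apply exp_increasing|lra]. }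
  clearbody A E. exists A, del. split; [auto|]. split; [lra|]. intros x t1 Hx Ht1.
  set (B := fun x t => / 4 + 3 / 4 * exp (- A * (be - x) - E * (t1 - t))).
  assert (HB : B x t1 <= w x t1).
  { apply (comparison (be - del) be (t1 - t0 / 2) t1 B
      (fun x t => 3 / 4 * (A * exp (- A * (be - x) - E * (t1 - t))))
      (fun x t => 3 / 4 * (A * (A * exp (- A * (be - x) - E * (t1 - t)))))
      (fun x t => 3 / 4 * (E * exp (- A * (be - x) - E * (t1 - t)))) w wx wxx wt); try lra.
    - apply ucont_of_continuity. intros y s _ _. unfold B. c2d. apply continuity_2d_pt_exp. c2d.
    - eapply ucont_restrict; [..|apply (ps_uc _ _ _ _ _ _ _ W)]; lra.
    - intros y s Hy Hs. unfold B.
      split; [|split; [|split; [|split; [|split; [|split]]]]];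
      [auto_derive; [auto|unfold Rminus; ring]..| | | |]; c2d; apply continuity_2d_pt_exp; c2d.
    - eapply smooth_restrict; [..|apply (ps_smooth _ _ _ _ _ _ _ W)]; lra.
    - intros y s Hy Hs. split; [|apply (ps_pos _ _ _ _ _ _ _ W); lra].
      unfold B. pose proof (exp_pos (- A * (be - y) - E * (t1 - s))). lra.
    - intros y s Hy Hs. unfold B. set (e := exp (- A * (be - y) - E * (t1 - s))).
      assert (He : 0 < e) by apply exp_pos.
      assert (He1 : e <= 1).
      { rewrite <- exp_0. apply Mexp. nra. }
      assert (P : 0 <= (/ 4 + 3 / 4 * e) * (1 - (/ 4 + 3 / 4 * e))) by (apply Rmult_le_pos; lra).
      assert (Q : 4 * E * e <= A * A * e) by (apply Rmult_le_compat_r; lra).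
      assert (Q2 : 0 <= 3 / 4 * e * (3 / 4 * (A * A * e))) by (repeat apply Rmult_le_pos; lra).
      nra.
    - intros y s Hy Hs. right. symmetry. apply (ps_pde _ _ _ _ _ _ _ W); lra.
    - intros y Hy. apply Rle_trans with (/ 2); [|apply Hhalf; lra]. unfold B.
      assert (exp (- A * (be - y) - E * (t1 - (t1 - t0 / 2))) <= exp (- 2)) by (apply Mexp; nra). lra.
    - intros s Hs. split.
      + apply Rle_trans with (/ 2); [|apply Hhalf; lra]. unfold B.
        assert (exp (- A * (be - (be - del)) - E * (t1 - s)) <= exp (- 2)) by (apply Mexp; nra). lra.
      + rewrite Hone by lra. unfold B.
        assert (exp (- A * (be - be) - E * (t1 - s)) <= exp 0) by (apply Mexp; nra). rewrite exp_0 in H1. lra. }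
  apply Rle_trans with (B x t1); auto. unfold B.
  pose proof (exp_ge (- A * (be - x) - E * (t1 - t1))).
  assert (0 <= A * (be - x)) by (apply Rmult_le_pos; lra). lra.
Qed.

(** By semiconvexity the derivative at x exceeds the slope of the chord to [be] by at most K (be -
    x). That chord slope is negative if w = 0 at [be], and at most [A] near [be] if w = 1 there;
    monotonicity of wx + K x extends the latter bound to the whole interval. *)
Lemma psol_dx_upper (al be T t0 : R) (w wx wxx wt : R -> R -> R) :
  psol al be T w wx wxx wt -> 0 < t0 <= T ->
  exists M, forall x t, al < x < be -> t0 <= t <= T -> wx x t <= M.
Proof.
  intros W Ht0. pose proof (ps_itv _ _ _ _ _ _ _ W) as Hab.
  set (K := 1 + / t0).
  assert (HK0 : 0 < K) by (unfold K; assert (0 < / t0) by (apply Rinv_0_lt_compat; lra); lra).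
  assert (HK : forall t, t0 <= t -> 1 + / t <= K).
  { intros t Ht. unfold K. apply Rplus_le_compat_l, Rinv_le_contravar; lra. }
  destruct (ps_r _ _ _ _ _ _ _ W) as [Hz|Ho].
  - exists (K * (be - al)). intros x t Hx Ht.
    pose proof (psol_chord_r _ _ _ _ _ _ _ x t K W ltac:(lra) (HK t ltac:(lra)) Hx) as C.
    rewrite Hz in C by lra.
    assert (0 < w x t) by (apply (ps_pos _ _ _ _ _ _ _ W); lra).
    assert (wx x t - K * (be - x) <= 0) by (apply Rnot_lt_le; intros ?; nra).
    nra.
  - destruct (psol_barrier_one al be T t0 w wx wxx wt W Ht0 Ho) as [A [del [Hd [Hdal HA]]]].
    assert (Near : forall x t, be - del <= x < be -> t0 <= t <= T -> wx x t <= A + K * (be - al)).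
    { intros x t Hx Ht.
      pose proof (psol_chord_r _ _ _ _ _ _ _ x t K W ltac:(lra) (HK t ltac:(lra)) ltac:(lra)) as C.
      rewrite Ho in C by lra. specialize (HA x t ltac:(lra) Ht).
      assert (wx x t - K * (be - x) <= A) by (apply Rmult_le_reg_r with (be - x); lra).
      nra. }
    exists (A + K * (be - al) + K * (be - al)). intros x t Hx Ht.
    assert (0 < K * (be - al)) by (apply Rmult_lt_0_compat; lra).
    destruct (Rlt_le_dec x (be - del)) as [Hl|Hr].
    + pose proof (psol_dx_mono _ _ _ _ _ _ _ x (be - del) t K W ltac:(lra) (HK t ltac:(lra)) ltac:(lra) ltac:(lra) ltac:(lra)).
      specialize (Near (be - del) t ltac:(lra) Ht). nra.
    + specialize (Near x t ltac:(lra) Ht). lra.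
Qed.

Lemma psol_reflect (al be T c : R) (w wx wxx wt : R -> R -> R) :
  psol al be T w wx wxx wt ->
  psol (c - be) (c - al) T (fun x t => w (c + -1 * x) t) (fun x t => -1 * wx (c + -1 * x) t)
    (fun x t => wxx (c + -1 * x) t) (fun x t => wt (c + -1 * x) t).
Proof. intros W. apply (psol_affine al be); auto. right. repeat split; ring. Qed.

Lemma psol_dx_bounded (al be T t0 : R) (w wx wxx wt : R -> R -> R) :
  psol al be T w wx wxx wt -> 0 < t0 <= T ->
  exists M, forall x t, al < x < be -> t0 <= t <= T -> Rabs (wx x t) <= M.
Proof.
  intros W Ht0.
  destruct (psol_dx_upper al be T t0 w wx wxx wt W Ht0) as [M1 H1].
  destruct (psol_dx_upper _ _ T t0 _ _ _ _ (psol_reflect al be T 0 _ _ _ _ W) Ht0) as [M2 H2].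
  exists (Rmax M1 M2). intros x t Hx Ht. specialize (H1 x t Hx Ht).
  specialize (H2 (- x) t ltac:(lra) Ht). simpl in H2. replace (0 + -1 * - x) with x in H2 by ring.
  pose proof (Rmax_l M1 M2). pose proof (Rmax_r M1 M2). apply Rabs_le_between; lra.
Qed.

(** * The slope at a zero *)

Lemma nondecreasing_right_limit (f : R -> R) (L : R) :
  0 < L -> (forall x y, 0 < x -> x <= y -> y < L -> f x <= f y) ->
  (forall x, 0 < x < L -> 0 <= f x) ->
  exists l, 0 <= l /\ (forall x, 0 < x < L -> l <= f x) /\
    forall eps, 0 < eps -> exists del, 0 < del < L /\ forall x, 0 < x <= del -> f x < l + eps.
Proof.
  intros HL Hm Hp.
  destruct (completeness (fun z => exists x, 0 < x < L /\ z = - f x)) as [m [Hub Hlub]].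
  - exists 0. intros z [x [Hx ->]]. specialize (Hp x Hx). lra.
  - exists (- f (L / 2)), (L / 2). split; lra.
  - exists (- m). split; [|split].
    + assert (m <= 0); [|lra]. apply Hlub. intros z [x [Hx ->]]. specialize (Hp x Hx). lra.
    + intros x Hx. assert (- f x <= m); [|lra]. apply Hub. now exists x.
    + intros eps He. apply Classical_Prop.NNPP. intros Hn.
      assert (m <= m - eps); [|lra]. apply Hlub. intros z [x [Hx ->]].
      apply Rnot_lt_le; intros Hlt. apply Hn. exists x. split; auto.
      intros y Hy. specialize (Hm y x ltac:(lra) ltac:(lra) ltac:(lra)). lra.
Qed.

(** The common limit of wx and w / x at the zero, recorded as an infimum: the lower bounds,
    corrected by K x, hold on all of (0, L), and only the upper ones are local. [K] is a parameter
    so that one value can serve a whole range of times. *)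
Definition slope (L K : R) (w wx : R -> R -> R) (t g : R) : Prop :=
  0 <= g /\
  (forall x, 0 < x < L -> g <= wx x t + K * x) /\
  (forall x, 0 < x < L -> (g - K * x) * x <= w x t) /\
  (forall eps, 0 < eps -> exists del, 0 < del < L /\
     forall x, 0 < x <= del -> wx x t + K * x < g + eps /\ w x t < (g + eps) * x).

Lemma psol_slope (L T K t : R) (w wx wxx wt : R -> R -> R) :
  psol 0 L T w wx wxx wt -> (forall t, 0 <= t <= T -> w 0 t = 0) ->
  0 < t <= T -> 1 + / t <= K ->
  exists g, slope L K w wx t g.
Proof.
  intros W Hz Ht HK. pose proof (ps_itv _ _ _ _ _ _ _ W) as HL.
  assert (Hl : forall x, 0 < x < L -> w x t <= (wx x t + K * x) * x).
  { intros x Hx. pose proof (psol_chord_l _ _ _ _ _ _ _ x t K W Ht HK Hx) as C.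
    rewrite Hz, !Rminus_0_r in C by lra. exact C. }
  destruct (nondecreasing_right_limit (fun x => wx x t + K * x) L HL) as [g [G0 [G1 G2]]].
  - intros x y Hx Hxy Hy. now apply (psol_dx_mono 0 L T w wx wxx wt).
  - intros x Hx. specialize (Hl x Hx).
    assert (0 < w x t) by (apply (ps_pos _ _ _ _ _ _ _ W); lra).
    apply Rnot_lt_le; intros ?. nra.
  - exists g. split; [auto|]. split; [auto|]. split.
    + intros y Hy.
      set (F := fun x => w y t - (g - K * y) * (y - x) - w (clamp 0 L x) t).
      assert (H : 0 <= F 0).
      { apply (continuous_nonneg_left F 0 y); [lra| |].
        - apply (continuous_minus (V := R_NormedModule)).
          + apply (ex_derive_continuous (V := R_NormedModule)). auto_derive. auto.
          + apply (psol_continuous_x _ _ _ _ _ _ _ _ _ W). lra.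
        - intros x Hx. unfold F. rewrite clamp_id by lra.
          pose proof (psol_chord _ _ _ _ _ _ _ x y t K W Ht HK ltac:(lra) ltac:(lra) ltac:(lra)) as [C _].
          specialize (G1 x ltac:(lra)). nra. }
      unfold F in H. rewrite clamp_id, Hz, Rminus_0_r in H by lra. lra.
    + intros eps He. destruct (G2 eps He) as [del [Hd F]]. exists del. split; auto.
      intros x Hx. specialize (F x Hx). split; auto. specialize (Hl x ltac:(lra)). nra.
Qed.

(** * Continuity of the slope *)

(** The barrier is the line p x plus a parabola vanishing at x0, plus a term growing at rate E in
    time. At 2 x0 the parabola alone equals C (2 x0), which dominates w. On (0, 2 x0) the barrier is
    of order x0 and its second derivative is 4 C / x0; their product is bounded independently of x0,
    so a fixed rate E suffices for a time of order x0. *)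
Lemma upper_step (L T s1 ts x0 p eta C : R) (w wx wxx wt : R -> R -> R) :
  psol 0 L T w wx wxx wt -> (forall t, 0 <= t <= T -> w 0 t = 0) ->
  0 < s1 < ts -> ts <= T -> 0 < x0 <= 1 -> 2 * x0 < L -> 0 < p -> 0 < eta -> 0 < C ->
  (forall x, 0 <= x <= 2 * x0 -> w x s1 <= p * x) ->
  (forall s, s1 <= s <= ts -> w (2 * x0) s <= C * (2 * x0)) ->
  (2 * p + 2 * C + eta) * (4 * C + 1) * (ts - s1) <= eta * x0 ->
  w x0 ts <= (p + eta) * x0.
Proof.
  intros W Hz Hs Hts Hx0 HxL Hp Heta HC Hini Hlat Hshort.
  set (E := (2 * p + 2 * C + eta) * (4 * C + 1)) in *.
  assert (HE : 0 < E) by (apply Rmult_lt_0_compat; lra).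
  set (V := fun x s => p * x + 2 * C / x0 * (x - x0) ^ 2 + E * (s - s1)).
  assert (HD : 0 < 2 * C / x0) by (apply Rdiv_lt_0_compat; lra).
  assert (HDx : 2 * C / x0 * x0 = 2 * C) by (field; lra).
  assert (HV : w x0 ts <= V x0 ts).
  { apply (comparison 0 (2 * x0) s1 ts w wx wxx wt V
      (fun x s => p + 4 * C / x0 * (x - x0)) (fun x s => 4 * C / x0) (fun x s => E)); try lra.
    - eapply ucont_restrict; [..|apply (ps_uc _ _ _ _ _ _ _ W)]; lra.
    - apply ucont_of_continuity. intros y s _ _. unfold V. simpl. c2d.
    - eapply smooth_restrict; [..|apply (ps_smooth _ _ _ _ _ _ _ W)]; lra.
    - intros y s Hy Hs'. unfold V.
      split; [|split; [|split; [|split; [|split; [|split]]]]];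
      [auto_derive; [auto|field; lra]..| | | |]; simpl; c2d.
    - intros y s Hy Hs'. split; [apply (ps_pos _ _ _ _ _ _ _ W); lra|]. unfold V.
      assert (0 < p * y) by (apply Rmult_lt_0_compat; lra).
      assert (0 <= 2 * C / x0 * (y - x0) ^ 2) by (apply Rmult_le_pos; [lra|apply pow2_ge_0]).
      assert (0 <= E * (s - s1)) by (apply Rmult_le_pos; lra). lra.
    - intros y s Hy Hs'. right. apply (ps_pde _ _ _ _ _ _ _ W); lra.
    - intros y s Hy Hs'.
      assert (H1 : (y - x0) ^ 2 <= x0 * x0) by nra.
      assert (H2 : 2 * C / x0 * (y - x0) ^ 2 <= 2 * C * x0).
      { rewrite <- HDx at 2. rewrite Rmult_assoc. apply Rmult_le_compat_l; lra. }
      assert (H3 : E * (s - s1) <= eta * x0).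
      { eapply Rle_trans; [|exact Hshort]. apply Rmult_le_compat_l; lra. }
      assert (H4 : p * y <= p * (2 * x0)) by (apply Rmult_le_compat_l; lra).
      assert (H5 : V y s <= (2 * p + 2 * C + eta) * x0) by (unfold V; lra).
      assert (H6 : 0 <= V y s).
      { unfold V. assert (0 < p * y) by (apply Rmult_lt_0_compat; lra).
        assert (0 <= 2 * C / x0 * (y - x0) ^ 2) by (apply Rmult_le_pos; [lra|apply pow2_ge_0]).
        assert (0 <= E * (s - s1)) by (apply Rmult_le_pos; lra). lra. }
      apply Rle_trans with (V y s * (4 * C / x0 + 1)); [apply Rmult_le_compat_l; lra|].
      assert (0 < 4 * C / x0) by (apply Rdiv_lt_0_compat; lra).
      apply Rle_trans with ((2 * p + 2 * C + eta) * x0 * (4 * C / x0 + 1)); [apply Rmult_le_compat_r; lra|].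
      replace ((2 * p + 2 * C + eta) * x0 * (4 * C / x0 + 1)) with ((2 * p + 2 * C + eta) * (4 * C + x0)) by (field; lra).
      unfold E. apply Rmult_le_compat_l; lra.
    - intros y Hy. unfold V. assert (0 <= 2 * C / x0 * (y - x0) ^ 2) by (apply Rmult_le_pos; [lra|apply pow2_ge_0]).
      specialize (Hini y Hy). lra.
    - intros s Hs'. assert (0 <= E * (s - s1)) by (apply Rmult_le_pos; lra). unfold V. split.
      + rewrite Hz by lra. assert (0 <= 2 * C / x0 * (0 - x0) ^ 2) by (apply Rmult_le_pos; [lra|apply pow2_ge_0]). lra.
      + specialize (Hlat s Hs'). replace (2 * C / x0 * (2 * x0 - x0) ^ 2) with (C * (2 * x0)) by (field; lra).
        assert (0 < p * (2 * x0)) by (apply Rmult_lt_0_compat; lra). lra. }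
  eapply Rle_trans; [exact HV|]. unfold V. replace ((x0 - x0) ^ 2) with 0 by ring. lra.
Qed.

(* [exp (ka * sqrt (x / X))] is a subsolution, at rate [ka^2/4], of the radial operator x F'' + 2 F', that is of the Laplacian in dimension 4 in the variable 2 sqrt x, which governs u / x. It transports to the boundary, within a time proportional to X with arbitrarily small factor, an excess of u / x at X. *)
Lemma lower_step (L T s1 s2 X m a th ka mu : R) (w wx wxx wt : R -> R -> R) :
  psol 0 L T w wx wxx wt -> (forall t, 0 <= t <= T -> w 0 t = 0) ->
  0 < s1 < s2 -> s2 <= T -> 0 < X < L -> 0 < th -> 0 < ka -> 0 <= mu -> 0 < a ->
  (forall x, 0 <= x <= X -> m * x <= w x s1) ->
  (forall s, s1 <= s <= s2 -> (m + th * exp (ka + mu * ((s2 - s1) / X))) * X <= w X s) ->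
  a <= m - th * exp ka ->
  (m + th * exp (ka + mu * ((s2 - s1) / X))) * X <= 1 ->
  mu <= a * ka ^ 2 / 4 ->
  forall x, 0 <= x <= X -> (m + th * (exp (mu * ((s2 - s1) / X)) - exp ka)) * x <= w x s2.
Proof.
  intros W Hz Hs Hs2 HX Hth Hka Hmu Ha Hini Hlat Ham HX1 Hmua x Hx.
  set (G := fun x s => exp (ka * sqrt (x / X) + mu * ((s - s1) / X))).
  (* Subtracting [exp ka] puts [B] below m x at time s1. Later the increasing lateral value lifts
     [G] everywhere, at x = 0 to exp (mu (s - s1) / X). *)
  set (B := fun x s => m * x + th * x * (G x s - exp ka)).
  assert (Mexp : forall p q, p <= q -> exp p <= exp q).
  { intros p q [?|<-]; [left; now apply exp_increasing|lra]. }
  assert (Hm : 0 < m) by (pose proof (exp_pos ka); nra).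
  assert (HG0 : forall y s, 0 < G y s) by (intros; apply exp_pos).
  assert (Hsq : forall y, 0 <= y <= X -> 0 <= sqrt (y / X) <= 1).
  { intros y Hy. split; [apply sqrt_pos|]. rewrite <- sqrt_1. apply sqrt_le_1_alt.
    apply Rmult_le_reg_r with X; [lra|]. unfold Rdiv. rewrite Rmult_assoc, Rinv_l; lra. }
  assert (HsX : forall s, s1 <= s <= s2 -> 0 <= (s - s1) / X <= (s2 - s1) / X).
  { intros s Hs'. split; [apply Rdiv_le_0_compat; lra|].
    apply Rmult_le_compat_r; [left; apply Rinv_0_lt_compat|]; lra. }
  assert (HG1 : forall y s, 0 <= y <= X -> s1 <= s <= s2 -> G y s <= exp (ka + mu * ((s2 - s1) / X))).
  { intros y s Hy Hs'. apply Mexp. specialize (Hsq y Hy). specialize (HsX s Hs').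
    assert (ka * sqrt (y / X) <= ka * 1) by (apply Rmult_le_compat_l; lra).
    assert (mu * ((s - s1) / X) <= mu * ((s2 - s1) / X)) by (apply Rmult_le_compat_l; lra). lra. }
  assert (HBlow : forall y s, 0 <= y -> a * y <= B y s).
  { intros y s Hy. unfold B. specialize (HG0 y s).
    assert (0 <= th * y * G y s) by (repeat apply Rmult_le_pos; lra).
    assert (a * y <= (m - th * exp ka) * y) by (apply Rmult_le_compat_r; lra). nra. }
  assert (HBup : forall y s, 0 <= y <= X -> s1 <= s <= s2 -> B y s <= (m + th * exp (ka + mu * ((s2 - s1) / X))) * y).
  { intros y s Hy Hs'. unfold B. specialize (HG1 y s Hy Hs'). pose proof (exp_pos ka).
    assert (th * y * G y s <= th * y * exp (ka + mu * ((s2 - s1) / X))) by (apply Rmult_le_compat_l; [apply Rmult_le_pos|]; lra).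
    assert (0 <= th * y * exp ka) by (repeat apply Rmult_le_pos; lra). lra. }
  assert (HBx : B x s2 <= w x s2).
  { apply (comparison 0 X s1 s2 B
      (fun y s => m + th * (G y s - exp ka) + th * (ka / 2) * (sqrt (y / X) * G y s))
      (fun y s => th * (ka / (2 * X)) * (G y s / sqrt (y / X)) +
         th * (ka / (4 * X)) * (G y s / sqrt (y / X)) + th * (ka ^ 2 / (4 * X)) * G y s)
      (fun y s => th * y * (mu / X) * G y s) w wx wxx wt); try lra.
    - apply ucont_of_continuity. intros y s Hy _.
      unfold B, G. c2d. apply continuity_2d_pt_exp. unfold Rdiv. c2d.
      apply continuity_1d_2d_pt_comp; [|c2d]. apply continuity_pt_sqrt. apply Rdiv_le_0_compat; lra.
    - eapply ucont_restrict; [..|apply (ps_uc _ _ _ _ _ _ _ W)]; lra.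
    - intros y s Hy Hs'.
      assert (Hr : 0 < sqrt (y / X)) by (apply sqrt_lt_R0, Rdiv_lt_0_compat; lra).
      assert (Hrr : y = X * (sqrt (y / X) * sqrt (y / X))).
      { rewrite sqrt_sqrt by (apply Rdiv_le_0_compat; lra). field; lra. }
      assert (Hyp : 0 < y / X) by (apply Rdiv_lt_0_compat; lra).
      assert (CS : continuity_2d_pt (fun y s => sqrt (y / X)) y s).
      { apply continuity_1d_2d_pt_comp; [|unfold Rdiv; c2d]. apply continuity_pt_sqrt; lra. }
      assert (CG : continuity_2d_pt G y s).
      { apply continuity_2d_pt_exp. unfold Rdiv in *. c2d. }
      assert (DG : is_derive (fun z => G z s) y (ka / (2 * X) * (G y s / sqrt (y / X)))).
      { unfold G. auto_derive; [exact Hyp|]. unfold Rdiv, Rminus in *. field. split; lra. }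
      assert (DS : is_derive (fun z => sqrt (z / X)) y (/ (2 * X * sqrt (y / X)))).
      { auto_derive; [exact Hyp|]. unfold Rdiv in *. field. split; lra. }
      split; [|split; [|split; [|split; [|split; [|split]]]]].
      + unfold B. auto_derive; [eexists; apply DG|].
        replace (Derive (fun x => G x s) y) with (ka / (2 * X) * (G y s / sqrt (y / X))) by (symmetry; now apply is_derive_unique).
        set (r := sqrt (y / X)) in *. rewrite Hrr at 2. field. split; lra.
      + auto_derive; [split; [eexists; apply DG|split; [exact Hyp|split; [eexists; apply DG|auto]]]|].
        replace (Derive (fun x => G x s) y) with (ka / (2 * X) * (G y s / sqrt (y / X))) by (symmetry; now apply is_derive_unique).
        unfold Rdiv in *. field. split; lra.
      + unfold B, G. auto_derive; [auto|]. unfold Rdiv, Rminus. ring.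
      + unfold B. c2d.
      + c2d.
      + unfold Rdiv in *. c2d; lra.
      + c2d.
    - eapply smooth_restrict; [..|apply (ps_smooth _ _ _ _ _ _ _ W)]; lra.
    - intros y s Hy Hs'. split; [|apply (ps_pos _ _ _ _ _ _ _ W); lra].
      eapply Rlt_le_trans; [|apply HBlow; lra]. apply Rmult_lt_0_compat; lra.
    - intros y s Hy Hs'. specialize (HBlow y s ltac:(lra)). specialize (HBup y s ltac:(lra) ltac:(lra)).
      specialize (HG0 y s).
      assert (Hr : 0 < sqrt (y / X)) by (apply sqrt_lt_R0, Rdiv_lt_0_compat; lra).
      assert (HB1 : B y s <= 1).
      { eapply Rle_trans; [exact HBup|]. eapply Rle_trans; [|exact HX1]. apply Rmult_le_compat_l; [|lra].
        pose proof (exp_pos (ka + mu * ((s2 - s1) / X))). nra. }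
      assert (Q : 0 < G y s / sqrt (y / X)) by (apply Rdiv_lt_0_compat; lra).
      assert (Q1 : 0 < ka / (2 * X)) by (apply Rdiv_lt_0_compat; lra).
      assert (Q2 : 0 < ka / (4 * X)) by (apply Rdiv_lt_0_compat; lra).
      assert (Q3 : 0 < ka ^ 2 / (4 * X)) by (apply Rdiv_lt_0_compat; [nra|lra]).
      assert (0 < th * (ka / (2 * X)) * (G y s / sqrt (y / X))) by (apply Rmult_lt_0_compat; [apply Rmult_lt_0_compat|]; lra).
      assert (0 < th * (ka / (4 * X)) * (G y s / sqrt (y / X))) by (apply Rmult_lt_0_compat; [apply Rmult_lt_0_compat|]; lra).
      assert (0 < th * (ka ^ 2 / (4 * X)) * G y s) by (apply Rmult_lt_0_compat; [apply Rmult_lt_0_compat|]; lra).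
      assert (Hay : 0 < a * y) by (apply Rmult_lt_0_compat; lra).
      (* Of the three terms of the second derivative, the two singular at 0 are positive and are
         dropped, as is the reaction term, since B <= 1. What remains, with B >= a y, yields the
         rate a ka^2 / 4. *)
      apply Rle_trans with (a * y * (th * (ka ^ 2 / (4 * X)) * G y s)).
      + replace (a * y * (th * (ka ^ 2 / (4 * X)) * G y s)) with (th * y * ((a * ka ^ 2 / 4) / X) * G y s) by (field; lra).
        apply Rmult_le_compat_r; [lra|]. apply Rmult_le_compat_l; [nra|].
        apply Rmult_le_compat_r; [left; apply Rinv_0_lt_compat|]; lra.
      + apply Rmult_le_compat; lra.
    - intros y s Hy Hs'. right. symmetry. apply (ps_pde _ _ _ _ _ _ _ W); lra.
    - intros y Hy. eapply Rle_trans; [|apply Hini; lra]. unfold B.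
      assert (G y s1 <= exp ka).
      { apply Mexp. specialize (Hsq y Hy). replace ((s1 - s1) / X) with 0 by (field; lra).
        assert (ka * sqrt (y / X) <= ka * 1) by (apply Rmult_le_compat_l; lra). lra. }
      assert (th * y * (G y s1 - exp ka) <= 0); [|lra].
      assert (0 <= th * y) by (apply Rmult_le_pos; lra). nra.
    - intros s Hs'. split.
      + rewrite Hz by lra. unfold B. lra.
      + eapply Rle_trans; [apply HBup; lra|]. now apply Hlat. }
  eapply Rle_trans; [|exact HBx]. unfold B.
  assert (exp (mu * ((s2 - s1) / X)) <= G x s2).
  { apply Mexp. specialize (Hsq x Hx). assert (0 <= ka * sqrt (x / X)) by (apply Rmult_le_pos; lra). lra. }
  assert (0 <= th * x) by (apply Rmult_le_pos; lra). nra.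
Qed.

Lemma slope_weaken (L K K' t g : R) (w wx : R -> R -> R) :
  0 < L -> 0 <= K <= K' -> slope L K w wx t g -> slope L K' w wx t g.
Proof.
  intros HL HK [G0 [G1 [G2 G3]]]. split; [auto|]. split; [|split].
  - intros x Hx. specialize (G1 x Hx). nra.
  - intros x Hx. specialize (G2 x Hx). assert (K * x <= K' * x) by nra. nra.
  - intros eps He. destruct (G3 (eps / 2) ltac:(lra)) as [del [Hd F]].
    set (q := eps / (2 * (K' + 1))).
    assert (Hq : 0 < q) by (apply Rdiv_lt_0_compat; lra).
    assert (Hq2 : (K' + 1) * q = eps / 2) by (unfold q; field; lra).
    exists (Rmin del q). pose proof (Rmin_l del q). pose proof (Rmin_r del q).
    assert (0 < Rmin del q) by (apply Rmin_pos; lra).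
    split; [lra|]. intros x Hx. destruct (F x ltac:(lra)) as [F1 F2].
    assert (K' * x <= K' * q) by (apply Rmult_le_compat_l; lra).
    assert (0 <= K * x) by (apply Rmult_le_pos; lra).
    split; [lra|]. nra.
Qed.

(** The monotonicity of t w(x, t), divided by x, near x = 0. *)
Lemma slope_mono (L T K s1 s2 g1 g2 : R) (w wx wxx wt : R -> R -> R) :
  psol 0 L T w wx wxx wt -> 0 <= K -> 0 < s1 <= s2 -> s2 <= T ->
  slope L K w wx s1 g1 -> slope L K w wx s2 g2 -> s1 * g1 <= s2 * g2.
Proof.
  intros W HK Hs Hs2 [_ [_ [A _]]] [_ [_ [_ B]]].
  apply Rnot_lt_le; intros Hn. set (D := s1 * g1 - s2 * g2). assert (HD : 0 < D) by (unfold D; lra).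
  destruct (B (D / (2 * s2))) as [del [Hd F]]; [apply Rdiv_lt_0_compat; lra|].
  set (q := D / (2 * s1 * (K + 1))).
  assert (Hq : 0 < q) by (apply Rdiv_lt_0_compat; [|apply Rmult_lt_0_compat]; lra).
  assert (Hq2 : s1 * ((K + 1) * q) = D / 2) by (unfold q; field; lra).
  set (x := Rmin del q).
  assert (x <= del) by apply Rmin_l. assert (x <= q) by apply Rmin_r.
  assert (Hx : 0 < x) by (apply Rmin_pos; lra).
  specialize (A x ltac:(lra)). destruct (F x ltac:(lra)) as [_ F2].
  pose proof (psol_mono 0 L T w wx wxx wt s1 s2 x W ltac:(lra) ltac:(lra) Hs2 ltac:(lra)) as M.
  assert (E1 : s1 * ((g1 - K * x) * x) < s2 * ((g2 + D / (2 * s2)) * x)).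
  { apply Rle_lt_trans with (s1 * w x s1); [apply Rmult_le_compat_l; lra|].
    eapply Rle_lt_trans; [exact M|]. apply Rmult_lt_compat_l; lra. }
  assert (E2 : s1 * (g1 - K * x) < s2 * (g2 + D / (2 * s2))).
  { apply Rmult_lt_reg_r with x; auto. lra. }
  replace (s2 * (g2 + D / (2 * s2))) with (s2 * g2 + D / 2) in E2 by (field; lra).
  assert (s1 * (K * x) <= s1 * ((K + 1) * q)).
  { apply Rmult_le_compat_l; [lra|]. apply Rmult_le_compat; lra. }
  unfold D in *. lra.
Qed.

Lemma slope_usc (L T K ts g : R) (w wx wxx wt : R -> R -> R) :
  psol 0 L T w wx wxx wt -> 0 <= K -> 0 < ts <= T -> slope L K w wx ts g ->
  forall eps, 0 < eps -> exists del, 0 < del /\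
    forall s g', 0 < s <= T -> Rabs (s - ts) < del -> slope L K w wx s g' -> g' < g + eps.
Proof.
  intros W HK Hts [_ [_ [_ B]]] eps He.
  destruct (B (eps / 4) ltac:(lra)) as [del [Hd F]].
  set (q := eps / (4 * (K + 1))).
  assert (Hq : 0 < q) by (apply Rdiv_lt_0_compat; lra).
  assert (Hq2 : (K + 1) * q = eps / 4) by (unfold q; field; lra).
  set (x := Rmin del q).
  assert (x <= del) by apply Rmin_l. assert (x <= q) by apply Rmin_r.
  assert (Hx : 0 < x) by (apply Rmin_pos; lra).
  destruct (F x ltac:(lra)) as [_ F2].
  destruct (ps_uc _ _ _ _ _ _ _ W (eps / 4 * x)) as [d1 [Hd1 U]]; [apply Rmult_lt_0_compat; lra|].
  exists d1. split; auto. intros s g' Hs Hsd [_ [_ [A _]]].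
  specialize (A x ltac:(lra)).
  specialize (U x ts x s ltac:(lra) ltac:(lra) ltac:(lra) ltac:(lra) ltac:(rewrite Rminus_diag, Rabs_R0; lra) Hsd).
  apply Rabs_lt_between in U.
  assert (E : (g' - K * x) * x < (g + eps / 2) * x) by lra.
  apply Rmult_lt_reg_r in E; auto.
  assert (K * x <= (K + 1) * q) by (apply Rmult_le_compat; lra). lra.
Qed.

Lemma mul_le_1_of_le (X Z q : R) : 0 < X -> X * Z = 1 -> q <= Z -> X * q <= 1.
Proof. intros. nra. Qed.

(* A jump of the slope from [m] up to [M] at [ts]: [upper_step] forces u / x to exceed [m + eta] at a distance X from the zero already at time ts - 2cX, and [lower_step] turns this excess, before time [ts], into a slope exceeding [m] by an amount independent of X. *)
Lemma slope_lsc_left (L T t0 ts K : R) (w wx wxx wt : R -> R -> R) (g : R -> R) :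
  psol 0 L T w wx wxx wt -> (forall t, 0 <= t <= T -> w 0 t = 0) ->
  0 < t0 < ts -> ts <= T -> 1 + / t0 <= K ->
  (forall t, t0 <= t <= T -> slope L K w wx t (g t)) -> 0 < g t0 ->
  forall eps, 0 < eps -> exists del, 0 < del /\ forall s, t0 <= s -> ts - del < s <= ts -> g ts - eps < g s.
Proof.
  intros W Hz Ht0 Hts HKt Hg Hg0 eps He.
  pose proof (ps_itv _ _ _ _ _ _ _ W) as HL.
  assert (HK : 0 < K) by (assert (0 < / t0) by (apply Rinv_0_lt_compat; lra); lra).
  assert (HKt' : forall t, t0 <= t -> 1 + / t <= K).
  { intros t Ht. assert (/ t <= / t0) by (apply Rinv_le_contravar; lra). lra. }
  assert (Hmono : forall s s', t0 <= s -> s <= s' -> s' <= T -> s * g s <= s' * g s').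
  { intros s s' H1 H2 H3. apply (slope_mono L T K s s' _ _ w wx wxx wt); auto; try lra; apply Hg; lra. }
  apply Classical_Prop.NNPP. intros Hneg.
  set (M := g ts) in *.
  (* A single earlier time with s g(s) > ts (M - eps) would, by monotonicity, keep g above M - eps
     from then until ts. *)
  assert (Hall : forall s, t0 <= s < ts -> s * g s <= ts * (M - eps)).
  { intros s Hs. apply Rnot_lt_le; intros Hlt. apply Hneg. exists (ts - s). split; [lra|].
    intros s' Hs0 Hs'. destruct (Req_dec s' ts) as [->|Hne]; [unfold M; lra|].
    specialize (Hmono s s' ltac:(lra) ltac:(lra) ltac:(lra)).
    apply Rnot_le_lt; intros Hc.
    destruct (Hg s' ltac:(lra)) as [Gp _].
    assert (s' * g s' <= ts * (M - eps)) by (apply Rmult_le_compat; lra). lra. }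
  destruct (completeness (fun z => exists s, t0 <= s < ts /\ z = s * g s)) as [S [Sub Slub]].
  { exists (ts * (M - eps)). intros z [s [Hs ->]]. auto. }
  { exists (t0 * g t0), t0. split; lra. }
  assert (HS : forall s, t0 <= s < ts -> s * g s <= S) by (intros; apply Sub; eauto).
  assert (HSM : S <= ts * (M - eps)) by (apply Slub; intros z [s [Hs ->]]; auto).
  assert (HSpos : 0 < S).
  { apply Rlt_le_trans with (t0 * g t0); [apply Rmult_lt_0_compat; lra|apply HS; lra]. }
  (* Since s g(s) is nondecreasing with supremum [S] before ts, [m] is the left limit of g at ts. *)
  set (m := S / ts).
  assert (Hm : 0 < m) by (apply Rdiv_lt_0_compat; lra).
  assert (HmS : S = ts * m) by (unfold m; field; lra).
  assert (HmM : m <= M - eps) by (apply Rmult_le_reg_l with ts; lra).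
  destruct (psol_dx_upper 0 L T t0 w wx wxx wt W ltac:(lra)) as [C0 HC0].
  set (C := Rabs C0 + K * L + 1).
  assert (HC : 1 <= C).
  { unfold C. pose proof (Rabs_pos C0). assert (0 < K * L) by (apply Rmult_lt_0_compat; lra). lra. }
  assert (HwC : forall x t, 0 < x < L -> t0 <= t <= T -> w x t <= C * x).
  { intros x t Hx Ht.
    pose proof (psol_chord_l _ _ _ _ _ _ _ x t K W ltac:(lra) (HKt' t ltac:(lra)) Hx) as Q.
    rewrite Hz, !Rminus_0_r in Q by lra. eapply Rle_trans; [exact Q|]. apply Rmult_le_compat_r; [lra|].
    specialize (HC0 x t Hx Ht). pose proof (Rle_abs C0). unfold C.
    assert (K * x <= K * L) by (apply Rmult_le_compat_l; lra). lra. }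
  set (eta := eps / 4). assert (Heta : 0 < eta) by (unfold eta; lra).
  (* [upper_step] will be used with p = m + eta and x0 = X / 2 over a time 2 c X: [E] is its rate,
     and [c] makes its smallness condition an equality. *)
  set (E := (2 * (m + eta) + 2 * C + eta) * (4 * C + 1)).
  assert (HE : 0 < E) by (apply Rmult_lt_0_compat; lra).
  set (c := eta / (4 * E)).
  assert (Hc : 0 < c) by (apply Rdiv_lt_0_compat; lra).
  assert (HcE : E * (4 * c) = eta) by (unfold c; field; lra).
  set (a := m / 4).
  (* [mu] is quadratic in [ka], so a c ka >= 8 gives mu c >= 2 ka, hence exp (mu c) - exp ka >= 1,
     however small [c] is. *)
  set (ka := 8 / (a * c) + 1).
  assert (Hac : 0 < a * c) by (apply Rmult_lt_0_compat; unfold a; lra).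
  assert (Hka : 1 < ka) by (unfold ka; assert (0 < 8 / (a * c)) by (apply Rdiv_lt_0_compat; lra); lra).
  set (mu := a * ka ^ 2 / 4).
  assert (Ha : 0 < a) by (unfold a; lra).
  assert (Hmu : 0 < mu).
  { apply Rdiv_lt_0_compat; [|lra]. apply Rmult_lt_0_compat; [auto|apply pow_lt; lra]. }
  assert (Hmuc : 2 * ka <= mu * c).
  { unfold mu. replace (a * ka ^ 2 / 4 * c) with (ka * (a * c * ka / 4)) by field.
    assert (8 <= a * c * ka).
    { unfold ka. rewrite Rmult_plus_distr_l. replace (a * c * (8 / (a * c))) with 8 by (field; lra). lra. }
    nra. }
  (* The excess required at X is then at most eta / 8, within what [upper_step] provides, and at
     most m / 4, which leaves [a] as a lower bound for B / x. *)
  set (th := Rmin (eta / 8) (m / 4) * exp (- (ka + mu * c))).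
  assert (Hmin : 0 < Rmin (eta / 8) (m / 4)) by (apply Rmin_pos; lra).
  assert (Hth : 0 < th) by (apply Rmult_lt_0_compat; [auto|apply exp_pos]).
  assert (Mexp : forall p q, p <= q -> exp p <= exp q).
  { intros p q [?|<-]; [left; now apply exp_increasing|lra]. }
  assert (Hthe : th * exp (ka + mu * c) = Rmin (eta / 8) (m / 4)).
  { unfold th. rewrite Rmult_assoc, <- exp_plus, Rplus_opp_l, exp_0. ring. }
  assert (Hthe1 : th * exp (ka + mu * c) <= eta / 8) by (rewrite Hthe; apply Rmin_l).
  assert (Hthe2 : th * exp ka <= m / 4).
  { apply Rle_trans with (th * exp (ka + mu * c)); [|rewrite Hthe; apply Rmin_r].
    apply Rmult_le_compat_l; [lra|]. apply Mexp. lra. }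
  assert (Hth1 : th <= eta / 8).
  { apply Rle_trans with (th * exp (ka + mu * c)); auto.
    rewrite <- (Rmult_1_r th) at 1. apply Rmult_le_compat_l; [lra|]. rewrite <- exp_0. apply Mexp. lra. }
  assert (Hth2 : th <= m / 4).
  { apply Rle_trans with (th * exp ka); auto.
    rewrite <- (Rmult_1_r th) at 1. apply Rmult_le_compat_l; [lra|]. rewrite <- exp_0. apply Mexp. lra. }
  assert (Hgain : 1 <= exp (mu * c) - exp ka).
  { assert (exp (2 * ka) <= exp (mu * c)) by (apply Mexp; auto).
    replace (2 * ka) with (ka + ka) in H by ring. rewrite exp_plus in H. pose proof (exp_ge ka). nra. }
  assert (Hnu : exists sn, t0 <= sn < ts /\ ts * (m - th / 4) < sn * g sn).
  { apply Classical_Prop.NNPP. intros Hn.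
    assert (0 < ts * th) by (apply Rmult_lt_0_compat; lra).
    assert (S <= ts * (m - th / 4)); [|lra]. apply Slub. intros z [s [Hs ->]].
    apply Rnot_lt_le; intros ?. apply Hn. exists s. split; auto. }
  destruct Hnu as [sn [Hsn Hsng]].
  (* All smallness conditions on X are lower bounds for 1 / X; taking X as the inverse of their sum
     satisfies each of them, as [Q0] to [Q7] spell out. *)
  set (Z := 2 + 2 / L + 4 * K / th + 4 * m * c / (t0 * th) + 8 * K / eta
         + 16 * c * (m + eta) / (ts * eta) + (m + eta) + 2 * c / (ts - sn)).
  assert (P1 : 0 < 2 / L) by (apply Rdiv_lt_0_compat; lra).
  assert (P2 : 0 < 4 * K / th) by (apply Rdiv_lt_0_compat; lra).
  assert (P3 : 0 < 4 * m * c / (t0 * th)) by (apply Rdiv_lt_0_compat; apply Rmult_lt_0_compat; lra).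
  assert (P4 : 0 < 8 * K / eta) by (apply Rdiv_lt_0_compat; lra).
  assert (P5 : 0 < 16 * c * (m + eta) / (ts * eta)) by (apply Rdiv_lt_0_compat; apply Rmult_lt_0_compat; lra).
  assert (P6 : 0 < 2 * c / (ts - sn)) by (apply Rdiv_lt_0_compat; lra).
  set (X := / Z).
  assert (HZ : 0 < Z) by (unfold Z; lra).
  assert (HX : 0 < X) by (apply Rinv_0_lt_compat; auto).
  assert (HXZ : X * Z = 1) by (apply Rinv_l; lra).
  assert (Q0 : X <= 1 / 2) by (pose proof (mul_le_1_of_le X Z 2 HX HXZ ltac:(unfold Z; lra)); lra).
  assert (Q1 : X < L).
  { pose proof (mul_le_1_of_le X Z (2 / L) HX HXZ ltac:(unfold Z; lra)) as Q.
    apply Rmult_le_compat_r with (r := L) in Q; [|lra].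
    replace (X * (2 / L) * L) with (2 * X) in Q by (field; lra). lra. }
  assert (Q2 : K * X <= th / 4).
  { pose proof (mul_le_1_of_le X Z (4 * K / th) HX HXZ ltac:(unfold Z; lra)) as Q.
    apply Rmult_le_compat_r with (r := th / 4) in Q; [|lra].
    replace (X * (4 * K / th) * (th / 4)) with (K * X) in Q by (field; lra). lra. }
  assert (Q3 : m * (c * X / t0) <= th / 4).
  { pose proof (mul_le_1_of_le X Z (4 * m * c / (t0 * th)) HX HXZ ltac:(unfold Z; lra)) as Q.
    apply Rmult_le_compat_r with (r := th / 4) in Q; [|lra].
    replace (X * (4 * m * c / (t0 * th)) * (th / 4)) with (m * (c * X / t0)) in Q by (field; lra). lra. }
  assert (Q4 : K * X <= eta / 8).
  { pose proof (mul_le_1_of_le X Z (8 * K / eta) HX HXZ ltac:(unfold Z; lra)) as Q.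
    apply Rmult_le_compat_r with (r := eta / 8) in Q; [|lra].
    replace (X * (8 * K / eta) * (eta / 8)) with (K * X) in Q by (field; lra). lra. }
  assert (Q5 : (m + eta) * (2 * c * X / ts) <= eta / 8).
  { pose proof (mul_le_1_of_le X Z (16 * c * (m + eta) / (ts * eta)) HX HXZ ltac:(unfold Z; lra)) as Q.
    apply Rmult_le_compat_r with (r := eta / 8) in Q; [|lra].
    replace (X * (16 * c * (m + eta) / (ts * eta)) * (eta / 8)) with ((m + eta) * (2 * c * X / ts)) in Q by (field; lra). lra. }
  assert (Q6 : (m + eta) * X <= 1).
  { pose proof (mul_le_1_of_le X Z (m + eta) HX HXZ ltac:(unfold Z; lra)). lra. }
  assert (Q7 : 2 * c * X <= ts - sn).
  { pose proof (mul_le_1_of_le X Z (2 * c / (ts - sn)) HX HXZ ltac:(unfold Z; lra)) as Q.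
    apply Rmult_le_compat_r with (r := ts - sn) in Q; [|lra].
    replace (X * (2 * c / (ts - sn)) * (ts - sn)) with (2 * c * X) in Q by (field; lra). lra. }
  set (s1 := ts - 2 * c * X). set (s2 := ts - c * X).
  assert (HcX : 0 < c * X) by (apply Rmult_lt_0_compat; lra).
  assert (Hs1 : sn <= s1) by (unfold s1; lra).
  assert (Hs12 : s1 < s2) by (unfold s1, s2; lra).
  assert (Hs2 : s2 < ts) by (unfold s2; lra).
  assert (Hs21 : (s2 - s1) / X = c) by (unfold s1, s2; field; lra).
  assert (Hratio : forall s, t0 <= s < ts -> ts - s <= 2 * c * X -> g s <= m + m * ((ts - s) / t0)).
  { intros s Hs Hsx. specialize (HS s Hs). apply Rmult_le_reg_l with s; [lra|].
    assert (0 <= (ts - s) / t0) by (apply Rdiv_le_0_compat; lra).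
    assert (ts - s = t0 * ((ts - s) / t0)) by (field; lra).
    assert (t0 * ((ts - s) / t0) <= s * ((ts - s) / t0)) by (apply Rmult_le_compat_r; lra).
    assert (m * (ts - s) <= m * (s * ((ts - s) / t0))) by (apply Rmult_le_compat_l; lra). lra. }
  assert (Hg1low : m - th / 4 <= g s1).
  { pose proof (Hmono sn s1 ltac:(lra) Hs1 ltac:(lra)) as Q.
    destruct (Hg s1 ltac:(lra)) as [Gp _].
    assert (ts * (m - th / 4) <= ts * g s1).
    { apply Rle_trans with (s1 * g s1); [lra|]. apply Rmult_le_compat_r; lra. }
    apply Rmult_le_reg_l with ts; lra. }
  assert (Hg1up : g s1 <= m + th / 2).
  { pose proof (Hratio s1 ltac:(lra) ltac:(unfold s1; lra)) as Q.
    replace ((ts - s1) / t0) with (2 * (c * X / t0)) in Q by (unfold s1; field; lra). lra. }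
  assert (Hg2up : g s2 <= m + th / 4).
  { pose proof (Hratio s2 ltac:(lra) ltac:(unfold s2; lra)) as Q.
    replace ((ts - s2) / t0) with (c * X / t0) in Q by (unfold s2; field; lra). lra. }
  set (m' := g s1 - K * X).
  (* This amounts to w X s1 >= (m + eta / 2) X - K X^2. Otherwise semiconvexity spreads the
     smallness at X to all of [0, X]: a point where w > (m + eta) x would have wx + K x > m + eta,
     and the chord from it to X would make w too large at X. Then [upper_step] bounds w at (X / 2,
     ts) too sharply for the slope M. *)
  assert (Hexcess : (m + eta / 2) * X + K * X * X <= w X s1 + K * X * X * 2).
  { apply Rnot_lt_le; intros Hn.
    assert (Hini : forall x, 0 <= x <= X -> w x s1 <= (m + eta) * x).
    { intros x Hx. destruct (Req_dec x 0) as [->|Hx0]; [rewrite Hz by lra; lra|].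
      destruct (Req_dec x X) as [->|HxX].
      { assert (0 <= K * X * X) by (repeat apply Rmult_le_pos; lra).
        assert (0 < eta * X) by (apply Rmult_lt_0_compat; lra). lra. }
      apply Rnot_lt_le; intros Hc'.
      pose proof (psol_chord_l _ _ _ _ _ _ _ x s1 K W ltac:(lra) (HKt' s1 ltac:(lra)) ltac:(lra)) as R1.
      rewrite Hz, !Rminus_0_r in R1 by lra.
      pose proof (psol_chord _ _ _ _ _ _ _ x X s1 K W ltac:(lra) (HKt' s1 ltac:(lra)) ltac:(lra) ltac:(lra) ltac:(lra)) as [R2 _].
      assert (R3 : m + eta < wx x s1 + K * x).
      { apply Rmult_lt_reg_r with x; lra. }
      assert (R4 : (m + eta - K * X) * (X - x) <= w X s1 - w x s1).
      { eapply Rle_trans; [|exact R2]. apply Rmult_le_compat_r; lra. }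
      assert (0 <= K * X * x) by (repeat apply Rmult_le_pos; lra).
      assert (0 < eta * X) by (apply Rmult_lt_0_compat; lra).
      lra. }
    pose proof (upper_step L T s1 ts (X / 2) (m + eta) eta C w wx wxx wt W Hz) as US.
    replace (2 * (X / 2)) with X in US by field.
    specialize (US ltac:(lra) Hts ltac:(lra) Q1 ltac:(lra) Heta ltac:(lra) Hini).
    specialize (US ltac:(intros s Hs; apply HwC; lra)). fold E in US.
    specialize (US ltac:(unfold s1; replace (ts - (ts - 2 * c * X)) with (4 * c * (X / 2)) by field; rewrite <- Rmult_assoc, HcE; lra)).
    destruct (Hg ts ltac:(lra)) as [_ [_ [Glow _]]]. specialize (Glow (X / 2) ltac:(lra)).
    fold M in Glow.
    assert (F : M - K * (X / 2) <= m + eta + eta) by (apply Rmult_le_reg_r with (X / 2); lra).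
    unfold eta in *. lra. }
  assert (Hw0 : 0 <= w X s1) by (left; apply (ps_pos _ _ _ _ _ _ _ W); lra).
  (* The excess at X persists up to s2 because s w(X, s) is nondecreasing and s1 / ts is close to
     1. *)
  assert (HXs : forall s, s1 <= s <= s2 -> (m' + th * exp (ka + mu * c)) * X <= w X s).
  { intros s Hs.
    pose proof (psol_mono 0 L T w wx wxx wt s1 s X W ltac:(lra) ltac:(lra) ltac:(lra) ltac:(lra)) as Mo.
    assert (Hws : 0 <= w X s) by (left; apply (ps_pos _ _ _ _ _ _ _ W); lra).
    assert (N1 : s1 * w X s1 <= ts * w X s).
    { eapply Rle_trans; [exact Mo|]. apply Rmult_le_compat_r; lra. }
    assert (N2 : (m + eta / 2 - eta / 8) * X <= w X s1).
    { assert (K * X * X <= eta / 8 * X) by (apply Rmult_le_compat_r; lra). lra. }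
    assert (N3 : (m + eta) * (2 * c * X) <= eta / 8 * ts).
    { apply Rmult_le_compat_r with (r := ts) in Q5; [|lra].
      replace ((m + eta) * (2 * c * X / ts) * ts) with ((m + eta) * (2 * c * X)) in Q5 by (field; lra). lra. }
    assert (N4 : ts * (m + eta / 4) <= s1 * (m + eta / 2 - eta / 8)).
    { unfold s1. assert ((m + eta / 2 - eta / 8) * (2 * c * X) <= (m + eta) * (2 * c * X)) by (apply Rmult_le_compat_r; lra). lra. }
    assert (N5 : ts * (m + eta / 4) * X <= ts * w X s).
    { eapply Rle_trans; [|exact N1].
      apply Rle_trans with (s1 * (m + eta / 2 - eta / 8) * X); [apply Rmult_le_compat_r; lra|].
      rewrite Rmult_assoc. apply Rmult_le_compat_l; lra. }
    apply Rmult_le_reg_l with ts; [lra|]. eapply Rle_trans; [|exact N5].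
    rewrite Rmult_assoc. apply Rmult_le_compat_l; [lra|]. apply Rmult_le_compat_r; [lra|].
    assert (0 < K * X) by (apply Rmult_lt_0_compat; lra). unfold m'. lra. }
  assert (Hm'low : m - th / 2 <= m') by (unfold m'; lra).
  assert (Hm'up : m' + th * exp (ka + mu * c) <= m + eta).
  { assert (0 < K * X) by (apply Rmult_lt_0_compat; lra). unfold m'. lra. }
  pose proof (lower_step L T s1 s2 X m' a th ka mu w wx wxx wt W Hz) as LS. rewrite Hs21 in LS.
  assert (Low : forall x, 0 <= x <= X -> (m' + th * (exp (mu * c) - exp ka)) * x <= w x s2).
  { apply LS; auto; try lra.
    - intros x Hx. destruct (Req_dec x 0) as [->|Hx0]; [rewrite Hz by lra; lra|].
      destruct (Hg s1 ltac:(lra)) as [_ [_ [Glow _]]]. specialize (Glow x ltac:(lra)).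
      eapply Rle_trans; [|exact Glow]. apply Rmult_le_compat_r; [lra|]. unfold m'.
      assert (K * x <= K * X) by (apply Rmult_le_compat_l; lra). lra.
    - unfold a. lra.
    - eapply Rle_trans; [|exact Q6]. apply Rmult_le_compat_r; lra.
    - unfold mu. lra. }
  destruct (Hg s2 ltac:(lra)) as [_ [_ [_ G3]]].
  destruct (G3 (th / 8) ltac:(lra)) as [del [Hd F]].
  set (x := Rmin del X).
  assert (x <= del) by apply Rmin_l. assert (x <= X) by apply Rmin_r.
  assert (Hx : 0 < x) by (apply Rmin_pos; lra).
  destruct (F x ltac:(lra)) as [_ F2]. specialize (Low x ltac:(lra)).
  (* The left side is at least m - th / 2 + th, while g s2 <= m + th / 4. *)
  assert (Fin : m' + th * (exp (mu * c) - exp ka) < g s2 + th / 8) by (apply Rmult_lt_reg_r with x; lra).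
  assert (th * 1 <= th * (exp (mu * c) - exp ka)) by (apply Rmult_le_compat_l; lra).
  lra.
Qed.

(** Besides the two semicontinuity lemmas, a lower bound after ts is required; it is g s >= ts g(ts)
    / s, from the monotonicity of t g(t). *)
Lemma slope_continuous (L T t0 ts K : R) (w wx wxx wt : R -> R -> R) (g : R -> R) :
  psol 0 L T w wx wxx wt -> (forall t, 0 <= t <= T -> w 0 t = 0) ->
  0 < t0 < ts -> ts <= T -> 1 + / t0 <= K ->
  (forall t, t0 <= t <= T -> slope L K w wx t (g t)) -> 0 < g t0 ->
  forall eps, 0 < eps -> exists del, 0 < del /\
    forall s, 0 < s <= T -> Rabs (s - ts) < del -> Rabs (g s - g ts) < eps.
Proof.
  intros W Hz Ht0 Hts HKt Hg Hg0 eps He.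
  assert (HK : 0 <= K) by (assert (0 < / t0) by (apply Rinv_0_lt_compat; lra); lra).
  destruct (slope_lsc_left L T t0 ts K w wx wxx wt g W Hz Ht0 Hts HKt Hg Hg0 eps He) as [d1 [Hd1 F1]].
  destruct (slope_usc L T K ts (g ts) w wx wxx wt W HK ltac:(lra) (Hg ts ltac:(lra)) eps He) as [d2 [Hd2 F2]].
  destruct (Hg ts ltac:(lra)) as [Gp _].
  set (q := eps * ts / (g ts + 1)).
  assert (Hq : 0 < q) by (apply Rdiv_lt_0_compat; [apply Rmult_lt_0_compat|]; lra).
  assert (Hqe : (g ts + 1) * q = eps * ts) by (unfold q; field; lra).
  exists (Rmin (Rmin d1 d2) (Rmin q (ts - t0))).
  split; [repeat apply Rmin_pos; lra|]. intros s Hs Hd.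
  assert (H1 : Rabs (s - ts) < d1).
  { eapply Rlt_le_trans; [exact Hd|]. eapply Rle_trans; apply Rmin_l. }
  assert (H2 : Rabs (s - ts) < d2).
  { eapply Rlt_le_trans; [exact Hd|]. eapply Rle_trans; [apply Rmin_l|apply Rmin_r]. }
  assert (H3 : Rabs (s - ts) < q).
  { eapply Rlt_le_trans; [exact Hd|]. eapply Rle_trans; [apply Rmin_r|apply Rmin_l]. }
  assert (H4 : Rabs (s - ts) < ts - t0).
  { eapply Rlt_le_trans; [exact Hd|]. eapply Rle_trans; apply Rmin_r. }
  apply Rabs_lt_between in H4.
  specialize (F2 s (g s) Hs H2 (Hg s ltac:(lra))).
  apply Rabs_lt_between in H1. apply Rabs_lt_between in H3.
  assert (g ts - eps < g s); [|apply Rabs_lt_between; lra].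
  destruct (Rle_lt_dec s ts) as [Hle|Hgt]; [apply F1; lra|].
  pose proof (slope_mono L T K ts s (g ts) (g s) w wx wxx wt W HK ltac:(lra) ltac:(lra) (Hg ts ltac:(lra)) (Hg s ltac:(lra))) as Mo.
  apply Rmult_lt_reg_l with s; [lra|].
  assert (g ts * (s - ts) <= g ts * q) by (apply Rmult_le_compat_l; lra).
  assert (eps * ts < eps * s) by (apply Rmult_lt_compat_l; lra).
  lra.
Qed.

(** * Slopes and waiting times *)

(** The waiting-time alternative without naming the waiting time: a nonzero slope at one time makes
    the slope nonzero and continuous at all later times. In this form it is insensitive to the sign
    of u. *)
Definition slope_law (T : R) (g : R -> R) : Prop :=
  forall s t, 0 < s < t -> t <= T -> g s <> 0 ->
    g t <> 0 /\
    forall eps, 0 < eps -> exists del, 0 < del /\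
      forall r, 0 < r <= T -> Rabs (r - t) < del -> Rabs (g r - g t) < eps.

Lemma slope_law_0 (L T : R) (w wx wxx wt : R -> R -> R) :
  psol 0 L T w wx wxx wt -> (forall t, 0 <= t <= T -> w 0 t = 0) ->
  exists g, slope_law T g /\
    forall t eps, 0 < t <= T -> 0 < eps -> exists del, 0 < del < L /\
      forall x, 0 < x < del -> Rabs (wx x t - g t) < eps.
Proof.
  intros W Hz. pose proof (ps_itv _ _ _ _ _ _ _ W) as HL.
  (* Each time is given its own constant 1 + 1 / t; [slope_weaken] then moves all times after t0 to
     the common constant 1 + 1 / t0. *)
  set (g := fun t => epsilon (inhabits 0) (fun l => slope L (1 + / t) w wx t l)).
  assert (Hg : forall t, 0 < t <= T -> slope L (1 + / t) w wx t (g t)).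
  { intros t Ht. apply epsilon_spec. apply (psol_slope L T (1 + / t) t w wx wxx wt); auto; lra. }
  assert (Hi : forall t, 0 < t -> 0 < 1 + / t) by (intros t Ht; assert (0 < / t) by (now apply Rinv_0_lt_compat); lra).
  assert (HgK : forall t0 t, 0 < t0 -> t0 <= t <= T -> slope L (1 + / t0) w wx t (g t)).
  { intros t0 t Ht0 Ht. apply slope_weaken with (1 + / t); auto; [|apply Hg; lra].
    assert (/ t <= / t0) by (apply Rinv_le_contravar; lra). specialize (Hi t ltac:(lra)). lra. }
  exists g. split.
  - intros s t Hs Ht Hgs.
    assert (Hgs0 : 0 < g s) by (destruct (Hg s ltac:(lra)) as [? _]; lra).
    split.
    + pose proof (slope_mono L T (1 + / s) s t (g s) (g t) w wx wxx wt W ltac:(specialize (Hi s); lra) ltac:(lra) Ht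
        ltac:(apply HgK; lra) ltac:(apply HgK; lra)) as Mo.
      assert (0 < s * g s) by (apply Rmult_lt_0_compat; lra).
      intros E. rewrite E in Mo. lra.
    + apply (slope_continuous L T s t (1 + / s) w wx wxx wt); auto; try lra. intros r Hr. apply HgK; lra.
  - intros t eps Ht He. destruct (Hg t Ht) as [_ [G1 [_ G3]]].
    destruct (G3 eps He) as [del [Hd F]].
    set (K := 1 + / t) in *. assert (HK : 0 < K) by (apply Hi; lra). clearbody K.
    exists (Rmin del (eps / K)).
    assert (0 < eps / K) by (apply Rdiv_lt_0_compat; lra).
    pose proof (Rmin_l del (eps / K)). pose proof (Rmin_r del (eps / K)).
    assert (0 < Rmin del (eps / K)) by (apply Rmin_pos; lra).
    split; [lra|]. intros x Hx.
    specialize (G1 x ltac:(lra)). destruct (F x ltac:(lra)) as [F1 _].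
    assert (HKx : K * x < K * (eps / K)) by (apply Rmult_lt_compat_l; lra).
    replace (K * (eps / K)) with eps in HKx by (field; lra).
    assert (0 < K * x) by (apply Rmult_lt_0_compat; lra).
    apply Rabs_lt_between. lra.
Qed.

Lemma slope_law_l (al be T : R) (w wx wxx wt : R -> R -> R) :
  psol al be T w wx wxx wt -> (forall t, 0 <= t <= T -> w al t = 0) ->
  exists g, slope_law T g /\
    forall t eps, 0 < t <= T -> 0 < eps -> exists del, 0 < del < be - al /\
      forall x, al < x < al + del -> Rabs (wx x t - g t) < eps.
Proof.
  intros W Hz.
  destruct (slope_law_0 (be - al) T _ _ _ _ (psol_affine al be T 0 (be - al) al 1 _ _ _ _ W ltac:(left; repeat split; ring))) as [g [G1 G2]].
  { intros t Ht. replace (al + 1 * 0) with al by ring. auto. }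
  exists g. split; auto. intros t eps Ht He. destruct (G2 t eps Ht He) as [del [Hd F]].
  exists del. split; auto. intros x Hx. specialize (F (x - al) ltac:(lra)).
  simpl in F. replace (al + 1 * (x - al)) with x in F by ring. now rewrite Rmult_1_l in F.
Qed.

Lemma slope_law_r (al be T : R) (w wx wxx wt : R -> R -> R) :
  psol al be T w wx wxx wt -> (forall t, 0 <= t <= T -> w be t = 0) ->
  exists g, slope_law T g /\
    forall t eps, 0 < t <= T -> 0 < eps -> exists del, 0 < del < be - al /\
      forall x, be - del < x < be -> Rabs (wx x t - g t) < eps.
Proof.
  intros W Hz.
  pose proof (psol_reflect al be T be _ _ _ _ W) as V. rewrite Rminus_diag in V.
  destruct (slope_law_0 (be - al) T _ _ _ _ V) as [g [G1 G2]].
  { intros t Ht. replace (be + -1 * 0) with be by ring. auto. }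
  exists (fun t => - g t). split.
  - intros s t Hs Ht Hne. destruct (G1 s t Hs Ht ltac:(lra)) as [A B]. split; [lra|].
    intros eps He. destruct (B eps He) as [del [Hd F]]. exists del. split; auto.
    intros r Hr Hrd. specialize (F r Hr Hrd). replace (- g r - - g t) with (- (g r - g t)) by ring.
    now rewrite Rabs_Ropp.
  - intros t eps Ht He. destruct (G2 t eps Ht He) as [del [Hd F]].
    exists del. split; auto. intros x Hx. specialize (F (be - x) ltac:(lra)).
    simpl in F. replace (be + -1 * (be - x)) with x in F by ring.
    replace (wx x t - - g t) with (- (-1 * wx x t - g t)) by ring. now rewrite Rabs_Ropp.
Qed.

(** Stated for an arbitrary filter so as to serve both sides of a zero. The threshold is built from
    all solutions on all horizons at once, and the local agreement of two solutions transfers a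
    nonzero slope from one to another. *)
Lemma threshold (F : (R -> Prop) -> Prop) (sol : R -> (R -> R -> R) -> Prop) :
  ProperFilter F ->
  (forall T u, 0 < T -> sol T u -> exists g, slope_law T g /\
     forall t, 0 < t <= T -> filterlim (fun y => ux u y t) F (locally (g t))) ->
  (forall T1 u1 T2 u2 t, 0 < T1 -> 0 < T2 -> sol T1 u1 -> sol T2 u2 -> 0 < t -> t <= T1 -> t <= T2 ->
     F (fun y => ux u1 y t = ux u2 y t)) ->
  exists tau : Rbar, Rbar_le (Finite 0) tau /\
    forall T u, 0 < T -> sol T u -> exists g : R -> R,
      (forall t, 0 < t <= T -> filterlim (fun y => ux u y t) F (locally (g t))) /\
      (forall t, 0 < t <= T -> (Rbar_lt (Finite t) tau -> g t = 0) /\ (Rbar_lt tau (Finite t) -> g t <> 0)) /\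
      (forall t, 0 < t <= T -> Finite t <> tau ->
         filterlim g (within (fun s => 0 < s <= T) (locally t)) (locally (g t))).
Proof.
  intros PF Hsol Huniq.
  (* The infimum of an empty set is [p_infty], the case of a slope that never leaves 0. *)
  set (E := fun t => exists T u l, 0 < T /\ sol T u /\ 0 < t <= T /\
     filterlim (fun y => ux u y t) F (locally l) /\ l <> 0).
  set (tau := Glb_Rbar E). destruct (Glb_Rbar_correct E) as [Hlb Hglb]. fold tau in Hlb, Hglb.
  exists tau. split.
  { apply Hglb. intros t [T [u [l [_ [_ [Ht _]]]]]]. simpl. lra. }
  intros T u HT Hu. destruct (Hsol T u HT Hu) as [g [Gl Glim]].
  assert (Before : forall t, 0 < t <= T -> Rbar_lt (Finite t) tau -> g t = 0).
  { intros t Ht Hlt. apply NNPP. intros Hne.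
    apply (Rbar_lt_not_le _ _ Hlt). apply Hlb. exists T, u, (g t). repeat split; auto; lra. }
  assert (After : forall t, 0 < t <= T -> Rbar_lt tau (Finite t) -> exists s, 0 < s < t /\ g s <> 0).
  { intros t Ht Hlt. apply NNPP. intros Hn.
    apply (Rbar_lt_not_le _ _ Hlt). apply Hglb. intros s [T' [u' [l [HT' [Hu' [Hs [Hlim Hl]]]]]]].
    simpl. apply Rnot_lt_le. intros Hst. apply Hn. exists s. split; [lra|].
    assert (g s = l); [|congruence].
    apply (filterlim_locally_unique (F := F) (fun y => ux u y s)); [apply Glim; lra|].
    apply filterlim_ext_loc with (fun y => ux u' y s); auto.
    apply (Huniq T' u' T u s); auto; lra. }
  exists g. split; [auto|]. split.
  - intros t Ht. split; [now apply Before|]. intros Hlt.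
    destruct (After t Ht Hlt) as [s [Hs Hgs]]. apply (Gl s t Hs ltac:(lra) Hgs).
  - intros t Ht Hne. destruct (Rbar_total_order (Finite t) tau) as [[Hlt|Heq]|Hgt]; [|contradiction|].
    (* A real [r] beyond t before which g vanishes; it covers an infinite [tau] too. *)
    + assert (exists r, t < r /\ forall s, 0 < s <= T -> s < r -> g s = 0) as [r [Hr Hr0]].
      { destruct tau as [r| |]; simpl in Hlt; [| |contradiction].
        - exists r. split; auto.
        - exists (t + 1). split; [lra|]. intros. apply Before; simpl; auto. }
      rewrite (Hr0 t Ht Hr). intros P [e He].
      exists (mkposreal (r - t) ltac:(lra)). intros s Hs Hs'. simpl in Hs.
      change (Rabs (s - t) < r - t) in Hs. apply Rabs_lt_between in Hs.
      rewrite (Hr0 s Hs' ltac:(lra)). apply He, ball_center.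
    + destruct (After t Ht Hgt) as [s [Hs Hgs]].
      destruct (Gl s t Hs ltac:(lra) Hgs) as [_ C].
      intros P [e He]. destruct (C e (cond_pos e)) as [del [Hd Fd]].
      exists (mkposreal del Hd). intros r Hr Hr'. apply He. now apply Fd.
Qed.

(** * Relative limits in epsilon-delta form *)

Lemma cont_on_eps (D : R * R -> Prop) (f : R -> R -> R) (x t eps : R) :
  cont_on D f -> D (x, t) -> 0 < eps -> exists del, 0 < del /\
    forall y s, D (y, s) -> Rabs (y - x) < del -> Rabs (s - t) < del -> Rabs (f y s - f x t) < eps.
Proof.
  intros H HD He.
  assert (L : locally (f x t) (fun z => Rabs (z - f x t) < eps)).
  { exists (mkposreal eps He). intros z Hz. exact Hz. }
  destruct (H (x, t) HD _ L) as [[del Hd] F]. exists del. split; auto.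
  intros y s Hys Hy Hs. apply (F (y, s)); auto. split; assumption.
Qed.

Lemma cont_on_ucont (a b T : R) (u : R -> R -> R) :
  a < b -> 0 < T -> cont_on (Qbar a b T) u -> ucont a b 0 T u.
Proof.
  intros Hab HT H.
  assert (U : ucont a b 0 T (fun y s => u (clamp a b y) (clamp 0 T s))).
  { apply ucont_of_continuity. intros x t Hx Ht eps.
    destruct (cont_on_eps _ u (clamp a b x) (clamp 0 T t) eps H) as [del [Hd F]].
    - split; apply clamp_in; lra.
    - apply cond_pos.
    - exists (mkposreal del Hd). simpl. intros y s Hy Hs. apply F.
      + split; apply clamp_in; lra.
      + eapply Rle_lt_trans; [apply clamp_lip; lra|auto].
      + eapply Rle_lt_trans; [apply clamp_lip; lra|auto]. }
  intros eps He. destruct (U eps He) as [del [Hd F]]. exists del. split; auto.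
  intros x t y s Hx Ht Hy Hs Hyx Hst. specialize (F x t y s Hx Ht Hy Hs Hyx Hst).
  simpl in F. rewrite !clamp_id in F by lra. exact F.
Qed.

Lemma cont_on_interior (D : R * R -> Prop) (f : R -> R -> R) (p q c d x t : R) :
  cont_on D f -> (forall y s, p < y < q -> c < s < d -> D (y, s)) ->
  p < x < q -> c < t < d -> continuity_2d_pt f x t.
Proof.
  intros H HD Hx Ht eps.
  destruct (cont_on_eps D f x t eps H (HD x t Hx Ht) (cond_pos eps)) as [del [Hd F]].
  assert (L : locally_2d (fun y s => D (y, s)) x t) by (apply (locally_2d_box p q c d); auto).
  destruct L as [e G].
  assert (Hm : 0 < Rmin del e) by (apply Rmin_pos; [auto|apply cond_pos]).
  exists (mkposreal _ Hm). simpl. intros y s Hy Hs.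
  pose proof (Rmin_l del e). pose proof (Rmin_r del e).
  apply F; [apply G| |]; lra.
Qed.

Lemma is_tderiv_is_derive (u : R -> R -> R) (T x t l : R) :
  0 < t < T -> is_tderiv u T x t l -> is_derive (fun s => u x s) t l.
Proof.
  intros Ht H. apply is_derive_Reals. intros eps He.
  assert (L : locally l (fun z => Rabs (z - l) < eps)).
  { exists (mkposreal eps He). intros z Hz. exact Hz. }
  destruct (H _ L) as [[del Hd] F]. simpl in F.
  assert (Hm : 0 < Rmin del (Rmin t (T - t))) by (repeat apply Rmin_pos; lra).
  pose proof (Rmin_l del (Rmin t (T - t))). pose proof (Rmin_r del (Rmin t (T - t))).
  pose proof (Rmin_l t (T - t)). pose proof (Rmin_r t (T - t)).
  exists (mkposreal _ Hm). simpl. intros h Hh0 Hh.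
  assert (Hb : ball t del (t + h)).
  { change (Rabs (t + h - t) < del). replace (t + h - t) with h by ring. lra. }
  specialize (F (t + h) Hb). apply Rabs_lt_between in Hh.
  specialize (F ltac:(split; lra)). replace (t + h - t) with h in F by ring. exact F.
Qed.

(** The intermediate value theorem along the segment from (x, t) to (y, s), with [clamp] making the
    restriction continuous on the whole line. *)
Lemma nonzero_same_sign (a b c d : R) (f : R -> R -> R) (x t y s : R) :
  a <= b -> c <= d -> ucont a b c d f ->
  (forall r, 0 <= r <= 1 -> f (x + r * (y - x)) (t + r * (s - t)) <> 0) ->
  a <= x <= b -> a <= y <= b -> c <= t <= d -> c <= s <= d ->
  0 < f x t -> 0 < f y s.
Proof.
  intros Hab Hcd U Hne Hx Hy Ht Hs Hpos. apply Rnot_le_lt. intros Hneg.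
  set (h := fun r => f (clamp a b (x + r * (y - x))) (clamp c d (t + r * (s - t)))).
  assert (Hin : forall r, 0 <= r <= 1 -> h r = f (x + r * (y - x)) (t + r * (s - t))).
  { intros r Hr. unfold h. rewrite !clamp_id by nra. reflexivity. }
  assert (Hc : continuity h).
  { intros r. apply continuity_pt_filterlim.
    assert (C := ucont_clamp a b c d f Hab Hcd U (x + r * (y - x)) (t + r * (s - t))).
    apply continuity_2d_pt_filterlim in C.
    apply (continuous_comp (fun r => (x + r * (y - x), t + r * (s - t))) (fun p => f (clamp a b (fst p)) (clamp c d (snd p)))).
    - apply (continuous_comp_2 (fun r => x + r * (y - x)) (fun r => t + r * (s - t)) (fun p q => (p, q))).
      + apply (ex_derive_continuous (V := R_NormedModule)). auto_derive. auto.
      + apply (ex_derive_continuous (V := R_NormedModule)). auto_derive. auto.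
      + apply continuous_ext with (fun p => p); [intros [? ?]; reflexivity|apply continuous_id].
    - exact C. }
  destruct (IVT_cor h 0 1 Hc ltac:(lra)) as [z [Hz Hz0]].
  - rewrite !Hin by lra. replace (x + 0 * (y - x)) with x by ring. replace (t + 0 * (s - t)) with t by ring.
    replace (x + 1 * (y - x)) with y by ring. replace (t + 1 * (s - t)) with s by ring. nra.
  - rewrite Hin in Hz0 by lra. now apply (Hne z).
Qed.

(** * Nodal intervals of classical solutions *)

(** Between consecutive zeros u never vanishes for any t in [0, T], so its sign is that of u0 at the
    midpoint, and [sg * u] is |u| there. *)
Lemma component_psol (a b T p q sg : R) (u0 : R -> R) (N0 : R -> Prop) (u : R -> R -> R) :
  a < b -> 0 < T -> u0 a = -1 -> u0 b = 1 ->
  classical_solution a b T u0 N0 u ->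
  a <= p -> p < q -> q <= b -> (forall y, p < y < q -> ~ N0 y) ->
  p = a \/ N0 p -> q = b \/ N0 q ->
  sg = 1 \/ sg = -1 -> 0 < sg * u0 ((p + q) / 2) ->
  exists v, psol p q T (fun x t => sg * u x t) (fun x t => sg * ux u x t)
    (fun x t => sg * uxx u x t) (fun x t => sg * v x t).
Proof.
  intros Hab HT Hua Hub [Cu [Hz [Hd [Cux [Cuxx [[v [Cv Hv]] [Hbd Hini]]]]]]] Hap Hpq Hqb HN Hp Hq Hsg Hmid.
  exists v.
  assert (Uu : ucont a b 0 T u) by (now apply cont_on_ucont).
  assert (Uw : ucont a b 0 T (fun x t => sg * u x t)).
  { assert (Hs1 : Rabs sg = 1) by (destruct Hsg as [->| ->]; [apply Rabs_R1|rewrite Rabs_left; lra]).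
    intros eps He. destruct (Uu eps He) as [del [Hdel F]]. exists del. split; auto.
    intros. rewrite <- Rmult_minus_distr_l, Rabs_mult, Hs1, Rmult_1_l. now apply F. }
  assert (Hint : forall y s, p < y < q -> 0 < s <= T -> QmN a b T N0 (y, s)).
  { intros y s Hy Hs. repeat split; simpl; try lra. now apply HN. }
  assert (Hpos : forall x t, p < x < q -> 0 <= t <= T -> 0 < sg * u x t).
  { intros x t Hx Ht.
    apply (nonzero_same_sign a b 0 T (fun x t => sg * u x t) ((p + q) / 2) 0 x t); auto; try lra.
    - intros r Hr E.
      assert (G : forall m, p < m < q -> p < m + r * (x - m) < q).
      { intros m Hm. destruct (Req_dec r 1) as [->|Hr1]; [lra|].
        assert (0 < (1 - r) * (m - p)) by (apply Rmult_lt_0_compat; lra).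
        assert (0 < (1 - r) * (q - m)) by (apply Rmult_lt_0_compat; lra).
        assert (0 <= r * (x - p)) by (apply Rmult_le_pos; lra).
        assert (0 <= r * (q - x)) by (apply Rmult_le_pos; lra). lra. }
      specialize (G ((p + q) / 2) ltac:(lra)).
      assert (Gt : 0 <= 0 + r * (t - 0) <= T) by nra.
      apply Rmult_integral in E. destruct E as [E|E]; [destruct Hsg; lra|].
      apply Hz in E; [|lra|exact Gt]. revert E. now apply HN.
    - rewrite Hini by lra. exact Hmid. }
  assert (Hcl : forall x t, (x = p \/ x = q) -> 0 <= t <= T -> 0 <= sg * u x t).
  { intros x t Hx Ht.
    assert (Uc : forall z, continuous (fun y => sg * u (clamp a b y) t) z).
    { intros z. pose proof (ucont_clamp a b 0 T _ ltac:(lra) ltac:(lra) Uw z t) as C.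
      apply continuity_2d_pt_fst in C. now rewrite (clamp_id 0 T t) in C. }
    rewrite <- (clamp_id a b x) by (destruct Hx; lra).
    destruct Hx as [->| ->].
    - apply (continuous_nonneg_left (fun y => sg * u (clamp a b y) t) p q); auto.
      intros y Hy. rewrite clamp_id by lra. left. now apply Hpos.
    - apply (continuous_nonneg_right (fun y => sg * u (clamp a b y) t) p q); auto.
      intros y Hy. rewrite clamp_id by lra. left. now apply Hpos. }
  assert (Hbd0 : forall t, 0 <= t <= T -> u a t = -1 /\ u b t = 1).
  { intros t Ht. destruct (Req_dec t 0) as [->|]; [rewrite !Hini by lra; auto|]. apply Hbd; lra. }
  split; auto.
  - apply (ucont_restrict a b 0 T); auto; lra.
  - intros x t Hx Ht.
    destruct (Hd x t (Hint x t Hx ltac:(lra))) as [D1 D2].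
    assert (Hbox : forall y s, p < y < q -> 0 < s < T -> QmN a b T N0 (y, s)) by (intros; apply Hint; auto; lra).
    destruct (Hv x t (Hbox x t Hx Ht)) as [D3 _].
    split; [|split; [|split; [|split; [|split; [|split]]]]].
    + apply is_derive_Rscal. now apply Derive_correct.
    + apply is_derive_Rscal. now apply Derive_correct.
    + apply is_derive_Rscal. now apply (is_tderiv_is_derive u T).
    + apply continuity_2d_pt_mult; [apply continuity_2d_pt_const|].
      apply (cont_on_interior (Qbar a b T) u p q 0 T); auto. intros; split; simpl; lra.
    + apply continuity_2d_pt_mult; [apply continuity_2d_pt_const|].
      apply (cont_on_interior (QmN a b T N0) (ux u) p q 0 T); auto.
    + apply continuity_2d_pt_mult; [apply continuity_2d_pt_const|].
      apply (cont_on_interior (QmN a b T N0) (uxx u) p q 0 T); auto.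
    + apply continuity_2d_pt_mult; [apply continuity_2d_pt_const|].
      apply (cont_on_interior (QmN a b T N0) v p q 0 T); auto.
  - intros x t Hx Ht. apply is_derive_Rscal. apply Derive_correct. destruct (Hd x t (Hint x t Hx Ht)) as [D1 D2]; assumption.
  - intros x t Hx Ht. apply is_derive_Rscal. apply Derive_correct. destruct (Hd x t (Hint x t Hx Ht)) as [D1 D2]; assumption.
  - intros x eps Hx He.
    destruct (cont_on_eps _ _ x T eps Cuxx (Hint x T Hx ltac:(lra)) He) as [del [Hdel F]].
    exists del. split; auto. intros s Hs Hsd.
    rewrite <- Rmult_minus_distr_l, Rabs_mult.
    replace (Rabs sg) with 1 by (destruct Hsg as [->| ->]; [rewrite Rabs_R1|rewrite Rabs_left]; lra).
    rewrite Rmult_1_l. apply F; auto.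
    + rewrite Rminus_diag, Rabs_R0; lra.
    + apply Rabs_lt_between; lra.
  - intros x t Hx Ht. specialize (Hpos x t Hx ltac:(lra)).
    destruct (Hv x t (Hint x t Hx ltac:(lra))) as [_ ->].
    destruct Hsg as [->| ->].
    + rewrite Rabs_pos_eq by lra. ring.
    + rewrite Rabs_left by lra. ring.
  (* At a the limit of positive values is nonnegative, which with u = -1 forces sg = -1 and the
     lateral value 1; at b likewise sg = 1. *)
  - destruct Hp as [->|Hp].
    + right. intros t Ht. specialize (Hcl a t (or_introl eq_refl) Ht). destruct (Hbd0 t Ht) as [E _].
      rewrite E in *. destruct Hsg; lra.
    + left. intros t Ht. apply Rmult_eq_0_compat_l. apply Hz; auto; lra.
  - destruct Hq as [->|Hq].
    + right. intros t Ht. specialize (Hcl b t (or_intror eq_refl) Ht). destruct (Hbd0 t Ht) as [_ E].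
      rewrite E in *. destruct Hsg; lra.
    + left. intros t Ht. apply Rmult_eq_0_compat_l. apply Hz; auto; lra.
Qed.

(** The zeros preceded by a and followed by b. The indices shift by one: [xs i] is node S i, so the
    interval on its left has index i and the one on its right index S i. *)
Definition node (a b : R) (k : nat) (xs : nat -> R) (j : nat) : R :=
  match j with O => a | S i => if Compare_dec.lt_dec i k then xs i else b end.

Lemma node_S (a b : R) (k : nat) (xs : nat -> R) (i : nat) :
  (i < k)%nat -> node a b k xs (S i) = xs i.
Proof. intros. simpl. now destruct (Compare_dec.lt_dec i k). Qed.

Lemma node_last (a b : R) (k : nat) (xs : nat -> R) : node a b k xs (S k) = b.
Proof. simpl. destruct (Compare_dec.lt_dec k k); auto; lia. Qed.

Section Nodes.

Context {a b : R} {k : nat} {xs : nat -> R}.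
Context (Hab : a < b).
Context (Hinc : forall i j, (i < j < k)%nat -> xs i < xs j).
Context (Hin : forall i, (i < k)%nat -> a < xs i < b).

Lemma node_lt (j : nat) : (j <= k)%nat -> node a b k xs j < node a b k xs (S j).
Proof.
  intros Hj. destruct j as [|i].
  - destruct (Compare_dec.lt_dec 0 k) as [H|H]; [rewrite node_S by auto; apply Hin; auto|].
    replace k with 0%nat by lia. now rewrite node_last.
  - rewrite node_S by lia. destruct (Compare_dec.lt_dec (S i) k) as [H|H].
    + rewrite node_S by auto. apply Hinc; lia.
    + replace (S i) with k by lia. rewrite node_last. apply Hin; lia.
Qed.

Lemma node_range (j : nat) : (j <= S k)%nat -> a <= node a b k xs j <= b.
Proof.
  intros Hj. destruct j as [|i]; simpl; [lra|].
  destruct (Compare_dec.lt_dec i k) as [H|H]; [|lra]. specialize (Hin i H). lra.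
Qed.

Lemma node_no_zero (j : nat) (y : R) : (j <= k)%nat ->
  node a b k xs j < y < node a b k xs (S j) -> ~ zset k xs y.
Proof.
  intros Hj Hy [i [Hi ->]].
  assert (Hmono : forall l m, (l < k)%nat -> (m < k)%nat -> xs l < xs m -> (l < m)%nat).
  { intros l m Hl Hm Hlm. destruct (Nat.lt_total l m) as [|[->|Hml]]; auto; [lra|].
    specialize (Hinc m l ltac:(lia)). lra. }
  assert (H1 : (j <= i)%nat).
  { destruct j as [|j]; [lia|]. rewrite node_S in Hy by lia.
    apply Hmono; try lia. apply Hy. }
  destruct (Compare_dec.lt_dec j k) as [H|H]; [|lia].
  rewrite node_S in Hy by auto. specialize (Hmono i j Hi H ltac:(apply Hy)). lia.
Qed.

Lemma node_left (j : nat) : (j <= k)%nat -> node a b k xs j = a \/ zset k xs (node a b k xs j).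
Proof.
  intros Hj. destruct j as [|i]; [left; auto|]. right. rewrite node_S by lia. exists i. split; auto.
Qed.

Lemma node_right (j : nat) : (j <= k)%nat -> node a b k xs (S j) = b \/ zset k xs (node a b k xs (S j)).
Proof.
  intros Hj. destruct (Compare_dec.lt_dec j k) as [H|H].
  - right. rewrite node_S by lia. exists j. auto.
  - left. replace j with k by lia. apply node_last.
Qed.

Lemma node_cover (x : R) : a < x < b -> ~ zset k xs x ->
  exists j, (j <= k)%nat /\ node a b k xs j < x < node a b k xs (S j).
Proof.
  intros Hx Hn.
  assert (H : forall n, (n <= S k)%nat -> x < node a b k xs n ->
     exists j, (j <= k)%nat /\ node a b k xs j < x < node a b k xs (S j)).
  { induction n as [|n IH]; intros Hk Hxn; [simpl in Hxn; lra|].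
    destruct (Rtotal_order x (node a b k xs n)) as [Hl|[He|Hg]].
    - apply IH; auto; lia.
    - exfalso. destruct n as [|m]; [simpl in He; lra|]. apply Hn. rewrite node_S in He by lia.
      exists m. split; [lia|auto].
    - exists n. split; [lia|lra]. }
  apply (H (S k)); auto. rewrite node_last. lra.
Qed.

Context {u0 : R -> R}.
Context (Hua : u0 a = -1) (Hub : u0 b = 1).
Context (Hu0 : forall y, a < y < b -> (u0 y = 0 <-> zset k xs y)).

(** The sign is read off u0 before [T] and [u] are introduced, so two solutions on different
    horizons can be compared with the same sign. *)
Lemma node_psol (j : nat) : (j <= k)%nat ->
  exists sg, (sg = 1 \/ sg = -1) /\ forall T u, 0 < T -> classical_solution a b T u0 (zset k xs) u ->
  exists v, psol (node a b k xs j) (node a b k xs (S j)) T (fun x t => sg * u x t) (fun x t => sg * ux u x t)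
    (fun x t => sg * uxx u x t) v.
Proof.
  intros Hj. set (p := node a b k xs j). set (q := node a b k xs (S j)).
  assert (Hpq : p < q) by (now apply node_lt).
  assert (Hp : a <= p <= b) by (apply node_range; lia).
  assert (Hq : a <= q <= b) by (apply node_range; lia).
  assert (Hne : u0 ((p + q) / 2) <> 0).
  { intros E. apply Hu0 in E; [|lra]. revert E. apply (node_no_zero j); auto. fold p q. lra. }
  assert (exists sg, (sg = 1 \/ sg = -1) /\ 0 < sg * u0 ((p + q) / 2)) as [sg [Hsg Hpos]].
  { destruct (Rlt_le_dec 0 (u0 ((p + q) / 2))); [exists 1|exists (-1)]; split; auto; lra. }
  exists sg. split; auto. intros T u HT Hu.
  destruct (component_psol a b T p q sg u0 (zset k xs) u) as [v W]; auto; try lra.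
  - intros y Hy. now apply (node_no_zero j).
  - now apply node_left.
  - now apply node_right.
  - eexists. exact W.
Qed.

Lemma classical_ux_unique (T1 T2 : R) (u1 u2 : R -> R -> R) (j : nat) (x t : R) :
  0 < T1 -> 0 < T2 -> classical_solution a b T1 u0 (zset k xs) u1 -> classical_solution a b T2 u0 (zset k xs) u2 ->
  (j <= k)%nat -> node a b k xs j < x < node a b k xs (S j) -> 0 < t -> t <= T1 -> t <= T2 ->
  ux u1 x t = ux u2 x t.
Proof.
  intros HT1 HT2 C1 C2 Hj Hx Ht Ht1 Ht2.
  destruct (node_psol j Hj) as [sg [Hsg HW]].
  destruct (HW T1 u1 HT1 C1) as [v1 W1]. destruct (HW T2 u2 HT2 C2) as [v2 W2].
  assert (Hr1 := node_range j ltac:(lia)). assert (Hr2 := node_range (S j) ltac:(lia)).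
  assert (I1 : forall y, a <= y <= b -> u1 y 0 = u0 y) by apply C1.
  assert (I2 : forall y, a <= y <= b -> u2 y 0 = u0 y) by apply C2.
  assert (Hm : 0 <= t <= Rmin T1 T2) by (split; [lra|now apply Rmin_glb]).
  assert (Hm' : 0 <= t <= Rmin T2 T1) by (split; [lra|now apply Rmin_glb]).
  unfold ux. apply Derive_ext_loc.
  apply (locally_itv (node a b k xs j) (node a b k xs (S j))); auto.
  intros y Hy.
  pose proof (psol_unique_le _ _ _ _ _ _ _ _ _ _ _ _ W1 W2 ltac:(intros z Hz; simpl; rewrite I1, I2; lra) y t ltac:(lra) Hm) as L1.
  pose proof (psol_unique_le _ _ _ _ _ _ _ _ _ _ _ _ W2 W1 ltac:(intros z Hz; simpl; rewrite I1, I2; lra) y t ltac:(lra) Hm') as L2.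
  simpl in L1, L2. destruct Hsg; subst sg; lra.
Qed.

Lemma classical_ux_bounded (T t0 : R) (u : R -> R -> R) :
  classical_solution a b T u0 (zset k xs) u -> 0 < t0 < T ->
  exists M, forall x t, a < x < b -> ~ zset k xs x -> t0 < t < T -> Rabs (ux u x t) <= M.
Proof.
  intros C Ht0.
  assert (H : forall n, (n <= S k)%nat -> exists M, forall j x t, (j < n)%nat ->
     node a b k xs j < x < node a b k xs (S j) -> t0 < t < T -> Rabs (ux u x t) <= M).
  { induction n as [|n IH]; intros Hn; [exists 0; intros; lia|].
    destruct (IH ltac:(lia)) as [M1 H1].
    destruct (node_psol n ltac:(lia)) as [sg [Hsg HW]].
    destruct (HW T u ltac:(lra) C) as [v W].
    destruct (psol_dx_bounded _ _ T t0 _ _ _ _ W ltac:(lra)) as [M2 H2].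
    exists (Rmax M1 M2). intros j x t Hj Hx Ht.
    pose proof (Rmax_l M1 M2). pose proof (Rmax_r M1 M2).
    destruct (Nat.eq_dec j n) as [->|Hne].
    - specialize (H2 x t Hx ltac:(lra)). rewrite Rabs_mult in H2.
      replace (Rabs sg) with 1 in H2 by (destruct Hsg as [->| ->]; [rewrite Rabs_R1|rewrite Rabs_left]; lra). lra.
    - specialize (H1 j x t ltac:(lia) Hx Ht). lra. }
  destruct (H (S k) (Nat.le_refl _)) as [M HM]. exists M. intros x t Hx Hn Ht.
  destruct (node_cover x Hx Hn) as [j [Hj Hxj]]. apply (HM j); auto; lia.
Qed.

Lemma slope_law_sign (T sg : R) (g : R -> R) : sg = 1 \/ sg = -1 -> slope_law T g -> slope_law T (fun t => sg * g t).
Proof.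
  intros Hsg H s t Hs Ht Hne.
  destruct (H s t Hs Ht ltac:(intros E; apply Hne; rewrite E; ring)) as [A B].
  split; [destruct Hsg; subst; lra|]. intros eps He. destruct (B eps He) as [del [Hd F]].
  exists del. split; auto. intros r Hr Hrt. rewrite <- Rmult_minus_distr_l, Rabs_mult.
  replace (Rabs sg) with 1 by (destruct Hsg as [->| ->]; [rewrite Rabs_R1|rewrite Rabs_left]; lra).
  rewrite Rmult_1_l. now apply F.
Qed.

Lemma sign_close (sg y g eps : R) : sg = 1 \/ sg = -1 -> Rabs (sg * y - g) < eps -> Rabs (y - sg * g) < eps.
Proof. intros [->| ->] H; apply Rabs_lt_between; apply Rabs_lt_between in H; lra. Qed.

Lemma classical_zero_l (i : nat) (T : R) (u : R -> R -> R) :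
  (i < k)%nat -> 0 < T -> classical_solution a b T u0 (zset k xs) u ->
  exists g, slope_law T g /\
    forall t, 0 < t <= T -> filterlim (fun y => ux u y t) (at_left (xs i)) (locally (g t)).
Proof.
  intros Hi HT C.
  destruct (node_psol i ltac:(lia)) as [sg [Hsg HW]]. destruct (HW T u HT C) as [v W].
  rewrite node_S in W by auto. specialize (Hin i Hi).
  destruct (slope_law_r _ _ T _ _ _ _ W) as [g [G1 G2]].
  { intros t Ht. apply Rmult_eq_0_compat_l. apply C; [lra|auto|]. exists i. auto. }
  exists (fun t => sg * g t). split; [now apply slope_law_sign|].
  intros t Ht P [e He]. destruct (G2 t e Ht (cond_pos e)) as [del [Hd F]].
  exists (mkposreal del (proj1 Hd)). intros y Hy Hlt. apply He. change (Rabs (ux u y t - sg * g t) < e).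
  apply sign_close; auto. apply F.
  change (Rabs (y - xs i) < del) in Hy. apply Rabs_lt_between in Hy. lra.
Qed.

Lemma classical_zero_r (i : nat) (T : R) (u : R -> R -> R) :
  (i < k)%nat -> 0 < T -> classical_solution a b T u0 (zset k xs) u ->
  exists g, slope_law T g /\
    forall t, 0 < t <= T -> filterlim (fun y => ux u y t) (at_right (xs i)) (locally (g t)).
Proof.
  intros Hi HT C.
  destruct (node_psol (S i) ltac:(lia)) as [sg [Hsg HW]]. destruct (HW T u HT C) as [v W].
  rewrite node_S in W by auto. specialize (Hin i Hi).
  destruct (slope_law_l _ _ T _ _ _ _ W) as [g [G1 G2]].
  { intros t Ht. apply Rmult_eq_0_compat_l. apply C; [lra|auto|]. exists i. auto. }
  exists (fun t => sg * g t). split; [now apply slope_law_sign|].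
  intros t Ht P [e He]. destruct (G2 t e Ht (cond_pos e)) as [del [Hd F]].
  exists (mkposreal del (proj1 Hd)). intros y Hy Hlt. apply He. change (Rabs (ux u y t - sg * g t) < e).
  apply sign_close; auto. apply F.
  change (Rabs (y - xs i) < del) in Hy. apply Rabs_lt_between in Hy. lra.
Qed.

(** The quantifier over [T] and [u] stands inside, after [tau]: this is the independence of [T]. *)
Definition threshold_at (F : (R -> Prop) -> Prop) (tau : Rbar) : Prop :=
  Rbar_le (Finite 0) tau /\
  forall T u, 0 < T -> classical_solution a b T u0 (zset k xs) u -> exists g : R -> R,
    (forall t, 0 < t <= T -> filterlim (fun y => ux u y t) F (locally (g t))) /\
    (forall t, 0 < t <= T -> (Rbar_lt (Finite t) tau -> g t = 0) /\ (Rbar_lt tau (Finite t) -> g t <> 0)) /\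
    (forall t, 0 < t <= T -> Finite t <> tau ->
       filterlim g (within (fun s => 0 < s <= T) (locally t)) (locally (g t))).

Lemma threshold_l (i : nat) : (i < k)%nat -> exists tau, threshold_at (at_left (xs i)) tau.
Proof.
  intros Hi. apply threshold.
  - typeclasses eauto.
  - intros T u HT C. now apply classical_zero_l.
  - intros T1 u1 T2 u2 t H1 H2 C1 C2 Ht Ht1 Ht2.
    pose proof (node_lt i ltac:(lia)) as L. rewrite (node_S a b k xs i) in L by auto.
    exists (mkposreal (xs i - node a b k xs i) ltac:(lra)). intros y Hy Hlt.
    change (Rabs (y - xs i) < xs i - node a b k xs i) in Hy. apply Rabs_lt_between in Hy.
    apply (classical_ux_unique T1 T2 u1 u2 i); auto; [lia|]. rewrite node_S by auto. lra.
Qed.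

Lemma threshold_r (i : nat) : (i < k)%nat -> exists tau, threshold_at (at_right (xs i)) tau.
Proof.
  intros Hi. apply threshold.
  - typeclasses eauto.
  - intros T u HT C. now apply classical_zero_r.
  - intros T1 u1 T2 u2 t H1 H2 C1 C2 Ht Ht1 Ht2.
    pose proof (node_lt (S i) ltac:(lia)) as L. rewrite (node_S a b k xs i) in L by auto.
    exists (mkposreal (node a b k xs (S (S i)) - xs i) ltac:(lra)). intros y Hy Hlt.
    change (Rabs (y - xs i) < node a b k xs (S (S i)) - xs i) in Hy. apply Rabs_lt_between in Hy.
    apply (classical_ux_unique T1 T2 u1 u2 (S i)); auto. rewrite node_S by auto. lra.
Qed.

End Nodes.

Theorem theorem3p2 (a b : R) (u0 : R -> R) (k : nat) (xs : nat -> R) :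
  a < b ->
  (forall x, a <= x <= b ->
     filterlim u0 (within (fun y => a <= y <= b) (locally x)) (locally (u0 x))) ->
  u0 a = -1 -> u0 b = 1 ->
  (forall i j, (i < j < k)%nat -> xs i < xs j) ->
  (forall i, (i < k)%nat -> a < xs i < b) ->
  (forall y, a < y < b -> (u0 y = 0 <-> zset k xs y)) ->
  (forall i, (i < k)%nat -> exists d, 0 < d /\
     forall y z, xs i - d < y < xs i -> xs i < z < xs i + d -> u0 y * u0 z < 0) ->
  exists taum taup : nat -> Rbar,
    (forall i, (i < k)%nat -> Rbar_le (Finite 0) (taum i) /\ Rbar_le (Finite 0) (taup i)) /\
    forall (T : R) (u : R -> R -> R), 0 < T ->
      classical_solution a b T u0 (zset k xs) u ->
      (* (i) u_x bounded on ((a,b) \ N0) x (t0,T) *)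
      (forall t0, 0 < t0 < T -> exists M : R, forall x t,
          a < x < b -> ~ zset k xs x -> t0 < t < T -> Rabs (ux u x t) <= M) /\
      (* (i)+(ii): one-sided limits of u_x at each x_i *)
      (forall i, (i < k)%nat ->
         exists gm gp : R -> R,
           (forall t, 0 < t <= T ->
              filterlim (fun y => ux u y t) (at_left (xs i)) (locally (gm t)) /\
              filterlim (fun y => ux u y t) (at_right (xs i)) (locally (gp t))) /\
           (forall t, 0 < t <= T ->
              (Rbar_lt (Finite t) (taum i) -> gm t = 0) /\
              (Rbar_lt (taum i) (Finite t) -> gm t <> 0) /\
              (Rbar_lt (Finite t) (taup i) -> gp t = 0) /\
              (Rbar_lt (taup i) (Finite t) -> gp t <> 0)) /\
           (forall t, 0 < t <= T -> Finite t <> taum i ->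
              filterlim gm (within (fun s => 0 < s <= T) (locally t)) (locally (gm t))) /\
           (forall t, 0 < t <= T -> Finite t <> taup i ->
              filterlim gp (within (fun s => 0 < s <= T) (locally t)) (locally (gp t)))).
Proof.
  intros Hab _ Hua Hub Hinc Hin Hu0 _.
  (* The statement asks for functions of i, so a threshold is chosen for each index by [epsilon];
     its specification is available for i < k. *)
  set (taum := fun i => epsilon (inhabits p_infty) (@threshold_at a b k xs u0 (at_left (xs i)))).
  set (taup := fun i => epsilon (inhabits p_infty) (@threshold_at a b k xs u0 (at_right (xs i)))).
  assert (Hm : forall i, (i < k)%nat -> @threshold_at a b k xs u0 (at_left (xs i)) (taum i)).
  { intros i Hi. apply epsilon_spec. now apply threshold_l. }
  assert (Hp : forall i, (i < k)%nat -> @threshold_at a b k xs u0 (at_right (xs i)) (taup i)).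
  { intros i Hi. apply epsilon_spec. now apply threshold_r. }
  exists taum, taup. split.
  { intros i Hi. split; [apply (Hm i Hi)|apply (Hp i Hi)]. }
  intros T u HT C. split.
  - intros t0 Ht0. now apply (classical_ux_bounded Hab Hinc Hin Hua Hub Hu0).
  - intros i Hi.
    destruct (proj2 (Hm i Hi) T u HT C) as [gm [M1 [M2 M3]]].
    destruct (proj2 (Hp i Hi) T u HT C) as [gp [P1 [P2 P3]]].
    exists gm, gp. repeat split; auto; try (now apply M2); now apply P2.
Qed.
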